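(* Let $\mathfrak{b}$ be a Borel subalgebra of the complex simple Lie algebra of type $E_6$. For each integer $m\geq 0$ let $N(m)$ be the number of abelian ideals of $\mathfrak{b}$ of dimension $m$. Then $$(N(0),N(1),\ldots,N(16))=(1,1,1,1,2,3,3,4,6,7,8,10,7,4,2,2,2)$$ and $N(m)=0$ for $m\geq 17$; the total number of abelian ideals of $\mathfrak{b}$ is $64$.
   Context: An abelian ideal of $\mathfrak{b}$ is an ideal $I$ of the Lie algebra $\mathfrak{b}$ with $[I,I]=0$ (the zero ideal is included); dimension is over $\mathbb{C}$. *)

(* Defs.v *)
From HB Require Import structures.
From mathcomp Require Import all_boot all_order all_algebra.
From mathcomp Require Import complex.
From mathcomp Require Import boolp classical_sets functions cardinality reals.

Set Implicit Arguments.
Unset Strict Implicit.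
Unset Printing Implicit Defensive.

Import Order.TTheory GRing.Theory Num.Theory.
Local Open Scope ring_scope.

HB.mixin Record isLieAlgebra (K : fieldType) L of Vector K L := {
  lie : L -> L -> L;
  lie_linearl : forall y : L, linear (lie^~ y);
  lie_linearr : forall x : L, linear (lie x);
  liexx : forall x : L, lie x x = 0;
  lie_jacobi : forall x y z : L,
    lie x (lie y z) + lie y (lie z x) + lie z (lie x y) = 0
}.

#[short(type="lieAlgType")]
HB.structure Definition LieAlgebra (K : fieldType) :=
  { L of isLieAlgebra K L & Vector K L }.

Section Subspaces.
Variables (K : fieldType) (g : lieAlgType K).
Implicit Types (U V W I b : {vspace g}) (u v : g).

(* [U, V], the linear span of all brackets of an element of U with an element
   of V; by bilinearity it is enough to take bases (see lie_prod_subP). *)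
Definition lie_prod U V : {vspace g} :=
  <<[seq lie u v | u <- vbasis U, v <- vbasis V]>>%VS.

Lemma lie_prod_subP U V W :
  (forall u v, u \in U -> v \in V -> lie u v \in W)
  <-> (lie_prod U V <= W)%VS.
Proof.
split=> [UVW | /span_subvP sUV u v /coord_vbasis -> /coord_vbasis ->].
  apply/span_subvP=> _ /allpairsP[[u v] /= [uU vV ->]].
  by apply: UVW; apply: vbasis_mem.
have lieDl (y : g) : {morph (fun x => lie x y) : a c / a + c}.
  by move=> a c; have := lie_linearl y 1 a c; rewrite /= !scale1r.
have lieDr (x : g) : {morph (fun y => lie x y) : a c / a + c}.
  by move=> a c; have := lie_linearr x 1 a c; rewrite /= !scale1r.
have lie0l (y : g) : lie 0 y = 0.
  by have /eqP := lieDl y 0 0; rewrite addr0 -subr_eq subrr eq_sym => /eqP.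
have lie0r (x : g) : lie x 0 = 0.
  by have /eqP := lieDr x 0 0; rewrite addr0 -subr_eq subrr eq_sym => /eqP.
have lieZl (y : g) (k : K) (x : g) : lie (k *: x) y = k *: lie x y.
  by have := lie_linearl y k x 0; rewrite /= lie0l !addr0.
have lieZr (x : g) (k : K) (y : g) : lie x (k *: y) = k *: lie x y.
  by have := lie_linearr x k y 0; rewrite /= lie0r !addr0.
rewrite (big_morph _ (lieDl _) (lie0l _)); apply: memv_suml => i _.
rewrite lieZl; apply: memvZ.
rewrite (big_morph _ (lieDr _) (lie0r _)); apply: memv_suml => j _.
rewrite lieZr; apply: memvZ; apply: sUV.
by apply/allpairsP; exists ((vbasis U)`_i, (vbasis V)`_j); split=> //=;
  apply: mem_nth; rewrite size_tuple.
Qed.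

Definition lie_subalgebra U : Prop := (lie_prod U U <= U)%VS.

Definition lie_ideal b I : Prop := (I <= b)%VS /\ (lie_prod b I <= I)%VS.

Definition lie_abelian U : Prop := lie_prod U U = 0%VS.

Definition derived_series U (n : nat) : {vspace g} :=
  iter n (fun V => lie_prod V V) U.

Definition lie_solvable U : Prop := exists n, derived_series U n = 0%VS.

Definition borel_subalgebra b : Prop :=
  [/\ lie_subalgebra b, lie_solvable b &
      forall U, lie_subalgebra U -> lie_solvable U -> (b <= U)%VS -> U = b].

Definition abelian_ideals b : set {vspace g} :=
  [set I | lie_ideal b I /\ lie_abelian I]%classic.

End Subspaces.

Definition lie_simple (K : fieldType) (g : lieAlgType K) : Prop :=
  ~ lie_abelian (fullv : {vspace g}) /\
  forall I : {vspace g}, lie_ideal fullv I -> I = 0%VS \/ I = fullv.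

(* The Dynkin diagram E6 in Bourbaki's labelling, shifted to start from 0:
        0 - 2 - 3 - 4 - 5
                |
                1          *)
Definition E6_edges : seq (nat * nat) :=
  [:: (0, 2); (2, 3); (3, 4); (4, 5); (1, 3)]%N.

Definition E6_cartan : 'M[int]_6 :=
  \matrix_(i, j)
    if i == j then 2
    else if ((val i, val j) \in E6_edges) || ((val j, val i) \in E6_edges)
    then -1
    else 0.

(* g is generated as a Lie algebra by a family (e_i, h_i, f_i) satisfying the
   Chevalley-Serre relations of the Cartan matrix A = (<alpha_i^v, alpha_j>). *)
Definition chevalley_generators (K : fieldType) (g : lieAlgType K) (n : nat)
    (A : 'M[int]_n) (e h f : 'I_n -> g) : Prop :=
  [/\ [/\ forall i j, lie (h i) (h j) = 0,
          forall i j, lie (e i) (f j) = if i == j then h i else 0,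
          forall i j, lie (h i) (e j) = (A i j)%:~R *: e j &
          forall i j, lie (h i) (f j) = - ((A i j)%:~R *: f j)],
      forall i j, i != j -> iter `|1 - A i j|%N (lie (e i)) (e j) = 0,
      forall i j, i != j -> iter `|1 - A i j|%N (lie (f i)) (f j) = 0 &
      forall U : {vspace g}, lie_subalgebra U ->
        (forall i, [/\ e i \in U, h i \in U & f i \in U]) -> U = fullv].

(* When K has characteristic 0, Serre's theorem says that these conditions
   determine g up to isomorphism. *)
Definition simple_of_type_E6 (K : fieldType) (g : lieAlgType K) : Prop :=
  lie_simple g /\
  exists e h f : 'I_6 -> g, chevalley_generators E6_cartan e h f.

(* Main.v *)
Require Import Defs.
From HB Require Import structures.
From mathcomp Require Import all_boot all_order all_algebra.
From mathcomp Require Import complex.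
From mathcomp Require Import boolp classical_sets functions cardinality reals.
From mathcomp Require Import zify ring.

Set Implicit Arguments.
Unset Strict Implicit.
Unset Printing Implicit Defensive.

Import Order.TTheory GRing.Theory Num.Theory.
Local Open Scope ring_scope.

(** Let g be simple of type E6 and let b be a Borel subalgebra.

    Suppose first that b is the standard Borel subalgebra, spanned by a Cartan
    subalgebra and the positive root vectors.  An abelian ideal of b is stable
    under the Cartan subalgebra, so it is the sum of its intersection with the
    latter and of root spaces; an element of this intersection brackets every
    e_j into a multiple of e_j inside the ideal, so it vanishes because the
    ideal is abelian.  Hence abelian ideals correspond to the sets S of positive
    roots that are closed under adding positive roots and such that no two
    elements of S add up to a root ([abelian_ideal_root_span],
    [root_span_ideal]).  A backtracking search, from the highest root down,
    lists all of them ([ideal_supports_complete]): there are 64, with the stated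
    sizes.

    Two reductions lead to this case.

    The first one is the structure of g ([E6_basis_exists]).  Root vectors are
    defined as iterated brackets of the generators, with signs given by a
    bimultiplicative cocycle on the root lattice.  The brackets [f_j, E_a] are
    computed by induction on the height of a.  For [e_i, E_a], the difference z
    between it and its expected value is killed by all the f_j, so the ideal
    generated by z lies in positive height; it is not g, and therefore z = 0
    since g is simple ([killed_by_f]).  So the whole bracket is given by an
    explicit table, on which everything else is computed.

    The second one is the conjugacy of Borel subalgebras ([borel_standard]).  A
    solvable subalgebra U is moved into the standard Borel subalgebra by an
    automorphism, in two steps that replace a fixed point theorem on the flag
    variety.  The elements x with [x, [x, z]] = <x, z> x for all z, for a fixed
    invariant form < , >, form a cone stable under limits of one-parameter
    groups.  Combining this with the induction that proves Lie's theorem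
    ([lie_common_eigenvector], [quadratic_cone_eigenvector]) shows that U
    normalizes the line of such an x.  These elements are all conjugate to
    multiples of the highest root vector ([extremal_conjugate]), whose line is
    normalized by the parabolic subalgebra of elements of nonnegative degree in
    the simple root alpha_1.  That subalgebra maps to gl_6, acting on a space of
    dimension 6 where Lie's theorem, one vector at a time, gives a flag stable
    under U ([flag_step]); elementary matrices lift to automorphisms of g and
    move this flag to the standard one. *)

(** * Subspaces and generalized eigenvectors *)

(** Among the subspaces on which P holds, one of largest dimension contains every
    vector with P: otherwise the vector could be added to it. *)
Lemma vspace_of_pred (K : fieldType) (V : vectType K) (P : V -> Prop) :
  P 0 -> (forall a u v, P u -> P v -> P (a *: u + v)) ->
  exists E : {vspace V}, forall v, v \in E <-> P v.
Proof.
move=> P0 Plin.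
pose Q n := `[< exists2 E : {vspace V}, \dim E = n & forall v, v \in E -> P v >].
have exQ : exists n, Q n.
  exists 0%N; apply/asboolP; exists 0%VS; first by rewrite dimv0.
  by move=> v /[!memv0] /eqP ->.
have leQ n : Q n -> (n <= \dim {: V})%N.
  by move=> /asboolP[E <- _]; apply/dimvS/subvf.
case: (ex_maxnP exQ leQ) => n /asboolP[E dE EP] maxn.
exists E => v; split=> [/EP // | Pv].
have sE : (E <= E + <[v]>)%VS by apply: addvSl.
have : Q (\dim (E + <[v]>)).
  apply/asboolP; exists (E + <[v]>)%VS => // u /memv_addP[x xE [y /vlineP[a ->] ->]].
  by rewrite addrC; apply: Plin => //; apply: EP.
move=> /maxn; rewrite -dE => le_dim.
have /eqP -> : E == (E + <[v]>)%VS by rewrite eqEdim sE.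
by apply: (subvP (addvSr _ _)); apply: memv_line.
Qed.

Section GeneralizedEigenvectors.
Variables (K : fieldType) (V : lmodType K) (T : {linear V -> V}).

Definition shift s v : V := T v - s *: v.

Fact shift_is_linear s : linear (shift s).
Proof.
move=> a u v; rewrite /shift linearP !scalerDr !scalerN !scalerA.
by rewrite [s * a]mulrC opprD addrACA.
Qed.
HB.instance Definition _ s := GRing.isLinear.Build K V V _ (shift s) (shift_is_linear s).

Definition gen_eigen s v := exists k, iter k (shift s) v = 0.

Lemma iter_shift_lin s k a u v :
  iter k (shift s) (a *: u + v) = a *: iter k (shift s) u + iter k (shift s) v.
Proof. by elim: k => //= k ->; rewrite linearP. Qed.

Lemma iter_shift0 s k : iter k (shift s) 0 = 0.
Proof. by elim: k => //= k ->; rewrite linear0. Qed.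

Lemma iter_shift_le s k l v :
  (k <= l)%N -> iter k (shift s) v = 0 -> iter l (shift s) v = 0.
Proof. by move=> /subnK <- kv; rewrite iterD kv iter_shift0. Qed.

Lemma iter_shift_sum s k (I : Type) (r : seq I) (P : pred I) (F : I -> V) :
  iter k (shift s) (\sum_(i <- r | P i) F i)
  = \sum_(i <- r | P i) iter k (shift s) (F i).
Proof.
have Dm : {morph iter k (shift s) : u v / u + v}.
  by move=> u v; have := iter_shift_lin s k 1 u v; rewrite !scale1r.
exact: (big_morph _ Dm (iter_shift0 s k)).
Qed.

Lemma shiftC s t v : shift s (shift t v) = shift t (shift s v).
Proof.
have TB a x y : T (x - a *: y) = T x - a *: T y by rewrite linearB linearZ_LR.
rewrite /shift !TB !scalerBr !scalerA [t * s]mulrC !opprB !addrA.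
by rewrite addrAC [RHS]addrAC; congr (_ + _); rewrite addrAC.
Qed.

Lemma iter_shiftC s t k v : iter k (shift s) (shift t v) = shift t (iter k (shift s) v).
Proof. by elim: k => //= k ->; rewrite shiftC. Qed.

Lemma gen_eigen0 s : gen_eigen s 0. Proof. by exists 0%N. Qed.

Lemma gen_eigen_lin s a u v :
  gen_eigen s u -> gen_eigen s v -> gen_eigen s (a *: u + v).
Proof.
move=> [k ku] [l lv]; exists (k + l)%N; rewrite iter_shift_lin.
rewrite (iter_shift_le _ ku) ?leq_addr // (iter_shift_le _ lv) ?leq_addl //.
by rewrite scaler0 addr0.
Qed.

Lemma gen_eigenZ s a u : gen_eigen s u -> gen_eigen s (a *: u).
Proof. by move=> ku; rewrite -[_ *: _]addr0; apply: gen_eigen_lin (gen_eigen0 s). Qed.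

Lemma gen_eigenD s u v : gen_eigen s u -> gen_eigen s v -> gen_eigen s (u + v).
Proof. by move=> ku kv; rewrite -[u]scale1r; apply: gen_eigen_lin. Qed.

Lemma gen_eigen_sum s (I : Type) (r : seq I) (P : pred I) (F : I -> V) :
  (forall i, P i -> gen_eigen s (F i)) -> gen_eigen s (\sum_(i <- r | P i) F i).
Proof. by move=> gF; apply: big_ind => //; [apply: gen_eigen0 | apply: gen_eigenD]. Qed.

Lemma gen_eigen_shift s t v : gen_eigen s v -> gen_eigen s (shift t v).
Proof. by move=> [k kv]; exists k; rewrite iter_shiftC kv linear0. Qed.

Lemma gen_eigen_shiftV s v : gen_eigen s (shift s v) -> gen_eigen s v.
Proof. by move=> [k kv]; exists k.+1; rewrite iterSr. Qed.

Lemma eigen_gen_eigen s v : T v = s *: v -> gen_eigen s v.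
Proof. by move=> Tv; exists 1%N; rewrite /= /shift Tv subrr. Qed.

(** T - t is invertible on the generalized eigenvectors for s, because it is
    s - t plus a locally nilpotent operator. *)
Lemma gen_eigen_shift_surj s t v : s != t -> gen_eigen s v ->
  exists2 u, gen_eigen s u & shift t u = v.
Proof.
move=> st [k]; elim: k v => [|k IHk] v /=.
  by move=> ->; exists 0; [apply: gen_eigen0 | rewrite linear0].
rewrite -iterS iterSr => /[dup] kv /IHk[u gu uv].
have gv : gen_eigen s v by exists k.+1; rewrite iterSr.
have stU : s - t \is a GRing.unit by rewrite unitfE subr_eq0.
exists ((s - t)^-1 *: (v - u)).
  by apply/gen_eigenZ/gen_eigenD => //; rewrite -scaleN1r; apply: gen_eigenZ.
rewrite linearZ linearB /= uv /shift opprB.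
rewrite [_ + (_ - _)]addrC.
rewrite subrKA.
by rewrite -scalerBl scalerA mulVr ?scale1r.
Qed.

Section StableSubspace.
Variable Z : V -> Prop.
Hypotheses (Z0 : Z 0) (Zlin : forall a u v, Z u -> Z v -> Z (a *: u + v))
  (ZT : forall v, Z v -> Z (T v)).

Lemma stable_shift s v : Z v -> Z (shift s v).
Proof. by move=> Zv; rewrite /shift addrC -scaleNr; apply: Zlin => //; apply: ZT. Qed.

Lemma stable_gen_eigen_shift s t v : s != t -> gen_eigen s v -> Z (shift t v) -> Z v.
Proof.
move=> st [k]; elim: k v => [|k IHk] v; first by move=> /= -> _.
rewrite iterSr => kv Zv.
have Zu : Z (shift s v) by apply: IHk kv _; rewrite shiftC; apply: stable_shift.
have := Zlin (-1) Zu Zv; rewrite scaleN1r /shift opprB subrKA.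
rewrite -scalerBl => /(Zlin (s - t)^-1) /(_ Z0).
by rewrite addr0 scalerA mulVf ?subr_eq0 // scale1r.
Qed.

Lemma stable_gen_eigen_iter s t k v :
  s != t -> gen_eigen s v -> Z (iter k (shift t) v) -> Z v.
Proof.
move=> st; elim: k v => //= k IHk v gv; rewrite -iterS iterSr => Zk.
by apply: (stable_gen_eigen_shift st gv); apply: IHk Zk; apply: gen_eigen_shift.
Qed.

(** A T-stable subspace contains the components of its elements: apply a power
    of T - s0 to remove the component for s0, and argue by induction.  With the
    zero subspace this is the independence of generalized eigenspaces. *)
Lemma stable_components (r : seq K) (F : K -> V) :
    uniq r -> (forall s, gen_eigen s (F s)) ->
  Z (\sum_(s <- r) F s) -> {in r, forall s, Z (F s)}.
Proof.
elim: r F => [//|s0 r IHr] F /= /andP[s0r ur] gF; rewrite big_cons => ZF.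
have [k ks0] := gF s0.
have Zr : {in r, forall s, Z (F s)}.
  have /(IHr _ ur) Zk : Z (\sum_(s <- r) iter k (shift s0) (F s)).
    rewrite -iter_shift_sum; have := iter_shift_lin s0 k 1 (F s0) (\sum_(s <- r) F s).
    rewrite ks0 scaler0 add0r scale1r => <-.
    by elim: (k) => //= l; apply: stable_shift.
  move=> s sr; have s_s0 : s != s0 by apply: contraNneq s0r => <-.
  apply: (stable_gen_eigen_iter s_s0 (gF s)); apply: (Zk _ s sr) => t.
  by elim: (k) => //= l; apply: gen_eigen_shift.
move=> s; rewrite inE => /predU1P[->|]; last exact: Zr.
have ZS : Z (\sum_(s <- r) F s).
  rewrite big_seq; elim/big_ind: _ => [//|u v Zu Zv|u /Zr //].
  by rewrite -[u]scale1r; apply: Zlin.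
by have := Zlin (-1) ZS ZF; rewrite scaleN1r addrC addrK.
Qed.

(** The eigenvalues e i may be repeated; components with equal eigenvalues are
    then grouped together. *)
Lemma stable_components_fam (I : eqType) (r : seq I) (e : I -> K) (F : I -> V) :
    {in r, forall i, gen_eigen (e i) (F i)} ->
  Z (\sum_(i <- r) F i) -> forall s, Z (\sum_(i <- r | e i == s) F i).
Proof.
move=> gF; pose es := undup (map e r).
rewrite (_ : \sum_(i <- r) F i = \sum_(s <- es) \sum_(i <- r | e i == s) F i); last first.
  rewrite (exchange_big_dep xpredT) //= big_seq [RHS]big_seq.
  apply: eq_bigr => i ir; rewrite big_mkcond /= (bigD1_seq (e i)) ?undup_uniq //=.
    by rewrite eqxx big1 ?addr0 // => s; rewrite eq_sym => /negPf ->.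
  by rewrite mem_undup map_f.
move=> ZS s; have [sr|] := boolP (s \in es).
  apply: (@stable_components es (fun s => \sum_(i <- r | e i == s) F i)) => //.
    exact: undup_uniq.
  by move=> t; rewrite big_seq_cond; apply: gen_eigen_sum => i /andP[ir /eqP <-]; apply: gF.
rewrite mem_undup => sr; rewrite big_seq_cond big1 // => i /andP[ir /eqP ei].
by case/negP: sr; rewrite -ei map_f.
Qed.

End StableSubspace.

(** The value p(T) v, for a T that need not belong to a ring of operators. *)
Definition poly_act (p : {poly K}) v : V := \sum_(i < size p) p`_i *: iter i T v.

Lemma poly_act_widen n (p : {poly K}) v : (size p <= n)%N ->
  poly_act p v = \sum_(i < n) p`_i *: iter i T v.
Proof.
move=> le_pn; rewrite /poly_act (big_ord_widen n (fun i => p`_i *: iter i T v)) //.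
rewrite big_mkcond; apply: eq_bigr => i _; case: ltnP => // ge_i.
by rewrite nth_default // scale0r.
Qed.

Lemma poly_act_XsubC (p : {poly K}) z v : poly_act (('X - z%:P) * p) v = poly_act p (shift z v).
Proof.
have szM : (size (('X - z%:P) * p)%R <= (size p).+1)%N.
  by apply: leq_trans (size_polyMleq _ _) _; rewrite size_XsubC.
have iterT i : iter i T (shift z v) = iter i.+1 T v - z *: iter i T v.
  by elim: i => //= i ->; rewrite linearB linearZ.
rewrite (poly_act_widen _ szM) [RHS](@poly_act_widen (size p)) //.
under eq_bigr do rewrite mulrBl coefB coefXM coefCM scalerBl.
rewrite sumrB big_ord_recl /= scale0r add0r big_ord_recr /= nth_default //.
rewrite mulr0 scale0r addr0 -sumrB; apply: eq_bigr => i _.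
by rewrite iterT scalerBr scalerA [z * _]mulrC.
Qed.

Lemma poly_act_prod (r : seq K) v :
  poly_act (\prod_(z <- r) ('X - z%:P)) v = foldl (fun u z => shift z u) v r.
Proof.
elim: r v => [|z r IHr] v; last by rewrite big_cons poly_act_XsubC IHr.
by rewrite big_nil /poly_act size_poly1 big_ord1 coef1 scale1r.
Qed.

(** Induction on the annihilating product: if (T - t) v is decomposed, so is v
    up to a generalized eigenvector for t. *)
Lemma gen_eigen_decomp_roots (rs : seq K) v :
    foldl (fun u z => shift z u) v rs = 0 ->
  exists r (F : K -> V), [/\ uniq r, forall s, gen_eigen s (F s) & v = \sum_(s <- r) F s].
Proof.
elim: rs v => [|t rs IHrs] v /=.
  move=> ->; exists [::], (fun=> 0); split=> // [s|]; last by rewrite big_nil.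
  exact: gen_eigen0.
move=> /IHrs[r [F [ur gF vF]]].
have /choice[G GP] s : exists u, gen_eigen s u /\ (s != t -> shift t u = F s).
  have [->|st] := eqVneq s t; first by exists 0; split=> //; apply: gen_eigen0.
  by have [u gu uF] := gen_eigen_shift_surj st (gF s); exists u.
pose r' := [seq s <- r | s != t].
pose w := v - \sum_(s <- r') G s.
have gw : gen_eigen t w.
  apply: gen_eigen_shiftV; rewrite linearB linear_sum /= vF.
  have -> : \sum_(s <- r') shift t (G s) = \sum_(s <- r | s != t) F s.
    rewrite big_filter; apply: eq_bigr => s st; exact: (GP s).2.
  rewrite (bigID (fun s => s != t)) /= addrC addrK.
  by apply: gen_eigen_sum => s; rewrite negbK => /eqP ->.
exists (t :: r'), (fun s => if s == t then w else G s); split.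
- by rewrite /= filter_uniq // andbT mem_filter eqxx.
- by move=> s; case: eqP => [->//|_]; apply: (GP s).1.
rewrite big_cons eqxx -[LHS](subrK (\sum_(s <- r') G s)) -/w; congr (_ + _).
by rewrite !big_filter; apply: eq_bigr => s /negPf ->.
Qed.

End GeneralizedEigenvectors.

(** More iterates of T on v than the dimension are dependent, so a nonzero
    polynomial in T kills v, and it splits. *)
Lemma gen_eigen_decomp (K : closedFieldType) (V : vectType K) (T : {linear V -> V}) v :
  exists r (F : K -> V),
    [/\ uniq r, forall s, gen_eigen T s (F s) & v = \sum_(s <- r) F s].
Proof.
pose n := (\dim {: V}).+1; pose X := [tuple iter i T v | i < n].
have : ~~ free X.
  by rewrite /free size_tuple neq_ltn (leq_ltn_trans (dimvS (subvf _))) // ltnS.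
move=> /freeP nfree.
have [k [kX k_neq0]] : exists k : 'I_n -> K,
    \sum_(i < n) k i *: X`_i = 0 /\ ~ forall i, k i = 0.
  by apply: contra_notP nfree => nk k kX; apply: contra_notP nk => nk; exists k.
pose p := \poly_(i < n) (if insub i is Some j then k j else 0).
have pE (i : 'I_n) : p`_i = k i by rewrite coef_poly ltn_ord valK.
have p0 : p != 0.
  by apply/eqP => p0; apply: k_neq0 => i; rewrite -pE p0 coef0.
have : poly_act T p v = 0.
  rewrite (@poly_act_widen _ _ _ n) ?size_poly // -[RHS]kX; apply: eq_bigr => i _.
  by rewrite pE (nth_map ord0) ?size_enum_ord // nth_enum_ord.
have [r pr] := closed_field_poly_normal p; rewrite pr.
have lc0 : lead_coef p != 0 by rewrite lead_coef_eq0.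
set q := \prod_(z <- r) _.
rewrite (@poly_act_widen _ _ _ (size q)) ?size_scale_leq //.
under eq_bigr do rewrite coefZ -scalerA.
rewrite -scaler_sumr => /eqP; rewrite scaler_eq0 (negPf lc0) /= => /eqP.
rewrite -/(poly_act T q v) poly_act_prod; exact: gen_eigen_decomp_roots.
Qed.

(** * Brackets and the common eigenvector of a solvable subalgebra *)

Section LieBasics.
Variables (K : fieldType) (g : lieAlgType K).
Implicit Types (x y z : g) (U W : {vspace g}).

HB.instance Definition _ x := GRing.isLinear.Build K g g _ (lie x) (lie_linearr x).

Lemma lieDr x : {morph lie x : y z / y + z}. Proof. exact: linearD. Qed.
Lemma lieZr x a y : lie x (a *: y) = a *: lie x y. Proof. exact: linearZ. Qed.
Lemma lie0r x : lie x 0 = 0. Proof. exact: linear0. Qed.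
Lemma lieNr x y : lie x (- y) = - lie x y. Proof. exact: linearN. Qed.
Lemma lieBr x y z : lie x (y - z) = lie x y - lie x z. Proof. exact: linearB. Qed.
Lemma lie_sumr x (I : Type) (r : seq I) (P : pred I) (F : I -> g) :
  lie x (\sum_(i <- r | P i) F i) = \sum_(i <- r | P i) lie x (F i).
Proof. exact: linear_sum. Qed.

Lemma lieC x y : lie x y = - lie y x.
Proof.
have := liexx (x + y); rewrite lieDr.
have Dl a b c : lie (a + b) c = lie a c + lie b c.
  by have := lie_linearl c 1 a b; rewrite !scale1r.
by rewrite !Dl !liexx add0r addr0 => /eqP; rewrite addrC addr_eq0 => /eqP.
Qed.

Lemma lieDl x : {morph lie^~ x : y z / y + z}.
Proof. by move=> y z; rewrite /= lieC lieDr opprD -!(lieC _ x). Qed.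
Lemma lieZl a x y : lie (a *: x) y = a *: lie x y.
Proof. by rewrite lieC lieZr -scalerN -lieC. Qed.
Lemma lie0l x : lie 0 x = 0. Proof. by rewrite lieC lie0r oppr0. Qed.
Lemma lieNl x y : lie (- x) y = - lie x y. Proof. by rewrite lieC lieNr -lieC. Qed.
Lemma lie_suml x (I : Type) (r : seq I) (P : pred I) (F : I -> g) :
  lie (\sum_(i <- r | P i) F i) x = \sum_(i <- r | P i) lie (F i) x.
Proof. by rewrite lieC lie_sumr -sumrN; apply: eq_bigr => i _; rewrite -lieC. Qed.

Lemma lie_lie x y z : lie x (lie y z) = lie (lie x y) z + lie y (lie x z).
Proof.
have := lie_jacobi x y z; rewrite [lie y (lie z x)]lieC [lie z x]lieC lieNl opprK.
rewrite [lie z (lie x y)]lieC [lie (lie x z) y]lieC => /eqP.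
by rewrite subr_eq0 => /eqP <-; rewrite subrK.
Qed.

Lemma lie_liel x y z : lie (lie x y) z = lie x (lie y z) - lie y (lie x z).
Proof. by rewrite [in RHS]lie_lie addrK. Qed.

Lemma lie_prod_mem U W u v : u \in U -> v \in W -> lie u v \in lie_prod U W.
Proof. by move: u v; apply/lie_prod_subP. Qed.

Lemma lie_prodS U1 U2 W1 W2 :
  (U1 <= U2)%VS -> (W1 <= W2)%VS -> (lie_prod U1 W1 <= lie_prod U2 W2)%VS.
Proof.
move=> /subvP sU /subvP sW; apply/lie_prod_subP => u v /sU uU /sW vW.
exact: lie_prod_mem.
Qed.

Lemma lie_subalgebraP U :
  lie_subalgebra U <-> (forall u v, u \in U -> v \in U -> lie u v \in U).
Proof. by split=> /lie_prod_subP. Qed.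

Lemma derived_seriesS U W n :
  (U <= W)%VS -> (derived_series U n <= derived_series W n)%VS.
Proof. by move=> sUW; elim: n => //= n IHn; apply: lie_prodS. Qed.

Lemma lie_solvableS U W : (U <= W)%VS -> lie_solvable W -> lie_solvable U.
Proof.
move=> sUW [n Wn]; exists n; apply/eqP; rewrite -subv0 -Wn; exact: derived_seriesS.
Qed.

End LieBasics.

Section WeightSpaces.
Variables (K : numClosedFieldType) (g : lieAlgType K) (V : vectType K).
Variable r : g -> {linear V -> V}.
Hypothesis r_linearl : forall v, linear (fun x => r x v).

Let rDl x y v : r (x + y) v = r x v + r y v.
Proof. by have := r_linearl v 1 x y; rewrite /= !scale1r. Qed.
Let r0l v : r 0 v = 0.
Proof. by apply: (addrI (r 0 v)); rewrite -rDl !addr0. Qed.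
Let rZl a x v : r (a *: x) v = a *: r x v.
Proof. by have := r_linearl v a x 0; rewrite /= r0l !addr0. Qed.
Let r_suml n (F : 'I_n -> g) v : r (\sum_i F i) v = \sum_i r (F i) v.
Proof. by apply: (big_morph (fun x => r x v)) => [x y|]; [apply: rDl | apply: r0l]. Qed.

(** Here v is a common eigenvector of I, with weight lam, and y normalizes I.
    On the span of v, r y v, r y (r y v), ... every u in I is triangular with
    diagonal lam u; the commutator [u, y], in I, has trace zero there. *)
Section TraceArgument.
Variables (I : {vspace g}) (y : g) (lam : g -> K) (v : V).
Hypothesis Iy : forall u, u \in I -> lie u y \in I.
Hypothesis r_lie : forall u, u \in I ->
  forall w, r (lie u y) w = r u (r y w) - r y (r u w).
Hypotheses (v_neq0 : v != 0) (rv : forall u, u \in I -> r u v = lam u *: v).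

Let w k := iter k (r y) v.
(* Decreasing order lets a first dependence be read off the head of the list. *)
Let X := fix X n := if n is k.+1 then w k :: X k else [::].

Let sizeX n : size (X n) = n. Proof. by elim: n => //= n ->. Qed.

Let X_tuple n : n.-tuple V := Tuple (introT eqP (sizeX n)).

Let subX m n : (m <= n)%N -> (<<X m>> <= <<X n>>)%VS.
Proof.
move=> /subnK <-; elim: (n - m)%N => //= k IHk.
by rewrite span_cons; apply: subv_trans IHk (addvSr _ _).
Qed.

Let memX k n : (k < n)%N -> w k \in <<X n>>%VS.
Proof.
by move=> lt_kn; apply: (subvP (subX lt_kn)); apply: memv_span; rewrite inE eqxx.
Qed.

Let nthX n (i : 'I_n) : (X n)`_i = w (n.-1 - i).
Proof.
elim: n i => [[]//|n IHn] [[|i] lt_i] /=; first by rewrite subn0.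
by have := IHn (Ordinal (lt_i : i < n)%N) => /= ->; case: n {IHn} lt_i => //= n _; rewrite subSS.
Qed.

Let r_y_span n s : s \in <<X n>>%VS -> r y s \in <<X n.+1>>%VS.
Proof.
move=> /(@coord_span _ _ _ (X_tuple n)) ->; rewrite linear_sum; apply: memv_suml => i _.
rewrite linearZ; apply: memvZ; rewrite /= nthX.
have lt_k : ((n.-1 - i).+1 < n.+1)%N by have := ltn_ord i; lia.
exact: (memX lt_k).
Qed.

Let triangular k u : u \in I -> r u (w k) - lam u *: w k \in <<X k>>%VS.
Proof.
elim: k u => [|k IHk] u uI; first by rewrite /w /= rv // subrr mem0v.
have -> : r u (w k.+1) - lam u *: w k.+1
    = (r (lie u y) (w k) - lam (lie u y) *: w k) + lam (lie u y) *: w k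
      + r y (r u (w k) - lam u *: w k).
  rewrite subrK r_lie // [r y (_ - _)]linearB [r y (_ *: _)]linearZ addrA.
  by rewrite subrK.
apply: rpredD; last exact/r_y_span/IHk.
apply: rpredD; last by apply: memvZ; apply: memX.
by apply: (subvP (subX (leqnSn k))); apply: IHk; apply: Iy.
Qed.

Let exists_dep : exists n, ~~ free (X n.+1).
Proof.
exists (\dim {: V}); rewrite /free sizeX neq_ltn ltnS.
by rewrite (dimvS (subvf _)).
Qed.

Lemma weight_of_commutator u : u \in I -> lam (lie u y) = 0.
Proof.
move=> uI; case: (ex_minnP exists_dep) => n dep minn.
have freeX : free (X n).
  case: n dep minn => [|n] _ minn; first by rewrite nil_free.
  by apply: contraT => /minn; rewrite ltnn.
have n_gt0 : (0 < n)%N.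
  by case: n dep {minn freeX} => //; rewrite /= free_cons nil_free span_nil memv0 v_neq0.
have wn : w n \in <<X n>>%VS by move: dep; rewrite /= free_cons freeX andbT negbK.
have spanS : (<<X n.+1>> <= <<X n>>)%VS by rewrite /= span_cons subv_add -memvE wn /=.
have stab_y s : s \in <<X n>>%VS -> r y s \in <<X n>>%VS.
  by move=> /r_y_span; apply: (subvP spanS).
have stab_I x s : x \in I -> s \in <<X n>>%VS -> r x s \in <<X n>>%VS.
  move=> xI /(@coord_span _ _ _ (X_tuple n)) ->; rewrite linear_sum.
  apply: memv_suml => i _; rewrite linearZ; apply: memvZ.
  have lt_i : (n.-1 - i < n)%N by case: (n) i => [[]//|k] i; rewrite ltnS leq_subr.
  rewrite /= nthX -[r x _](subrK (lam x *: w (n.-1 - i))).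
  apply: rpredD; last by apply/memvZ/memX.
  apply: (subvP (subX (ltnW lt_i))).
  exact: triangular.
pose M (f : V -> V) : 'M[K]_n := \matrix_(i, j) coord (X_tuple n) j (f (X n)`_i).
have M_comp x1 x2 : (forall s, s \in <<X n>>%VS -> r x2 s \in <<X n>>%VS) ->
    M (fun s => r x1 (r x2 s)) = M (r x2) *m M (r x1).
  move=> stab2; apply/matrixP => i j; rewrite !mxE.
  have Xi : (X n)`_i \in <<X n>>%VS by apply/memv_span/mem_nth; rewrite sizeX.
  rewrite [in LHS](@coord_span _ _ _ (X_tuple n) _ (stab2 _ Xi)) linear_sum linear_sum.
  by apply: eq_bigr => k _; rewrite !mxE linearZ linearZ.
have tr0 : \tr (M (r (lie u y))) = 0.
  have -> : M (r (lie u y)) = M (fun s => r u (r y s)) - M (fun s => r y (r u s)).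
    by apply/matrixP => i j; rewrite !mxE r_lie // linearB.
  rewrite !M_comp //; first by rewrite linearB /= mxtrace_mulC subrr.
  by move=> s; apply: stab_I.
have diag i : M (r (lie u y)) i i = lam (lie u y).
  rewrite mxE nthX -[r _ _](subrK (lam (lie u y) *: w (n.-1 - i))).
  rewrite [LHS]linearD -[w _ in X in _ + X](nthX i).
  rewrite [X in _ + X]linearZ /= (@coord_free _ _ _ (X_tuple n) i i) // eqxx mulr1.
  have coord_w l : (l < n.-1 - i)%N -> coord (X_tuple n) i (w l) = 0.
    move=> lt_l; have lt_k : (n.-1 - l < n)%N by lia.
    have -> : w l = (X n)`_(Ordinal lt_k).
      by rewrite nthX /=; congr w; have := ltn_ord i; lia.
    rewrite (coord_free _ _ (X := X_tuple n)) //; case: eqP => // /(congr1 val) /=.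
    by have := ltn_ord i; lia.
  have /(@coord_span _ _ _ (X_tuple _)) -> := triangular (n.-1 - i) (Iy uI).
  rewrite linear_sum big1 ?add0r // => j _; rewrite linearZ /= nthX.
  by rewrite coord_w ?mulr0 //; have := ltn_ord j; lia.
have := tr0; rewrite /mxtrace (eq_bigr _ (fun i _ => diag i)) sumr_const card_ord.
by move=> /eqP; rewrite mulrn_eq0 eqn0Ngt n_gt0 => /eqP.
Qed.
End TraceArgument.

Variable X : V -> Prop.

(** The proof of Lie's theorem, with the eigenvector kept inside a set X of
    vectors: it is enough that every subspace stable under a single element of U
    and meeting X contains an eigenvector of this element in X. *)
Lemma lie_common_eigenvector (U : {vspace g}) :
    lie_subalgebra U -> lie_solvable U ->
    (forall x y, x \in U -> y \in U ->
       forall v, r (lie x y) v = r x (r y v) - r y (r x v)) ->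
    (forall u (E : {vspace V}), u \in U -> (forall v, v \in E -> r u v \in E) ->
       (exists2 v, v \in E & X v) ->
       exists v mu, [/\ v \in E, X v & r u v = mu *: v]) ->
    (exists v, X v) ->
  exists2 v, X v & forall u, u \in U -> exists mu, r u v = mu *: v.
Proof.
have [n] := ubnP (\dim U); elim: n U => // n IHn U ltn Usub Usol Uhom Ulim exX.
have [U0|U_neq0] := eqVneq U 0%VS.
  have [v Xv] := exX; exists v => // u; rewrite U0 memv0 => /eqP ->.
  by exists 0; rewrite r0l scale0r.
have D_neq : lie_prod U U != U.
  apply: contra_neq U_neq0 => DU; have [k <-] := Usol.
  by elim: k => //= k <-; rewrite DU.
pose Q d := `[< exists W : {vspace g},
  [/\ (lie_prod U U <= W)%VS, (W <= U)%VS, W != U & \dim W = d] >].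
have exQ : exists d, Q d.
  by exists (\dim (lie_prod U U)); apply/asboolP; exists (lie_prod U U); split.
have leQ d : Q d -> (d <= \dim U)%N by move=> /asboolP[W [_ /dimvS leW _ <-]].
case: (ex_maxnP exQ leQ) => d /asboolP[I [DI IU I_neq dimI]] maxd.
have [y yU yI] : exists2 y, y \in U & y \notin I.
  apply: contraNP I_neq => noy; rewrite eqEsubv IU; apply/subvP => z zU.
  by apply: contraT => zI; case: noy; exists z.
have Uy : (I + <[y]>)%VS = U.
  apply/eqP; apply: contraT => Iy_neq.
  have : Q (\dim (I + <[y]>)).
    apply/asboolP; exists (I + <[y]>)%VS; split => //.
      exact: subv_trans DI (addvSl _ _).
    by rewrite subv_add IU -memvE.
  move=> /maxd; rewrite -dimI => leI.
  have /eqP eqI : I == (I + <[y]>)%VS by rewrite eqEdim addvSl.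
  by case/negP: yI; rewrite eqI; apply: (subvP (addvSr _ _)); apply: memv_line.
have sIU := subvP IU; have lieI u z : u \in U -> z \in U -> lie u z \in I.
  by move=> uU zU; apply: (subvP DI); apply: lie_prod_mem.
have ltI : (\dim I < n)%N.
  rewrite -ltnS; apply: leq_trans ltn; rewrite ltnS ltn_neqAle dimvS // andbT.
  by apply: contraNneq I_neq => dimIU; rewrite eqEdim IU dimIU leqnn.
have [|||||v0 Xv0 v0P] := IHn I ltI.
- by apply/lie_subalgebraP => u z uI zI; apply: lieI; apply: sIU.
- exact: lie_solvableS IU Usol.
- by move=> x z /sIU xU /sIU zU; apply: Uhom.
- by move=> u E /sIU uU; apply: Ulim.
- exact: exX.
have /choice[mu muP] (i : 'I_(\dim I)) : exists mu, r (vbasis I)`_i v0 = mu *: v0.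
  by apply/v0P/vbasis_mem/mem_nth; rewrite size_tuple.
pose lam u := \sum_(i < \dim I) coord (vbasis I) i u * mu i.
have lamP u : u \in I -> r u v0 = lam u *: v0.
  move=> /coord_vbasis {1}->; rewrite r_suml scaler_suml; apply: eq_bigr => i _.
  by rewrite rZl muP scalerA.
have [E EP] : exists E : {vspace V},
    forall v, v \in E <-> forall u, u \in I -> r u v = lam u *: v.
  apply: vspace_of_pred => [u _|a v1 v2 v1P v2P u uI].
    by rewrite linear0 scaler0.
  by rewrite linearP v1P // v2P // scalerDr !scalerA mulrC.
have Ey v : v \in E -> r y v \in E.
  move=> /EP vE; apply/EP => u uI.
  have [->|v_neq0] := eqVneq v 0; first by rewrite [r y 0]linear0 [r u 0]linear0 scaler0.
  have Iy z : z \in I -> lie z y \in I by move=> /sIU zU; apply: lieI.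
  have hom z : z \in I -> forall w, r (lie z y) w = r z (r y w) - r y (r z w).
    by move=> /sIU zU; apply: Uhom.
  have := weight_of_commutator Iy hom v_neq0 vE uI.
  have := hom u uI v; rewrite (vE u uI) (vE _ (Iy _ uI)) => + lam0.
  rewrite lam0 scale0r => /esym /eqP; rewrite subr_eq0 => /eqP ->.
  by rewrite linearZ.
have [|v [mu' [vE Xv yv]]] := Ulim y E yU Ey.
  by exists v0 => //; apply/EP.
exists v => // u; rewrite -Uy => /memv_addP[u' u'I [z /vlineP[c ->] ->]].
exists (lam u' + c * mu'); rewrite rDl rZl yv scalerDl scalerA.
by have /EP -> := vE.
Qed.

End WeightSpaces.

(** * The root system E6 and the bracket table *)

(** The basis of g is labelled by the integers below 78: 0..35 are the positive
    roots by increasing height, the first six being the simple roots in order and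
    35 the highest root; 36 + a is the opposite of the positive root a; 72 + i is
    the simple coroot h_i.  Roots are coefficient vectors on the simple roots.
    Elements of g with integral coordinates are sparse lists of pairs
    (coefficient, label).  Statements about the tables hold by computation. *)

Definition cartan (i j : nat) : int :=
  if i == j then 2
  else if ((i, j) \in E6_edges) || ((j, i) \in E6_edges) then -1 else 0.

Definition vec_add (u v : seq int) : seq int := [seq p.1 + p.2 | p <- zip u v].
Definition vec_opp (u : seq int) : seq int := [seq - x | x <- u].
Definition simple_root (i : nat) : seq int := mkseq (fun j => (i == j)%:R) 6.
Definition vec_form (w : nat -> nat -> int) (u v : seq int) : int :=
  foldr (fun i z => foldr (fun j z => u`_i * w i j * v`_j + z) z (iota 0 6)) 0 (iota 0 6).
Definition root_form := vec_form cartan.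
Definition vec_ht (u : seq int) : nat := absz (foldr +%R 0 u).

(** The sign eps(u, v) is bimultiplicative, with eps(u, u) = -1 for every root u and
    eps(u, v) eps(v, u) = (-1)^(u, v).  For the simply laced root systems,
    [E_u, E_v] = eps(u, v) E_(u + v) and [E_u, E_-u] = - h_u then define a Lie
    bracket; thus e_i = E_(alpha_i) and f_i = - E_(- alpha_i). *)
Definition eps_form := vec_form (fun i j => ((i == j) || ((j, i) \in E6_edges))%:R).
Definition eps (u v : seq int) : int := (-1) ^+ absz (eps_form u v).

Fixpoint vec_box (t : seq nat) : seq (seq int) :=
  if t is n :: t' then [seq Posz x :: u | u <- vec_box t', x <- iota 0 n.+1] else [:: [::]].

(** The roots are the vectors of norm 2, and the highest root bounds the
    coefficients of the positive ones. *)
Definition pos_roots : seq (seq int) := Eval vm_compute in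
  let box := [seq u <- vec_box [:: 1; 2; 2; 3; 2; 1]%N | root_form u u == 2] in
  flatten [seq [seq u <- box | vec_ht u == n] | n <- iota 1 11].
Definition E6_roots : seq (seq int) := Eval vm_compute in
  pos_roots ++ [seq vec_opp u | u <- pos_roots].
Definition rt (a : nat) : seq int := nth [::] E6_roots a.

Definition spvec := seq (int * nat).
Definition sp_scale (c : int) (s : spvec) : spvec := [seq (c * p.1, p.2) | p <- s].
Definition sp_coef (s : spvec) (k : nat) : int :=
  foldr (fun p z => if p.2 == k then p.1 + z else z) 0 s.
Definition sp_eq (s1 s2 : spvec) :=
  all (fun k => sp_coef s1 k == sp_coef s2 k) [seq p.2 | p <- s1 ++ s2].
Definition sp_app (f : nat -> spvec) (s : spvec) : spvec :=
  flatten [seq sp_scale p.1 (f p.2) | p <- s].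

Definition bracket_formula (a b : nat) : spvec :=
  if (a < 72)%N then
    if (b < 72)%N then
      let s := vec_add (rt a) (rt b) in
      if s == nseq 6 0 then [seq (- (rt a)`_i, (72 + i)%N) | i <- iota 0 6 & (rt a)`_i != 0]
      else let k := index s E6_roots in
        if (k < 72)%N then [:: (eps (rt a) (rt b), k)] else [::]
    else [:: (- root_form (rt a) (simple_root (b - 72)), a)]
  else if (b < 72)%N then [:: (root_form (simple_root (a - 72)) (rt b), b)]
  else [::].

Definition bracket_table : seq (seq spvec) := Eval vm_compute in
  [seq [seq bracket_formula a b | b <- iota 0 78] | a <- iota 0 78].
Definition bracket (a b : nat) : spvec := nth [::] (nth [::] bracket_table a) b.
Arguments bracket : simpl never.

(** A nonsimple positive root a is the sum of the simple root [lead a] and of the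
    positive root [parent a]; the root vector of a is [lead_sign a] times the
    bracket of theirs. *)
Definition lead_formula (a : nat) : nat :=
  find (fun i => vec_add (rt a) (vec_opp (simple_root i)) \in pos_roots) (iota 0 6).
Definition parent_formula (a : nat) : nat :=
  index (vec_add (rt a) (vec_opp (simple_root (lead_formula a)))) pos_roots.
Definition lead_table : seq nat := Eval vm_compute in map lead_formula (iota 0 36).
Definition lead (a : nat) := nth 0%N lead_table a.
Definition parent_table : seq nat := Eval vm_compute in map parent_formula (iota 0 36).
Definition parent (a : nat) := nth 0%N parent_table a.
Definition sign_table : seq int := Eval vm_compute in
  [seq eps (rt (lead a)) (rt (parent a)) | a <- iota 0 36].
Definition lead_sign (a : nat) : int := sign_table`_a.
Definition ht_table : seq nat := Eval vm_compute in map vec_ht E6_roots.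
Definition ht (a : nat) : nat := nth 0%N ht_table a.
Arguments ht : simpl never.

(** The effect on labels of the automorphism exchanging e_i with - f_i. *)
Definition neg_sp (s : spvec) : spvec :=
  [seq if (p.2 < 36)%N then (p.1, (36 + p.2)%N) else (- p.1, p.2) | p <- s].

(** The bracket of f_j = - E_(- alpha_j) with the root vector of a. *)
Definition gen_f (j a : nat) : spvec := sp_scale (-1) (bracket (36 + j) a).

Definition pos_label_lt (n k : nat) :=
  (k < 36)%N && (ht k < n)%N || (72 <= k < 78)%N.

Lemma check1 m n (P : nat -> bool) :
  all P (iota m n) -> forall a, (m <= a < m + n)%N -> P a.
Proof. by move=> /allP PP a ha; apply: PP; rewrite mem_iota. Qed.

Lemma check2 m n m' n' (P : nat -> nat -> bool) :
  all (fun a => all (P a) (iota m' n')) (iota m n) ->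
  forall a b, (m <= a < m + n)%N -> (m' <= b < m' + n')%N -> P a b.
Proof. by move=> /check1 PP a b /PP /check1; apply. Qed.

Lemma check3 m n m' n' m2 n2 (P : nat -> nat -> nat -> bool) :
  all (fun a => all (fun b => all (P a b) (iota m2 n2)) (iota m' n')) (iota m n) ->
  forall a b c, (m <= a < m + n)%N -> (m' <= b < m' + n')%N ->
    (m2 <= c < m2 + n2)%N -> P a b c.
Proof. by move=> /check2 PP a b c /PP H /H /check1; apply. Qed.

Lemma parentP a : (6 <= a < 36)%N ->
  [&& (lead a < 6)%N, (parent a < 36)%N & ht a == (ht (parent a)).+1].
Proof. by move: a; apply: (@check1 6 30); vm_compute. Qed.

Lemma ht_simple i : (i < 6)%N -> ht i == 1%N.
Proof. by move: i; apply: (@check1 0 6); vm_compute. Qed.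

Lemma ht_pos a : (a < 36)%N -> (0 < ht a)%N.
Proof. by move: a; apply: (@check1 0 36); vm_compute. Qed.

Lemma gen_f_simple i j : (i < 6)%N -> (j < 6)%N ->
  gen_f j i == if i == j then [:: (-1, (72 + i)%N)] else [::].
Proof. by move: i j; apply: (@check2 0 6 0 6); vm_compute. Qed.

Lemma gen_f_label a j : (a < 36)%N -> (j < 6)%N ->
  all (pos_label_lt (ht a)) (map snd (gen_f j a)).
Proof. by move: a j; apply: (@check2 0 36 0 6); vm_compute. Qed.

(** Compatibility of the table with the Jacobi identity for f_j, e_i and a root
    vector, first for a nonsimple a written as a bracket, then for [e_i, E_a]. *)
Lemma gen_f_step a j : (6 <= a < 36)%N -> (j < 6)%N ->
  sp_eq (gen_f j a) (sp_scale (lead_sign a)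
    ((if lead a == j then sp_scale (-1) (bracket (72 + lead a) (parent a)) else [::])
      ++ sp_app (bracket (lead a)) (gen_f j (parent a)))).
Proof. by move: a j; apply: (@check2 6 30 0 6); vm_compute. Qed.

Lemma gen_e_label a i : (a < 36)%N -> (i < 6)%N ->
  all (fun k => (k < 36)%N && (ht k == (ht a).+1)) (map snd (bracket i a)).
Proof. by move: a i; apply: (@check2 0 36 0 6); vm_compute. Qed.

Lemma gen_e_step a i j : (a < 36)%N -> (i < 6)%N -> (j < 6)%N ->
  sp_eq (sp_app (gen_f j) (bracket i a))
    ((if i == j then sp_scale (-1) (bracket (72 + i) a) else [::])
      ++ sp_app (bracket i) (gen_f j a)).
Proof. by move: a i j; apply: (@check3 0 36 0 6 0 6); vm_compute. Qed.

Lemma bracket_gen_h i j : (i < 6)%N -> (j < 6)%N ->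
  bracket i (72 + j) == [:: (- cartan j i, i)].
Proof. by move: i j; apply: (@check2 0 6 0 6); vm_compute. Qed.

Definition weight (i k : nat) : int := sp_coef (bracket (72 + i) k) k.

Lemma weight_simple i j : (i < 6)%N -> (j < 6)%N -> weight i j == cartan i j.
Proof. by move: i j; apply: (@check2 0 6 0 6); vm_compute. Qed.

Lemma bracket_h i k : (i < 6)%N -> (k < 72)%N -> bracket (72 + i) k == [:: (weight i k, k)].
Proof. by move: i k; apply: (@check2 0 6 0 72); vm_compute. Qed.

Lemma weight_parent i a : (i < 6)%N -> (6 <= a < 36)%N ->
  weight i a == weight i (lead a) + weight i (parent a).
Proof. by move: i a; apply: (@check2 0 6 6 30); vm_compute. Qed.

Lemma weight_gen_e i a j : (i < 6)%N -> (a < 36)%N -> (j < 6)%N ->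
  all (fun k => weight i k == cartan i j + weight i a) (map snd (bracket j a)).
Proof. by move: i a j; apply: (@check3 0 6 0 36 0 6); vm_compute. Qed.

(** Jacobi identity for a simple root vector, the parent of a, and any k. *)
Lemma full_step a k : (6 <= a < 36)%N -> (k < 78)%N ->
  sp_eq (bracket a k) (sp_scale (lead_sign a)
    (sp_app (bracket (lead a)) (bracket (parent a) k)
     ++ sp_scale (-1) (sp_app (bracket (parent a)) (bracket (lead a) k)))) &&
  sp_eq (bracket (36 + a) k) (sp_scale (lead_sign a)
    (sp_app (bracket (36 + lead a)) (bracket (36 + parent a) k)
     ++ sp_scale (-1) (sp_app (bracket (36 + parent a)) (bracket (36 + lead a) k)))).
Proof. by move: a k; apply: (@check2 6 30 0 78); vm_compute. Qed.

Lemma bracket_neg i a : (i < 6)%N -> (a < 36)%N ->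
  sp_eq (bracket (36 + i) (36 + a)) (neg_sp (bracket i a)) &&
  sp_eq (sp_scale (-1) (bracket i (36 + a))) (neg_sp (gen_f i a)).
Proof. by move: i a; apply: (@check2 0 6 0 36); vm_compute. Qed.

Lemma bracket_fgen_h i j : (i < 6)%N -> (j < 6)%N ->
  bracket (36 + i) (72 + j) == [:: (cartan j i, (36 + i)%N)].
Proof. by move: i j; apply: (@check2 0 6 0 6); vm_compute. Qed.

Lemma weight_neg i a : (i < 6)%N -> (a < 36)%N -> weight i (36 + a) == - weight i a.
Proof. by move: i a; apply: (@check2 0 6 0 36); vm_compute. Qed.

Lemma bracket_hh i j : (i < 6)%N -> (j < 6)%N -> bracket (72 + i) (72 + j) == [::].
Proof. by move: i j; apply: (@check2 0 6 0 6); vm_compute. Qed.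

Lemma bracket_pos_label i a : (i < 6)%N -> (a < 36)%N ->
  all (fun k => (k < 36)%N) (map snd (bracket i a)).
Proof. by move: i a; apply: (@check2 0 6 0 36); vm_compute. Qed.

Lemma bracket_label a b : (a < 78)%N -> (b < 78)%N ->
  all (fun k => (k < 78)%N) (map snd (bracket a b)).
Proof. by move: a b; apply: (@check2 0 78 0 78); vm_compute. Qed.

(** Heights of labels, shifted by 12 to be natural numbers. *)
Definition label_ht (k : nat) : nat :=
  if (k < 36)%N then (12 + ht k)%N else if (k < 72)%N then (12 - ht (k - 36))%N else 12%N.

Definition moves_to (a k l : nat) : bool :=
  if bracket a k is [:: (c, l')] then (c != 0) && (l' == l) else false.

(** Any label can be raised to the highest root by the e_i and any label can be
    reached from it by the f_i, along brackets with a single nonzero term. *)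
Lemma raising k : (k < 78)%N -> (k == 35%N) || 
  has (fun i => has (fun l => (label_ht l == (label_ht k).+1) && moves_to i k l) (iota 0 78))
      (iota 0 6).
Proof. by move: k; apply: (@check1 0 78); vm_compute. Qed.

Lemma lowering k : (k < 78)%N -> (k == 35%N) || 
  has (fun i => has (fun l => (label_ht l == (label_ht k).+1) && moves_to (36 + i) l k) (iota 0 78))
      (iota 0 6).
Proof. by move: k; apply: (@check1 0 78); vm_compute. Qed.

Lemma label_ht_le k : (k < 78)%N -> (label_ht k <= 23)%N.
Proof. by move: k; apply: (@check1 0 78); vm_compute. Qed.

(** Coordinates on the h_i of an element of the Cartan subalgebra on which the 72
    roots take distinct nonzero values. *)
Definition regular_coef : seq int := [:: 16; -2; 16; -32; -10; -21].
Definition regular_wt (k : nat) : int :=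
  if (k < 72)%N then foldr (fun i z => regular_coef`_i * weight i k + z) 0 (iota 0 6) else 0.

Lemma regular_wt_inj k l : (k < 72)%N -> (l < 78)%N ->
  (regular_wt k == regular_wt l) == (k == l).
Proof. by move: k l; apply: (@check2 0 72 0 78); vm_compute. Qed.

(** Three times the inverse of the Cartan matrix. *)
Definition cartan_adj (j i : nat) : int :=
  nth 0 (nth [::] [:: [:: 4; 3; 5; 6; 4; 2]; [:: 3; 6; 6; 9; 6; 3]; [:: 5; 6; 10; 12; 8; 4];
    [:: 6; 9; 12; 18; 12; 6]; [:: 4; 6; 8; 12; 10; 5]; [:: 2; 3; 4; 6; 5; 4]] j) i.

Lemma cartan_adjP k i : (k < 6)%N -> (i < 6)%N ->
  foldr (fun j z => cartan k j * cartan_adj j i + z) 0 (iota 0 6)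
  == if k == i then 3 else 0.
Proof. by move: k i; apply: (@check2 0 6 0 6); vm_compute. Qed.

(** * Root vectors from Chevalley generators *)

Section SparseCombinations.
Variables (K : fieldType) (g : lieAlgType K) (B : nat -> g).

Definition sp_ev (s : spvec) : g := \sum_(p <- s) p.1%:~R *: B p.2.

Lemma sp_ev_nil : sp_ev [::] = 0. Proof. exact: big_nil. Qed.

Lemma sp_ev_cat s1 s2 : sp_ev (s1 ++ s2) = sp_ev s1 + sp_ev s2.
Proof. exact: big_cat. Qed.

Lemma sp_ev1 c k : sp_ev [:: (c, k)] = c%:~R *: B k. Proof. exact: big_seq1. Qed.

Lemma sp_ev_scale c s : sp_ev (sp_scale c s) = c%:~R *: sp_ev s.
Proof.
rewrite /sp_ev big_map scaler_sumr; apply: eq_bigr => p _ /=.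
by rewrite intrM scalerA.
Qed.

Lemma sp_ev_coef (ks : seq nat) s : uniq ks -> {subset map snd s <= ks} ->
  sp_ev s = \sum_(k <- ks) (sp_coef s k)%:~R *: B k.
Proof.
move=> uks; elim: s => [|[c k] s IHs] sub.
  by rewrite sp_ev_nil big1 // => k _; rewrite scale0r.
have kks : k \in ks by apply: sub; rewrite inE eqxx.
rewrite /sp_ev big_cons -/(sp_ev s) IHs; last first.
  by move=> l ls; apply: sub; rewrite inE ls orbT.
rewrite (bigD1_seq k) //= [RHS](bigD1_seq k) //= eqxx intrD scalerDl addrA.
by congr (_ + _); apply: eq_bigr => l; rewrite eq_sym => /negPf ->.
Qed.

Lemma sp_eqP s1 s2 : sp_eq s1 s2 -> sp_ev s1 = sp_ev s2.
Proof.
move=> /allP eqs; pose ks := undup (map snd (s1 ++ s2)).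
have sub s : {subset s <= s1 ++ s2} -> {subset map snd s <= ks}.
  by move=> ss k /mapP[p /ss ps ->]; rewrite mem_undup map_f.
rewrite !(@sp_ev_coef ks) ?undup_uniq //.
- by apply: eq_big_seq => k; rewrite mem_undup => /eqs /eqP ->.
- by apply: sub => p; rewrite mem_cat => ->; rewrite orbT.
- by apply: sub => p; rewrite mem_cat => ->.
Qed.

Lemma lie_sp_ev x f s : {in map snd s, forall k, lie x (B k) = sp_ev (f k)} ->
  lie x (sp_ev s) = sp_ev (sp_app f s).
Proof.
elim: s => [|[c k] s IHs] xB; first by rewrite sp_ev_nil lie0r.
rewrite /sp_ev big_cons lieDr lieZr xB ?inE ?eqxx // -/(sp_ev s).
rewrite IHs => [|l ls]; last by apply: xB; rewrite inE ls orbT.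
by rewrite -/(sp_ev _) /sp_app /= sp_ev_cat sp_ev_scale.
Qed.

End SparseCombinations.

Definition chevalley_relations (K : fieldType) (g : lieAlgType K) (e h f : nat -> g) :=
  [/\ forall i j, (i < 6)%N -> (j < 6)%N -> lie (h i) (h j) = 0,
      forall i j, (i < 6)%N -> (j < 6)%N -> lie (e i) (f j) = if i == j then h i else 0,
      forall i j, (i < 6)%N -> (j < 6)%N -> lie (h i) (e j) = (cartan i j)%:~R *: e j &
      forall i j, (i < 6)%N -> (j < 6)%N -> lie (h i) (f j) = - ((cartan i j)%:~R *: f j)].

Definition lie_generating (K : fieldType) (g : lieAlgType K) (e h f : nat -> g) :=
  forall P : g -> Prop, P 0 -> (forall a x y, P x -> P y -> P (a *: x + y)) ->
    (forall x y, P x -> P y -> P (lie x y)) ->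
    (forall i, (i < 6)%N -> [/\ P (e i), P (h i) & P (f i)]) -> forall x, P x.

Lemma chevalley_relations_opp (K : fieldType) (g : lieAlgType K) (e h f : nat -> g) :
  chevalley_relations e h f ->
  chevalley_relations (fun i => - f i) (fun i => - h i) (fun i => - e i).
Proof.
move=> [hh ef he hf]; split=> i j hi hj; rewrite !(lieNl, lieNr).
- by rewrite hh // !oppr0.
- by rewrite opprK lieC ef // eq_sym; case: eqP => [->//|_]; rewrite oppr0.
- by rewrite opprK hf // scalerN.
- by rewrite opprK he // scalerN opprK.
Qed.

Lemma lie_generating_opp (K : fieldType) (g : lieAlgType K) (e h f : nat -> g) :
  lie_generating e h f ->
  lie_generating (fun i => - f i) (fun i => - h i) (fun i => - e i).
Proof.
move=> gen P P0 Plin Plie Pgen; apply: gen => // i /Pgen[Pf Ph Pe].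
have PN x : P (- x) -> P x.
  by move=> Px; have := Plin (-1) _ _ Px P0; rewrite scaleN1r opprK addr0.
by split; apply: PN.
Qed.

Section HighestWeight.
Variables (K : numClosedFieldType) (g : lieAlgType K) (e h f : nat -> g).
Hypotheses (g_simple : lie_simple g) (rel : chevalley_relations e h f)
  (gen : lie_generating e h f).

(** The element of the Cartan subalgebra on which all simple roots take value 1;
    its adjoint action measures heights. *)
Definition rho_coef (i : nat) : nat := nth 0%N [:: 8; 11; 15; 21; 15; 8]%N i.
Definition rho_vee : g := \sum_(i < 6) (rho_coef i)%:R *: h i.

Lemma rho_cartan i : (i < 6)%N ->
  \sum_(j < 6) ((rho_coef j)%:R : K) * (cartan j i)%:~R = 1.
Proof.
move=> hi; have E : \sum_(j < 6) (rho_coef j)%:Z * cartan j i = 1.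
  by case: i hi => [|[|[|[|[|[|]]]]]] // _; rewrite !big_ord_recr big_ord0.
rewrite -[RHS]/(1%:~R) -E rmorph_sum /=; apply: eq_bigr => j _.
by rewrite intrM -pmulrn.
Qed.

Lemma rho_vee_e i : (i < 6)%N -> lie rho_vee (e i) = e i.
Proof.
case: rel => _ _ he _ hi; rewrite lie_suml -[RHS]scale1r -[X in _ = X *: _](rho_cartan hi) scaler_suml.
by apply: eq_bigr => j _; rewrite lieZl he ?ltn_ord // scalerA.
Qed.

Lemma rho_vee_f i : (i < 6)%N -> lie rho_vee (f i) = - f i.
Proof.
case: rel => _ _ _ hf hi; rewrite lie_suml -[f i in RHS]scale1r -[X in _ = - (X *: _)](rho_cartan hi).
rewrite scaler_suml -sumrN.
by apply: eq_bigr => j _; rewrite lieZl hf ?ltn_ord // scalerN scalerA.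
Qed.

(** A weight vector z of positive height m, killed by all the f_j, is zero.  The
    vectors obtained from z by applying the e_i have positive heights, and their
    span is an ideal. *)
Section Killed.
Variables (z : g) (m : nat).
Hypotheses (m_gt0 : (0 < m)%N) (zh : forall i, (i < 6)%N -> exists c, lie (h i) z = c *: z)
  (z_ht : lie rho_vee z = m%:R *: z) (zf : forall i, (i < 6)%N -> lie (f i) z = 0).

Inductive raised : nat -> g -> Prop :=
| Raised0 : raised m z
| RaisedS d i x : (i < 6)%N -> raised d x -> raised d.+1 (lie (e i) x).

Inductive raised_span : g -> Prop :=
| RaisedSpan0 : raised_span 0
| RaisedSpanD a d x y : raised d x -> raised_span y -> raised_span (a *: x + y).

Lemma raised_span1 d x : raised d x -> raised_span x.
Proof.
by move=> rx; rewrite -[x]addr0 -[x]scale1r; exact: (RaisedSpanD _ rx RaisedSpan0).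
Qed.

Lemma raised_span_lin a x y : raised_span x -> raised_span y -> raised_span (a *: x + y).
Proof.
move=> + ry; elim=> [|b d u v ru _ IHv]; first by rewrite scaler0 add0r.
by rewrite scalerDr scalerA -addrA; exact: (RaisedSpanD _ ru IHv).
Qed.

Lemma raised_spanZ a x : raised_span x -> raised_span (a *: x).
Proof. by move=> rx; rewrite -[_ *: _]addr0; exact: (raised_span_lin _ rx RaisedSpan0). Qed.

Lemma raised_gt0 d x : raised d x -> (0 < d)%N.
Proof. by case. Qed.

Lemma raised_ht d x : raised d x -> lie rho_vee x = d%:R *: x.
Proof.
elim=> // {}d i {}x hi _ IHx; rewrite lie_lie rho_vee_e // IHx lieZr -natr1 scalerDl.
by rewrite scale1r addrC.
Qed.

Lemma raised_weight d x i : (i < 6)%N -> raised d x -> exists c, lie (h i) x = c *: x.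
Proof.
case: rel => _ _ he _ hi; elim=> [|{}d j {}x hj _ [c xc]]; first exact: zh.
exists ((cartan i j)%:~R + c).
by rewrite lie_lie he // xc lieZl lieZr scalerDl.
Qed.

Lemma raised_f d x i : (i < 6)%N -> raised d x -> raised_span (lie (f i) x).
Proof.
case: rel => _ ef _ _ hi; elim=> [|{}d j {}x hj rx IHx].
  by rewrite zf //; apply: RaisedSpan0.
rewrite lie_lie [lie (f i) _]lieC ef //.
have -> : lie (e j) (lie (f i) x) = 1 *: lie (e j) (lie (f i) x) by rewrite scale1r.
rewrite addrC; apply: raised_span_lin.
  elim: IHx => [|a d' u v ru _ IHv]; first by rewrite lie0r; apply: RaisedSpan0.
  rewrite lieDr lieZr. exact: (RaisedSpanD _ (RaisedS hj ru) IHv).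
case: eqP => [->|_]; last by rewrite oppr0 lie0l; apply: RaisedSpan0.
have [c xc] := raised_weight hi rx.
by rewrite lieNl xc -scaleNr; apply/raised_spanZ/raised_span1/rx.
Qed.

Lemma raised_span_ideal x y : raised_span y -> raised_span (lie x y).
Proof.
move=> ry; move: x y ry.
suff H x : forall d y, raised d y -> raised_span (lie x y).
  move=> x y; elim=> [|a d u v /H ru _ IHv]; first by rewrite lie0r; apply: RaisedSpan0.
  by rewrite lieDr lieZr; apply: raised_span_lin.
suff {}H : forall y, raised_span y -> raised_span (lie x y).
  by move=> d y /raised_span1; apply: H.
move: x; apply: gen => [y _|a x1 x2 H1 H2 y ry|x1 x2 H1 H2 y ry|i hi].
- by rewrite lie0l; apply: RaisedSpan0.
- by rewrite lieDl lieZl; apply: raised_span_lin; [apply: H1 | apply: H2].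
- rewrite lie_liel addrC -scaleN1r; apply: raised_span_lin; first exact/H2/H1.
  exact/H1/H2.
have ext x : (forall d y, raised d y -> raised_span (lie x y)) ->
    forall y, raised_span y -> raised_span (lie x y).
  move=> H y; elim=> [|a d u v /H ru _ IHv]; first by rewrite lie0r; apply: RaisedSpan0.
  by rewrite lieDr lieZr; apply: raised_span_lin.
split; apply: ext => d y ry.
- exact/raised_span1/RaisedS/ry.
- by have [c ->] := raised_weight hi ry; apply/raised_spanZ/raised_span1/ry.
- exact: raised_f ry.
Qed.

(** f_i has height -1, whereas raised vectors have positive heights. *)
Lemma raised_span_f i : (i < 6)%N -> raised_span (f i) -> f i = 0.
Proof.
move=> hi rf.
have [r [rP fr]] : exists r : seq (nat * g),
    (forall p, p \in r -> (0 < p.1)%N /\ lie rho_vee p.2 = p.1%:R *: p.2)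
    /\ f i = \sum_(p <- r) p.2.
  elim: rf => [|a d x y rx _ [r [rP ->]]].
    by exists [::]; split=> //; rewrite big_nil.
  exists ((d, a *: x) :: r); rewrite big_cons; split=> // p.
  rewrite inE => /predU1P[-> /=|/rP //]; split; first exact: raised_gt0 rx.
  by rewrite lieZr (raised_ht rx) !scalerA mulrC.
pose w (p : bool * (nat * g)) : K := if p.1 then p.2.1%:R else -1.
pose F (p : bool * (nat * g)) : g := if p.1 then - p.2.2 else f i.
pose r' := (false, (0%N, 0)) :: [seq (true, p) | p <- r].
have Fr' : \sum_(p <- r') F p = 0.
  by rewrite big_cons big_map /F /= sumrN -fr subrr.
have gF : {in r', forall p, gen_eigen (lie rho_vee) (w p) (F p)}.
  move=> p; rewrite inE => /predU1P[->|/mapP[q /rP[_ qE] ->]].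
    by apply: eigen_gen_eigen; rewrite /= rho_vee_f // scaleN1r.
  by apply: eigen_gen_eigen; rewrite /= lieNr qE scalerN.
have Z0 a (u v : g) : u = 0 -> v = 0 -> a *: u + v = 0.
  by move=> -> ->; rewrite scaler0 addr0.
have ZT (v : g) : v = 0 -> lie rho_vee v = 0 by move=> ->; rewrite lie0r.
have := stable_components_fam erefl Z0 ZT gF Fr' (-1).
rewrite big_cons eqxx big_map big_seq_cond big1 ?addr0 // => p /andP[_].
by rewrite /w /= -subr_eq0 opprK natr1 pnatr_eq0.
Qed.

(** By simplicity the span of the raised vectors is 0 or g; in the second case
    the f_i would be zero, and then all the generators. *)
Lemma killed_by_f : z = 0.
Proof.
have [I IP] := vspace_of_pred RaisedSpan0 raised_span_lin.
have Iid : lie_ideal fullv I.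
  split; first exact: subvf.
  by apply/lie_prod_subP => x y _ /IP ry; apply/IP/raised_span_ideal.
have zI : z \in I by apply/IP/raised_span1/Raised0.
have [I0|Ifull] := g_simple.2 I Iid; first by apply/eqP; rewrite -memv0 -I0.
have f0 i : (i < 6)%N -> f i = 0.
  by move=> hi; apply: raised_span_f => //; apply/IP; rewrite Ifull memvf.
have h0 i : (i < 6)%N -> h i = 0.
  by move=> hi; case: rel => _ /(_ i i hi hi) + _ _; rewrite eqxx f0 // lie0r.
have e0 i : (i < 6)%N -> e i = 0.
  move=> hi; case: rel => _ _ /(_ i i hi hi) + _; rewrite h0 // lie0l /cartan eqxx.
  by move=> /esym /eqP; rewrite scaler_eq0 intr_eq0 => /eqP.
apply: (gen (P := fun x => x = 0)) => // [a x y -> ->|x y -> _|i hi].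
- by rewrite scaler0 addr0.
- by rewrite lie0l.
- by rewrite e0 // h0 // f0.
Qed.

End Killed.
End HighestWeight.

Section PositivePart.
Variables (K : numClosedFieldType) (g : lieAlgType K) (e h f : nat -> g).
Hypotheses (g_simple : lie_simple g) (rel : chevalley_relations e h f)
  (gen : lie_generating e h f).

Lemma pos_root_ind (P : nat -> Prop) :
  (forall i, (i < 6)%N -> P i) ->
  (forall a, (6 <= a < 36)%N -> (lead a < 6)%N -> (parent a < 36)%N ->
     P (parent a) -> P a) ->
  forall a, (a < 36)%N -> P a.
Proof.
move=> P1 PS a; have [n] := ubnP (ht a); elim: n a => // n IHn a ltn ha.
have [lt6|ge6] := ltnP a 6; first exact: P1.
have ha' : (6 <= a < 36)%N by rewrite ge6.
have /and3P[hl hp /eqP htp] := parentP ha'.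
by apply: PS => //; apply: IHn => //; rewrite -ltnS -htp.
Qed.

Fixpoint pos_vec_rec n a : g :=
  if n is n'.+1 then
    if (a < 6)%N then e a
    else (lead_sign a)%:~R *: lie (e (lead a)) (pos_vec_rec n' (parent a))
  else 0.
Definition pos_vec a := pos_vec_rec (ht a) a.

Lemma pos_vec_simple i : (i < 6)%N -> pos_vec i = e i.
Proof. by move=> hi; rewrite /pos_vec (eqP (ht_simple hi)) /= hi. Qed.

Lemma pos_vec_step a : (6 <= a < 36)%N ->
  pos_vec a = (lead_sign a)%:~R *: lie (e (lead a)) (pos_vec (parent a)).
Proof.
move=> ha; have /and3P[_ _ /eqP htp] := parentP ha.
by rewrite {1}/pos_vec htp /= ltnNge; case/andP: ha => ->.
Qed.

Definition pos_basis k := if (k < 36)%N then pos_vec k else h (k - 72).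

Lemma pos_basis_pos k : (k < 36)%N -> pos_basis k = pos_vec k.
Proof. by rewrite /pos_basis => ->. Qed.

Lemma pos_basis_h i : pos_basis (72 + i) = h i.
Proof. by rewrite /pos_basis addKn. Qed.

Lemma lie_h_pos_vec i a : (i < 6)%N -> (a < 36)%N ->
  lie (h i) (pos_vec a) = (weight i a)%:~R *: pos_vec a.
Proof.
case: rel => _ _ he _ hi; move: a; apply: pos_root_ind => [j hj|a ha hl hp IHa].
  by rewrite pos_vec_simple // he // (eqP (weight_simple hi hj)).
rewrite pos_vec_step // lieZr lie_lie he // IHa lieZl lieZr -scalerDl -intrD.
by rewrite -(eqP (weight_simple hi hl)) -(eqP (weight_parent hi ha)) !scalerA mulrC.
Qed.

Lemma lie_rho_pos_vec a : (a < 36)%N ->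
  lie (rho_vee h) (pos_vec a) = (ht a)%:R *: pos_vec a.
Proof.
move: a; apply: pos_root_ind => [j hj|a ha hl hp IHa].
  by rewrite pos_vec_simple // (rho_vee_e rel) // (eqP (ht_simple hj)) scale1r.
have /and3P[_ _ /eqP ->] := parentP ha.
rewrite pos_vec_step // lieZr lie_lie (rho_vee_e rel) // IHa lieZr.
rewrite scalerA mulrC -scalerA; congr (_ *: _).
by rewrite -natr1 scalerDl scale1r addrC.
Qed.

Lemma lie_sp_ev_scalar x c s : {in map snd s, forall k, lie x (pos_basis k) = c *: pos_basis k} ->
  lie x (sp_ev pos_basis s) = c *: sp_ev pos_basis s.
Proof.
elim: s => [|[d k] s IHs] sx; first by rewrite sp_ev_nil lie0r scaler0.
rewrite -cat1s sp_ev_cat sp_ev1 lieDr lieZr sx ?inE ?eqxx // scalerDr !scalerA mulrC.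
by rewrite IHs // => l ls; apply: sx; rewrite inE ls orbT.
Qed.

Let f_rule a := forall j, (j < 6)%N ->
  lie (f j) (pos_vec a) = sp_ev pos_basis (gen_f j a).
Let e_rule a := forall i, (i < 6)%N ->
  lie (e i) (pos_vec a) = sp_ev pos_basis (bracket i a).

Lemma lie_e_h i j : (i < 6)%N -> (j < 6)%N ->
  lie (e i) (h j) = sp_ev pos_basis (bracket i (72 + j)).
Proof.
case: rel => _ _ he _ hi hj; rewrite (eqP (bracket_gen_h hi hj)) sp_ev1.
rewrite pos_basis_pos ?(leq_trans hi) // pos_vec_simple // lieC he //.
by rewrite intrN scaleNr.
Qed.

Lemma lie_f_e i j x : (i < 6)%N -> (j < 6)%N ->
  lie (f j) (lie (e i) x)
  = (if i == j then - lie (h i) x else 0) + lie (e i) (lie (f j) x).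
Proof.
case: rel => _ ef _ _ hi hj; rewrite lie_lie [lie (f j) _]lieC ef //.
by case: eqP => _; rewrite ?oppr0 ?lie0l ?lieNl.
Qed.

Lemma lie_h_basis i a : (i < 6)%N -> (a < 36)%N ->
  - lie (h i) (pos_vec a) = sp_ev pos_basis (sp_scale (-1) (bracket (72 + i) a)).
Proof.
move=> hi ha; rewrite (eqP (bracket_h hi _)); last by lia.
by rewrite sp_ev_scale sp_ev1 scaleN1r pos_basis_pos // lie_h_pos_vec.
Qed.

Lemma e_rule_label n i k : (i < 6)%N ->
    (forall a, (a < 36)%N -> (ht a < n)%N -> e_rule a) -> pos_label_lt n k ->
  lie (e i) (pos_basis k) = sp_ev pos_basis (bracket i k).
Proof.
move=> hi er /orP[/andP[hk htk]|/andP[ge_k lt_k]].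
  by rewrite pos_basis_pos // er.
rewrite -(subnKC ge_k) pos_basis_h lie_e_h //; lia.
Qed.

Lemma pos_label_ltW m n k : (m <= n)%N -> pos_label_lt m k -> pos_label_lt n k.
Proof. by rewrite /pos_label_lt => le_mn; lia. Qed.

(** [f_j, E_a] at height n + 1 only uses brackets with e_i at smaller heights, by
    the definition of E_a; [e_i, E_a] at height n is then determined because its
    brackets with the f_j are. *)
Lemma f_e_rules n :
  (forall a, (a < 36)%N -> (ht a <= n)%N -> f_rule a) /\
  (forall a, (a < 36)%N -> (ht a < n)%N -> e_rule a).
Proof.
elim: n => [|n [IHf IHe]].
  by split=> // a ha; rewrite leqNgt ht_pos.
have Fn a : (a < 36)%N -> (ht a <= n.+1)%N -> f_rule a.
  move=> ha htn j hj; have [lt6|ge6] := ltnP a 6.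
    case: rel => _ ef _ _.
    rewrite pos_vec_simple // (eqP (gen_f_simple _ _)) // lieC ef //.
    case: eqP => _; last by rewrite oppr0 sp_ev_nil.
    by rewrite sp_ev1 pos_basis_h scaleN1r.
  have ha' : (6 <= a < 36)%N by rewrite ge6.
  have /and3P[hl hp /eqP htp] := parentP ha'.
  have htpn : (ht (parent a) <= n)%N by rewrite -ltnS -htp.
  rewrite pos_vec_step // lieZr lie_f_e // IHf // (sp_eqP _ (gen_f_step ha' hj)).
  rewrite sp_ev_scale sp_ev_cat; congr (_ *: (_ + _)).
    by case: eqP => _; rewrite ?sp_ev_nil // lie_h_basis.
  apply: lie_sp_ev => k /(allP (gen_f_label hp hj)) /(pos_label_ltW htpn).
  exact: e_rule_label.
split=> // a ha; rewrite ltnS => htn i hi; apply/eqP; rewrite -subr_eq0; apply/eqP.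
apply: (killed_by_f g_simple rel gen (ltn0Sn (ht a))).
- move=> k hk; exists (cartan k i + weight k a)%:~R.
  rewrite lieBr scalerBr; congr (_ - _).
    case: rel => _ _ he _; rewrite lie_lie he // lie_h_pos_vec // lieZl lieZr.
    by rewrite -scalerDl -intrD.
  apply: lie_sp_ev_scalar => b bi.
  have /andP[hb _] := allP (gen_e_label ha hi) _ bi.
  by rewrite pos_basis_pos // lie_h_pos_vec // (eqP (allP (weight_gen_e hk ha hi) _ bi)).
- rewrite lieBr scalerBr; congr (_ - _).
    rewrite lie_lie (rho_vee_e rel) // lie_rho_pos_vec // lieZr -natr1 scalerDl scale1r.
    exact: addrC.
  apply: lie_sp_ev_scalar => b bi.
  have /andP[hb /eqP htb] := allP (gen_e_label ha hi) _ bi.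
  by rewrite pos_basis_pos // lie_rho_pos_vec // htb.
move=> j hj; rewrite lieBr lie_f_e // IHf //.
rewrite (lie_sp_ev (f := bracket i)); last first.
  move=> k /(allP (gen_f_label ha hj)) /(pos_label_ltW htn); exact: e_rule_label.
rewrite (lie_sp_ev (f := gen_f j)); last first.
  move=> k /(allP (gen_e_label ha hi)) /andP[hk /eqP htk].
  by rewrite pos_basis_pos // Fn // htk.
rewrite (sp_eqP _ (gen_e_step ha hi hj)) sp_ev_cat; apply/eqP; rewrite subr_eq0; apply/eqP.
congr (_ + _); case: eqP => _; rewrite ?sp_ev_nil //; exact: lie_h_basis.
Qed.

Lemma lie_f_pos_vec j a : (j < 6)%N -> (a < 36)%N ->
  lie (f j) (pos_vec a) = sp_ev pos_basis (gen_f j a).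
Proof. by move=> hj ha; apply: (f_e_rules (ht a)).1. Qed.

Lemma lie_e_pos_vec i a : (i < 6)%N -> (a < 36)%N ->
  lie (e i) (pos_vec a) = sp_ev pos_basis (bracket i a).
Proof. by move=> hi ha; apply: (f_e_rules (ht a).+1).2. Qed.

End PositivePart.

(** The negative root vectors are the positive ones for the generators
    (- f_i, - h_i, - e_i), which satisfy the same relations. *)
Section FullBasis.
Variables (K : numClosedFieldType) (g : lieAlgType K) (e h f : nat -> g).
Hypotheses (g_simple : lie_simple g) (rel : chevalley_relations e h f)
  (gen : lie_generating e h f).

Let e' i := - f i.
Let h' i := - h i.
Let f' i := - e i.
Let rel' : chevalley_relations e' h' f' := chevalley_relations_opp rel.
Let gen' : lie_generating e' h' f' := lie_generating_opp gen.

Definition chev_basis k : g :=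
  if (k < 36)%N then pos_vec e k else if (k < 72)%N then pos_vec e' (k - 36) else h (k - 72).
Local Notation B := chev_basis.
Local Notation ev := (sp_ev chev_basis).

Lemma chev_basis_pos k : (k < 36)%N -> B k = pos_vec e k.
Proof. by rewrite /chev_basis => ->. Qed.

Lemma chev_basis_neg k : (k < 36)%N -> B (36 + k) = pos_vec e' k.
Proof.
by move=> hk; rewrite /chev_basis addKn ifT //; lia.
Qed.

Lemma chev_basis_h i : B (72 + i) = h i.
Proof. by rewrite /chev_basis addKn. Qed.

Lemma chev_basis_e i : (i < 6)%N -> B i = e i.
Proof. by move=> hi; rewrite chev_basis_pos ?pos_vec_simple ?(leq_trans hi). Qed.

Lemma chev_basis_f i : (i < 6)%N -> B (36 + i) = - f i.
Proof. by move=> hi; rewrite chev_basis_neg ?pos_vec_simple ?(leq_trans hi). Qed.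

Lemma sp_ev_pos s : all (pos_label_lt 100) (map snd s) -> sp_ev (pos_basis e h) s = ev s.
Proof.
move=> /allP ps; rewrite /sp_ev big_seq [RHS]big_seq; apply: eq_bigr => -[c k] ck.
congr (_ *: _); have /= /orP[/andP[hk _]|/andP[ge_k _]] := ps k (map_f snd ck).
  by rewrite pos_basis_pos // chev_basis_pos.
by rewrite -(subnKC ge_k) pos_basis_h chev_basis_h.
Qed.

Lemma sp_ev_neg s :
  all (pos_label_lt 100) (map snd s) -> sp_ev (pos_basis e' h') s = ev (neg_sp s).
Proof.
move=> /allP ps; rewrite /sp_ev big_map big_seq [RHS]big_seq.
apply: eq_bigr => -[c k] ck.
have /= /orP[/andP[hk _]|/andP[ge_k _]] := ps k (map_f snd ck).
  by rewrite hk pos_basis_pos // chev_basis_neg.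
rewrite ifN /=; last by rewrite -leqNgt; apply: leq_trans ge_k.
by rewrite -(subnKC ge_k) pos_basis_h chev_basis_h intrN scaleNr scalerN.
Qed.

Lemma gen_f_label100 a j : (a < 36)%N -> (j < 6)%N ->
  all (pos_label_lt 100) (map snd (gen_f j a)).
Proof.
move=> ha hj; apply: sub_all (gen_f_label ha hj) => k; apply: pos_label_ltW.
by have := label_ht_le (ltn_addr 42 ha : (a < 78)%N); rewrite /label_ht ha; lia.
Qed.

Lemma gen_e_label100 a i : (a < 36)%N -> (i < 6)%N ->
  all (pos_label_lt 100) (map snd (bracket i a)).
Proof.
move=> ha hi; apply: sub_all (bracket_pos_label hi ha) => k hk.
rewrite /pos_label_lt hk /=.
by have := label_ht_le (ltn_addr 42 hk : (k < 78)%N); rewrite /label_ht hk; lia.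
Qed.

Lemma label_cases (P : nat -> Prop) :
  (forall a, (a < 36)%N -> P a) -> (forall a, (a < 36)%N -> P (36 + a)%N) ->
  (forall i, (i < 6)%N -> P (72 + i)%N) -> forall k, (k < 78)%N -> P k.
Proof.
move=> P1 P2 P3 k hk; have [|ge36] := ltnP k 36; first exact: P1.
have [lt72|ge72] := ltnP k 72.
  by rewrite -(subnKC ge36); apply: P2; lia.
by rewrite -(subnKC ge72); apply: P3; lia.
Qed.

Lemma lie_e_basis i k : (i < 6)%N -> (k < 78)%N -> lie (B i) (B k) = ev (bracket i k).
Proof.
move=> hi; rewrite chev_basis_e //; move: k; apply: label_cases => [a ha|a ha|j hj].
- rewrite chev_basis_pos // (lie_e_pos_vec g_simple rel gen) // sp_ev_pos //.
  exact: gen_e_label100.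
- apply: oppr_inj; rewrite -lieNl chev_basis_neg //.
  rewrite (lie_f_pos_vec g_simple rel' gen') // sp_ev_neg ?gen_f_label100 //.
  have /andP[_ /sp_eqP <-] := bracket_neg hi ha.
  by rewrite sp_ev_scale scaleN1r.
rewrite chev_basis_h (lie_e_h rel) // (eqP (bracket_gen_h hi hj)) !sp_ev1.
by rewrite pos_basis_pos ?chev_basis_pos // (leq_trans hi).
Qed.

Lemma lie_f_basis i k : (i < 6)%N -> (k < 78)%N ->
  lie (B (36 + i)) (B k) = ev (bracket (36 + i) k).
Proof.
move=> hi; rewrite chev_basis_f //; move: k; apply: label_cases => [a ha|a ha|j hj].
- rewrite lieNl chev_basis_pos // (lie_f_pos_vec g_simple rel gen) // sp_ev_pos.
    by rewrite sp_ev_scale scaleN1r opprK.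
  exact: gen_f_label100.
- rewrite chev_basis_neg //.
  rewrite (lie_e_pos_vec g_simple rel' gen') // sp_ev_neg ?gen_e_label100 //.
  by have /andP[/sp_eqP <- _] := bracket_neg hi ha.
rewrite chev_basis_h (eqP (bracket_fgen_h hi hj)) sp_ev1 chev_basis_f //.
by case: rel => _ _ _ hf; rewrite lieC lieNr opprK hf // scalerN.
Qed.

Lemma lie_h_basis_full i k : (i < 6)%N -> (k < 78)%N ->
  lie (B (72 + i)) (B k) = ev (bracket (72 + i) k).
Proof.
move=> hi; rewrite chev_basis_h; move: k; apply: label_cases => [a ha|a ha|j hj].
- rewrite (eqP (bracket_h hi _)) ?(leq_trans ha) // sp_ev1 chev_basis_pos //.
  by rewrite (lie_h_pos_vec rel).
- have lt72 : (36 + a < 72)%N by lia.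
  rewrite (eqP (bracket_h hi lt72)) sp_ev1 chev_basis_neg // (eqP (weight_neg hi ha)).
  by apply: oppr_inj; rewrite -lieNl (lie_h_pos_vec rel') // intrN scaleNr opprK.
by rewrite chev_basis_h (eqP (bracket_hh hi hj)) sp_ev_nil; case: rel => ->.
Qed.

Lemma lie_basis_step l p k s : 
  (forall k, (k < 78)%N -> lie (B l) (B k) = ev (bracket l k)) ->
  (forall k, (k < 78)%N -> lie (B p) (B k) = ev (bracket p k)) ->
  (l < 78)%N -> (p < 78)%N -> (k < 78)%N ->
  lie (s%:~R *: lie (B l) (B p)) (B k) = ev (sp_scale s (sp_app (bracket l) (bracket p k)
     ++ sp_scale (-1) (sp_app (bracket p) (bracket l k)))).
Proof.
move=> lP pP hl hp hk; rewrite lieZl lie_liel sp_ev_scale sp_ev_cat sp_ev_scale scaleN1r.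
rewrite pP // lP //; congr (_ *: (_ - _)); apply: lie_sp_ev => m.
  by move=> /(allP (bracket_label hp hk)); apply: lP.
by move=> /(allP (bracket_label hl hk)); apply: pP.
Qed.

(** Induction on a: ad of a bracket is the commutator of the ad's. *)
Lemma lie_basis a k : (a < 78)%N -> (k < 78)%N -> lie (B a) (B k) = ev (bracket a k).
Proof.
move=> ha; move: k.
have [H1 H2] : (forall a, (a < 36)%N -> forall k, (k < 78)%N -> lie (B a) (B k) = ev (bracket a k))
   /\ (forall a, (a < 36)%N -> forall k, (k < 78)%N ->
         lie (B (36 + a)) (B k) = ev (bracket (36 + a) k)).
  suff H b : (b < 36)%N -> (forall k, (k < 78)%N -> lie (B b) (B k) = ev (bracket b k)) /\
    (forall k, (k < 78)%N -> lie (B (36 + b)) (B k) = ev (bracket (36 + b) k)).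
    by split=> b /H[].
  move: b; apply: pos_root_ind => [i hi|b hb hl hp [IH1 IH2]].
    by split=> k hk; [apply: lie_e_basis | apply: lie_f_basis].
  have hb' : (b < 36)%N by case/andP: hb.
  split=> k hk; have /andP[/sp_eqP E1 /sp_eqP E2] := full_step hb hk.
    rewrite chev_basis_pos // pos_vec_step // -chev_basis_e // -chev_basis_pos // E1.
    by apply: lie_basis_step => //; [move=> l hk'; apply: lie_e_basis | lia | lia].
  rewrite chev_basis_neg // pos_vec_step // -[e' _]chev_basis_f // -chev_basis_neg // E2.
  by apply: lie_basis_step => //; [move=> l hk'; apply: lie_f_basis | lia | lia].
move: a ha; apply: label_cases => [//|//|i hi k]; exact: lie_h_basis_full.
Qed.

Lemma chev_basis_span (P : g -> Prop) : P 0 ->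
  (forall a x y, P x -> P y -> P (a *: x + y)) ->
  (forall k, (k < 78)%N -> P (B k)) -> forall x, P x.
Proof.
move=> P0 Plin PB.
suff H x : exists c : nat -> K, x = \sum_(k < 78) c k *: B k.
  move=> x; have [c ->] := H x; elim/big_ind: _ => // [u v Pu Pv|k _].
    by rewrite -[u]scale1r; apply: Plin.
  by rewrite -[_ *: _]addr0; apply: Plin => //; apply: PB.
pose Q x := exists c : nat -> K, x = \sum_(k < 78) c k *: B k.
have Q0 : Q 0 by exists (fun=> 0); rewrite big1 // => k _; rewrite scale0r.
have Qlin a u v : Q u -> Q v -> Q (a *: u + v).
  move=> [c ->] [d ->]; exists (fun k => a * c k + d k).
  rewrite scaler_sumr -big_split; apply: eq_bigr => k _ /=.
  by rewrite scalerDl scalerA.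
have QD u v : Q u -> Q v -> Q (u + v).
  by move=> Qu; rewrite -[u]scale1r; apply: Qlin.
have QZ a u : Q u -> Q (a *: u) by move=> Qu; rewrite -[_ *: _]addr0; apply: Qlin.
have QB k : (k < 78)%N -> Q (B k).
  move=> hk; exists (fun l => (l == k)%:R); rewrite (bigD1 (Ordinal hk)) //= eqxx scale1r.
  by rewrite big1 ?addr0 // => l; rewrite -val_eqE /= => /negPf ->; rewrite scale0r.
have Qev s : all (fun k => k < 78)%N (map snd s) -> Q (ev s).
  move=> /allP sk; rewrite /sp_ev big_seq; elim/big_ind: _ => // -[c k] ck.
  by apply/QZ/QB/sk/(map_f snd ck).
have Qlie u v : Q u -> Q v -> Q (lie u v).
  move=> [c ->] [d ->]; rewrite lie_suml; apply: (big_ind Q) => // k _.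
  rewrite lie_sumr; apply: (big_ind Q) => // l _; rewrite lieZl lieZr; apply/QZ/QZ.
  by rewrite lie_basis ?ltn_ord //; apply/Qev/bracket_label; apply: ltn_ord.
apply: (gen (P := Q)) => // i hi; split.
- by rewrite -chev_basis_e //; apply: QB; lia.
- by rewrite -chev_basis_h; apply: QB; lia.
- by rewrite -[f i]opprK -chev_basis_f // -scaleN1r; apply/QZ/QB; lia.
Qed.

Lemma moves_toP a k l : (a < 78)%N -> (k < 78)%N -> moves_to a k l ->
  exists2 c : K, c != 0 & lie (B a) (B k) = c *: B l.
Proof.
move=> ha hk; rewrite lie_basis // /moves_to; case: (bracket a k) => [//|[c m] [|//]].
by move=> /andP[c0 /eqP ->]; exists c%:~R; rewrite ?intr_eq0 // sp_ev1.
Qed.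

(** If one basis vector vanished, raising it to the highest root and lowering
    again would make all of them vanish. *)
Lemma chev_basis_neq0 k : (k < 78)%N -> B k != 0.
Proof.
move=> hk; apply/eqP => Bk0.
have B35 : B 35 = 0.
  have [n] := ubnP (23 - label_ht k); elim: n k hk Bk0 => // n IHn k hk Bk0 ltn.
  have /orP[/eqP <- //|/hasP[i + /hasP[l + /andP[/eqP htl mv]]]] := raising hk.
  rewrite !mem_iota => hi hl; have hi' : (i < 78)%N by lia.
  have [c c0] := moves_toP hi' hk mv.
  rewrite Bk0 lie0r => /esym /eqP; rewrite scaler_eq0 (negPf c0) => /eqP Bl0.
  by apply: (IHn l hl Bl0); have := label_ht_le hl; lia.
have B0 l : (l < 78)%N -> B l = 0.
  move=> hl; have [n] := ubnP (23 - label_ht l); elim: n l hl => // n IHn l hl ltn.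
  have /orP[/eqP -> //|/hasP[i + /hasP[m + /andP[/eqP htl mv]]]] := lowering hl.
  rewrite !mem_iota => hi hm; have hi' : (36 + i < 78)%N by lia.
  have [c c0] := moves_toP hi' hm mv.
  rewrite (IHn m) //; last by have := label_ht_le hm; lia.
  by rewrite lie0r => /esym /eqP; rewrite scaler_eq0 (negPf c0) => /eqP.
have g0 (x : g) : x = 0.
  move: x; apply: (chev_basis_span (P := fun x => x = 0)) => // a x y -> ->.
  by rewrite scaler0 addr0.
case: g_simple => nab _; apply: nab; apply/eqP; rewrite -subv0.
by apply/lie_prod_subP => u v _ _; rewrite memv0 (g0 (lie u v)).
Qed.

End FullBasis.

Definition bracket_relations (K : fieldType) (g : lieAlgType K) (B : nat -> g) : Prop :=
  forall a b, (a < 78)%N -> (b < 78)%N -> lie (B a) (B b) = sp_ev B (bracket a b).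

Lemma cartan_injective (K : numClosedFieldType) (x : nat -> K) :
  (forall j, (j < 6)%N -> \sum_(i < 6) x i * (cartan i j)%:~R = 0) ->
  forall l, (l < 6)%N -> x l = 0.
Proof.
move=> xA l hl.
have : \sum_(j < 6) (\sum_(i < 6) x i * (cartan i j)%:~R) * (cartan_adj j l)%:~R = 0.
  by rewrite big1 // => j _; rewrite xA // mul0r.
under eq_bigr do rewrite mulr_suml.
rewrite exchange_big /=.
have E (i : 'I_6) : \sum_(j < 6) x i * (cartan i j)%:~R * (cartan_adj j l)%:~R
   = x i * (if val i == l then 3 else 0).
  have := cartan_adjP (ltn_ord i) hl; set s := foldr _ _ _ => /eqP sE.
  under eq_bigr do rewrite -mulrA -intrM.
  rewrite -mulr_sumr; congr (_ * _).
  rewrite -(rmorph_sum (intmul (1 : K))) /=.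
  have -> : \sum_(j < 6) cartan i j * cartan_adj j l = s.
    by rewrite !big_ord_recr big_ord0 /s /= add0r addr0 !addrA.
  by rewrite sE; case: ifP.
rewrite (eq_bigr _ (fun i _ => E i)) (bigD1 (Ordinal hl)) //= eqxx.
rewrite big1 => [|i]; last first.
  by rewrite -val_eqE /= => /negPf ->; rewrite mulr0.
by rewrite addr0 => /eqP; rewrite mulf_eq0 pnatr_eq0 orbF => /eqP.
Qed.

(** * Bases with the bracket of the table *)

Section Weights.
Variables (K : numClosedFieldType) (g : lieAlgType K) (B : nat -> g).
Hypothesis lieB : bracket_relations B.
Local Notation ev := (sp_ev B).

Definition regular : g := \sum_(i < 6) (regular_coef`_i)%:~R *: B (72 + i)%N.

Lemma lie_regular k : (k < 78)%N -> lie regular (B k) = (regular_wt k)%:~R *: B k.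
Proof.
move=> hk; rewrite lie_suml.
have hE (i : 'I_6) : lie (B (72 + i)%N) (B k) = ev (bracket (72 + i) k).
  by apply: lieB => //; have := ltn_ord i; lia.
under eq_bigr do rewrite lieZl hE.
rewrite /regular_wt; case: ltnP => [lt72|ge72]; last first.
  rewrite scale0r big1 // => i _; rewrite -(subnKC ge72) (eqP (bracket_hh _ _)) //.
    by rewrite sp_ev_nil scaler0.
  by lia.
under eq_bigr => i _ do rewrite (eqP (bracket_h (ltn_ord i) lt72)) sp_ev1 scalerA -intrM.
rewrite -scaler_suml; congr (_ *: _); rewrite !big_ord_recr big_ord0 /= add0r.
by rewrite addr0 !intrD !addrA.
Qed.

(** Root spaces have distinct nonzero eigenvalues for [regular], so a subspace
    stable under it contains the root components of its elements, and their
    components in the Cartan subalgebra. *)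
Lemma weight_components (Z : g -> Prop) (x : nat -> K) : Z 0 ->
  (forall a u v, Z u -> Z v -> Z (a *: u + v)) -> (forall v, Z v -> Z (lie regular v)) ->
  Z (\sum_(k < 78) x k *: B k) ->
  (forall k, (k < 72)%N -> Z (x k *: B k)) /\ Z (\sum_(i < 6) x (72 + i)%N *: B (72 + i)%N).
Proof.
move=> Z0 Zlin Zreg Zx.
have ZT v : Z v -> Z ((lie regular : {linear g -> g}) v) by apply: Zreg.
have gF : {in index_enum 'I_78, forall k : 'I_78,
    gen_eigen (lie regular) ((regular_wt k)%:~R) (x k *: B k)}.
  move=> k _; apply: eigen_gen_eigen; rewrite /= lieZr lie_regular //.
  by rewrite !scalerA mulrC.
have ZS := stable_components_fam Z0 Zlin ZT gF Zx.
have Zk k : (k < 72)%N -> Z (x k *: B k).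
  move=> hk; have hk' : (k < 78)%N by lia.
  have := ZS ((regular_wt k)%:~R); rewrite (big_pred1 (Ordinal hk')) // => l.
  rewrite eqr_int eq_sym (eqP (regular_wt_inj hk (ltn_ord l))) /= -val_eqE /=.
  exact: eq_sym.
split=> //; have := ZS 0.
rewrite (eq_bigl (fun k : 'I_78 => (72 <= k)%N)); last first.
  move=> k; rewrite intr_eq0; have [lt72|ge72] := ltnP k 72; last first.
    by rewrite /regular_wt ltnNge ge72.
  rewrite -[0]/(regular_wt 72) (eqP (regular_wt_inj lt72 _)) //.
  by apply/negbTE; lia.
rewrite (@big_split_ord _ _ _ 72 6) /= big_pred0 ?add0r => [|i].
  rewrite (eq_bigl xpredT) => [|i]; last by rewrite leq_addr.
  by [].
by rewrite leqNgt ltn_ord.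
Qed.

End Weights.

Definition E6_basis (K : fieldType) (g : lieAlgType K) (B : nat -> g) : Prop :=
  bracket_relations B /\ basis_of fullv [tuple B (val k) | k < 78].

Lemma E6_basis_exists (K : numClosedFieldType) (g : lieAlgType K) :
  simple_of_type_E6 g -> exists B : nat -> g, E6_basis B.
Proof.
move=> [g_simple [e0 [h0 [f0 [[hh ef he hf] _ _ gen0]]]]].
pose lft (u : 'I_6 -> g) i := u (inord i).
have val_inord i : (i < 6)%N -> (inord i : 'I_6) = i :> nat by move=> hi; rewrite inordK.
have eq_inord i j : (i < 6)%N -> (j < 6)%N -> ((inord i : 'I_6) == inord j) = (i == j).
  by move=> hi hj; rewrite -val_eqE /= !val_inord.
have cartanE i j : (i < 6)%N -> (j < 6)%N -> E6_cartan (inord i) (inord j) = cartan i j.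
  by move=> hi hj; rewrite mxE eq_inord //= !val_inord.
have rel : chevalley_relations (lft e0) (lft h0) (lft f0).
  split=> i j hi hj; rewrite /lft; first exact: hh.
  - by rewrite ef eq_inord.
  - by rewrite he cartanE.
  - by rewrite hf cartanE.
have gen : lie_generating (lft e0) (lft h0) (lft f0).
  move=> P P0 Plin Plie Pgen; have [U UP] := vspace_of_pred P0 Plin.
  move=> x; apply/UP; rewrite (gen0 U) ?memvf //.
    by apply/lie_subalgebraP => u v /UP Pu /UP Pv; apply/UP/Plie.
  move=> i; have := Pgen i (ltn_ord i); rewrite /lft inord_val => -[Pe Ph Pf].
  by split; apply/UP.
pose B := chev_basis (lft e0) (lft h0) (lft f0).
have lieB : bracket_relations B by move=> a b; apply: lie_basis.
exists B; split=> //.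
set X := [tuple B (val k) | k < 78].
have nthX (k : 'I_78) : X`_k = B k by rewrite (nth_map ord0) ?size_enum_ord // nth_ord_enum.
have memX k : (k < 78)%N -> B k \in X.
  by move=> hk; rewrite -(nthX (Ordinal hk)) mem_nth ?size_tuple.
apply/andP; split.
  rewrite eqEsubv subvf; apply/subvP => x _; move: x.
  apply: (chev_basis_span g_simple rel gen) => [|a x y xX yX|k hk]; first exact: mem0v.
    by rewrite rpredD // rpredZ.
  exact/memv_span/memX.
apply/freeP => c cX k.
pose x l := if insub l is Some i then c i else 0.
have xE (i : 'I_78) : x i = c i by rewrite /x valK.
have x0 : \sum_(l < 78) x l *: B l = 0.
  by rewrite -[RHS]cX; apply: eq_bigr => i _; rewrite nthX xE.
have Z0 a (u v : g) : u = 0 -> v = 0 -> a *: u + v = 0.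
  by move=> -> ->; rewrite scaler0 addr0.
have ZT (v : g) : v = 0 -> lie (regular B) v = 0 by move=> ->; rewrite lie0r.
have [xr xh] := weight_components lieB erefl Z0 ZT x0.
rewrite -xE; have [lt72|ge72] := ltnP k 72.
  have /eqP := xr k lt72; rewrite scaler_eq0 => /orP[/eqP //|].
  by rewrite (negPf (chev_basis_neq0 g_simple rel gen _)).
(* Bracketing a combination of the h_i with the e_j shows that the Cartan matrix
   kills its coefficients. *)
have xA j : (j < 6)%N -> \sum_(i < 6) x (72 + i)%N * (cartan i j)%:~R = 0.
  move=> hj; have /(congr1 (fun u => lie u (B j))) := xh.
  rewrite lie0l lie_suml.
  have E (i : 'I_6) : lie (x (72 + i)%N *: B (72 + i)%N) (B j)
      = (x (72 + i)%N * (cartan i j)%:~R) *: B j.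
    have hj72 : (j < 72)%N by lia.
    have hi78 : (72 + i < 78)%N by have := ltn_ord i; lia.
    rewrite lieZl lieB ?(leq_trans hj) //.

    by rewrite (eqP (bracket_h (ltn_ord i) hj72)) sp_ev1 (eqP (weight_simple _ hj)) // scalerA.
  rewrite (eq_bigr _ (fun i _ => E i)) -scaler_suml => /eqP.
  rewrite scaler_eq0 => /orP[/eqP //|].
  by rewrite (negPf (chev_basis_neq0 g_simple rel gen _)) //; lia.
rewrite -[val k](subnKC ge72).
apply: (cartan_injective (x := fun i => x (72 + i)%N)) => //.
by have := ltn_ord k; lia.
Qed.

(** * Limits in a quadratic cone *)

(** Let D act on V, and let Q be a D-equivariant quadratic map.  When x is in the cone
    Q = 0, the line of exp(tD) x tends, for t going to infinity in a suitable
    complex direction, to the line of an eigenvector in the cone.  The lemmas below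
    obtain this leading term by algebra: a generalized eigencomponent of x, then
    its image under the highest nonzero power of the nilpotent part of D. *)

Section EquivariantQuadraticCone.
Variables (K : numClosedFieldType) (V : vectType K) (W : lmodType K).
Variables (D : {linear V -> V}) (DW : {linear W -> W}) (Q : V -> V -> W).
Hypotheses (Ql : forall y, linear (Q^~ y)) (Qr : forall x, linear (Q x))
  (Q_equiv : forall x y, DW (Q x y) = Q (D x) y + Q x (D y)).

Let QDl x1 x2 y : Q (x1 + x2) y = Q x1 y + Q x2 y.
Proof. by have := Ql y 1 x1 x2; rewrite /= !scale1r. Qed.
Let QDr x y1 y2 : Q x (y1 + y2) = Q x y1 + Q x y2.
Proof. by have := Qr x 1 y1 y2; rewrite !scale1r. Qed.
Let Q0l y : Q 0 y = 0.
Proof. by apply: (addrI (Q 0 y)); rewrite -QDl !addr0. Qed.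
Let Q0r x : Q x 0 = 0.
Proof. by apply: (addrI (Q x 0)); rewrite -QDr !addr0. Qed.
Let QZl a x y : Q (a *: x) y = a *: Q x y.
Proof. by have := Ql y a x 0; rewrite /= Q0l !addr0. Qed.
Let QZr x a y : Q x (a *: y) = a *: Q x y.
Proof. by have := Qr x a y 0; rewrite Q0r !addr0. Qed.

Lemma shift_quadratic s t x y :
  shift DW (s + t) (Q x y) = Q (shift D s x) y + Q x (shift D t y).
Proof.
rewrite /shift Q_equiv scalerDl opprD addrACA; congr (_ + _).
  by rewrite -[in RHS]scaleNr QDl QZl scaleNr.
by rewrite -[in RHS]scaleNr QDr QZr scaleNr.
Qed.

Lemma gen_eigen_quadratic s t x y :
  gen_eigen D s x -> gen_eigen D t y -> gen_eigen DW (s + t) (Q x y).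
Proof.
move=> [k kx] [l ly]; have [n] := ubnP (k + l); elim: n k l x y kx ly => // n IHn k l x y.
case: k => [/= -> _ _|k kx]; first by rewrite Q0l; apply: gen_eigen0.
case: l => [/= -> _|l ly le_n]; first by rewrite Q0r; apply: gen_eigen0.
apply: gen_eigen_shiftV; rewrite shift_quadratic; apply: gen_eigenD.
  by apply: (IHn k l.+1) ; [rewrite -iterSr | | lia].
by apply: (IHn k.+1 l); [| rewrite -iterSr | lia].
Qed.

Let binomial_step (T : nat -> nat -> W) n :
  \sum_(i < n.+1) (T i.+1 (n - i)%N + T i (n - i).+1) *+ 'C(n, i)
  = \sum_(i < n.+2) T i (n.+1 - i)%N *+ 'C(n.+1, i).
Proof.
under eq_bigr do rewrite mulrnDl; rewrite big_split /= addrC.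
rewrite [RHS]big_ord_recl /= bin0 subn0 mulr1n.
under [in RHS]eq_bigr do rewrite /bump /= add1n binS mulrnDr subSS.
rewrite [in RHS]big_split /= [RHS]addrA; congr (_ + _).
rewrite big_ord_recl /= bin0 subn0 mulr1n big_ord_recr /= bin_small // mulr0n addr0.
by congr (_ + _); apply: eq_bigr => i _; rewrite /bump /= add1n subnSK.
Qed.

Lemma iter_shift_quadratic s x n :
  iter n (shift DW (s + s)) (Q x x)
  = \sum_(i < n.+1) Q (iter i (shift D s) x) (iter (n - i) (shift D s) x) *+ 'C(n, i).
Proof.
elim: n => [|n IHn]; first by rewrite big_ord1.
rewrite iterS IHn linear_sum /=.
pose T i j := Q (iter i (shift D s) x) (iter j (shift D s) x).
rewrite -(binomial_step T); apply: eq_bigr => i _.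
by rewrite linearMn /= shift_quadratic.
Qed.

(** A complex number of largest norm is an extreme point: only m + m gives 2 m. *)
Lemma norm_extreme (a b m : K) :
  a + b = m + m -> `|a| <= `|m| -> `|b| <= `|m| -> a = m /\ b = m.
Proof.
move=> abm am bm.
have ab : a = b.
  apply/eqP; rewrite -subr_eq0 -normr_eq0 -sqrf_eq0 eq_le exprn_ge0 ?normr_ge0 // andbT.
  have -> : `|a - b| ^+ 2 = (`|a| ^+ 2 - `|m| ^+ 2) *+ 2 + (`|b| ^+ 2 - `|m| ^+ 2) *+ 2.
    have : `|a + b| ^+ 2 = `|m + m| ^+ 2 by rewrite abm.
    rewrite !normCK !rmorphD !rmorphN /= => E.
    have -> : (a - b) * (a^* - b^*) = (a * a^* + b * b^*) *+ 2 - (a + b) * (a^* + b^*).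
      by ring.
    by rewrite E; ring.
  have le2 (c : K) : `|c| <= `|m| -> (`|c| ^+ 2 - `|m| ^+ 2) *+ 2 <= 0.
    by move=> cm; rewrite mulrn_wle0 // subr_le0 lerXn2r ?nnegrE.
  by rewrite -[0]addr0 lerD ?le2.
have : (a - m) *+ 2 = 0 by rewrite mulr2n addrACA {2}ab abm -opprD subrr.
by move=> /eqP; rewrite mulrn_eq0 /= subr_eq0 => /eqP <-; rewrite -ab.
Qed.

Lemma exists_max_norm (r : seq K) : r != [::] ->
  exists2 m, m \in r & {in r, forall s, `|s| <= `|m|}.
Proof.
elim: r => // s [|t r] IHr _; first by exists s; rewrite ?inE // => u; rewrite inE => /eqP ->.
have [m mr maxm] := IHr isT.
have /orP[le_sm|le_ms] := real_leVge (normr_real s) (normr_real m).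
  exists m; first by rewrite inE mr orbT.
  by move=> u; rewrite inE => /predU1P[->//|/maxm].
exists s; first by rewrite inE eqxx.
by move=> u; rewrite inE => /predU1P[->//|/maxm le_um]; apply: le_trans le_um le_ms.
Qed.

(** For mu of largest norm, the component of Q(x, x) for the eigenvalue 2 mu is
    Q(F mu, F mu).  If N = D - mu has N^(k+1) (F mu) = 0, then applying the
    operator of eigenvalue 2 mu, shifted, 2 k times to Q(F mu, F mu) leaves the single
    term binomial(2k, k) Q(N^k (F mu), N^k (F mu)). *)
Lemma quadratic_cone_eigenvector (E : {vspace V}) x :
    (forall v, v \in E -> D v \in E) -> x \in E -> x != 0 -> Q x x = 0 ->
  exists v mu, [/\ v \in E, v != 0, Q v v = 0 & D v = mu *: v].
Proof.
move=> ED xE x_neq0 Qx.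
have Elin a u v : u \in E -> v \in E -> a *: u + v \in E.
  by move=> uE vE; rewrite rpredD // rpredZ.
have [r [F [ur gF xF]]] := gen_eigen_decomp D x.
have FE : {in r, forall s, F s \in E}.
  by apply: (stable_components (mem0v E) Elin ED ur gF); rewrite -xF.
pose r0 := [seq s <- r | F s != 0].
have xr0 : x = \sum_(s <- r0) F s.
  rewrite big_filter xF [RHS]big_mkcond; apply: eq_bigr => s _.
  by case: eqP => [->|].
have r0_neq : r0 != [::].
  by apply: contraNneq x_neq0 => r00; rewrite xr0 r00 big_nil.
have [mu mur0 max_mu] := exists_max_norm r0_neq.
have [Fmu_neq0 mur] : F mu != 0 /\ mu \in r.
  by move: mur0; rewrite mem_filter => /andP[].
have Qmu : Q (F mu) (F mu) = 0.
  pose r2 := [seq (s, t) | s <- r0, t <- r0].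
  have Qr2 : \sum_(p <- r2) Q (F p.1) (F p.2) = 0.
    rewrite big_allpairs /= -[RHS]Qx [in RHS]xr0.
    rewrite (big_morph (Q^~ _) (fun u v => QDl u v _) (Q0l _)); apply: eq_bigr => s _.
    by rewrite -xr0 [in RHS]xr0 (big_morph (Q _) (QDr _) (Q0r _)).
  have g2 : {in r2, forall p, gen_eigen DW (p.1 + p.2) (Q (F p.1) (F p.2))}.
    by move=> p _; apply: gen_eigen_quadratic.
  have Z0 a (u v : W) : u = 0 -> v = 0 -> a *: u + v = 0.
    by move=> -> ->; rewrite scaler0 addr0.
  have ZT (v : W) : v = 0 -> DW v = 0 by move=> ->; rewrite linear0.
  have := stable_components_fam erefl Z0 ZT g2 Qr2 (mu + mu).
  have mumu : (mu, mu) \in r2 by apply/allpairsP; exists (mu, mu).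
  have ur2 : uniq r2.
    by apply: allpairs_uniq; rewrite ?filter_uniq // => -[? ?] [? ?].
  rewrite big_mkcond (bigD1_seq (mu, mu)) //= eqxx big_seq_cond big1 ?addr0 //.
  move=> [s t] /andP[/allpairsP[[s' t'] /= [sr0 tr0 [-> ->]]] neq].
  case: eqP => // st; case/eqP: neq.
  by have [-> ->] := norm_extreme st (max_mu _ sr0) (max_mu _ tr0).
have [k0 k0P] := gF mu.
have ex_k : exists k, iter k (shift D mu) (F mu) == 0 by exists k0; apply/eqP.
case: (ex_minnP ex_k) => -[|k] /eqP kF min_k; first by rewrite -[F mu]/(iter 0 (shift D mu) _) kF eqxx in Fmu_neq0.
pose v := iter k (shift D mu) (F mu).
have v_neq0 : v != 0 by apply/negP => /min_k; rewrite ltnn.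
exists v, mu; split=> //.
- rewrite /v; elim: (k) => [|l IHl] /=; first exact: FE.
  by rewrite /shift rpredB ?rpredZ ?ED.
- have := iter_shift_quadratic mu (F mu) (k + k); rewrite Qmu iter_shift0.
  have lt_k : (k < (k + k).+1)%N by rewrite ltnS leq_addr.
  rewrite (bigD1 (Ordinal lt_k)) //= addKn big1 ?addr0 => [|i].
    move=> /esym /eqP; rewrite -scaler_nat scaler_eq0 pnatr_eq0.
    by rewrite eqn0Ngt bin_gt0 leq_addr /= => /eqP.
  rewrite -val_eqE /= => i_neq; have [lt_ki|le_ik] := ltnP k i.
    by rewrite (iter_shift_le lt_ki kF) Q0l mul0rn.
  by rewrite [X in Q _ X](@iter_shift_le _ _ _ _ k.+1) ?Q0r ?mul0rn //; lia.
- by apply/eqP; rewrite -subr_eq0; apply/eqP; rewrite -[LHS]/(shift D mu v) -iterS kF.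
Qed.

End EquivariantQuadraticCone.

(** * Invariant form and extremal elements *)

Definition opp_label (a : nat) : nat := if (a < 36)%N then (a + 36)%N else (a - 36)%N.
(** Minus twice the normalized invariant form, so that E_a is extremal below: for
    [E_a, [E_a, E_-a]] = 2 E_a, the value on (E_a, E_-a) has to be 2. *)
Definition form_label (a b : nat) : int :=
  if (a < 72)%N && (b < 72)%N then if b == opp_label a then 2 else 0
  else if (72 <= a)%N && (72 <= b)%N then - (cartan (a - 72) (b - 72) *+ 2) else 0.
Definition sp_form (s : spvec) (b : nat) : int :=
  foldr (fun p z => p.1 * form_label p.2 b + z) 0 s.

Lemma form_labelC a b : (a < 78)%N -> (b < 78)%N -> form_label a b == form_label b a.
Proof. by move: a b; apply: (@check2 0 78 0 78); vm_compute. Qed.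

Lemma form_label_inv c a b : (c < 6)%N -> (a < 78)%N -> (b < 78)%N ->
  (sp_form (bracket c a) b + sp_form (bracket c b) a == 0) &&
  (sp_form (bracket (36 + c) a) b + sp_form (bracket (36 + c) b) a == 0).
Proof. by move: c a b; apply: (@check3 0 6 0 78 0 78); vm_compute. Qed.

Lemma bracket_parent a : (6 <= a < 36)%N ->
  [&& bracket (lead a) (parent a) == [:: (lead_sign a, a)],
      bracket (36 + lead a) (36 + parent a) == [:: (lead_sign a, (36 + a)%N)] &
      lead_sign a != 0].
Proof. by move: a; apply: (@check1 6 30); vm_compute. Qed.

Lemma bracket_ef i : (i < 6)%N -> bracket i (36 + i) == [:: (-1, (72 + i)%N)].
Proof. by move: i; apply: (@check1 0 6); vm_compute. Qed.

Lemma extremal_label b : (b < 78)%N ->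
  sp_eq (sp_app (bracket 35) (bracket 35 b)) [:: (form_label 35 b, 35%N)].
Proof. by move: b; apply: (@check1 0 78); vm_compute. Qed.

Section Coordinates.
Variables (K : numClosedFieldType) (g : lieAlgType K) (B : nat -> g).
Hypothesis hB : E6_basis B.
Local Notation ev := (sp_ev B).

Let lieB : bracket_relations B := hB.1.
Let bas := [tuple B (val k) | k < 78].

Definition coordinate (k : nat) (v : g) : K := coord bas (inord k) v.

Local Notation crd := coordinate.

Lemma crd_lin k a u v : crd k (a *: u + v) = a * crd k u + crd k v.
Proof. by rewrite /coordinate linearP. Qed.
Lemma crdD k u v : crd k (u + v) = crd k u + crd k v. Proof. exact: linearD. Qed.
Lemma crdB k u v : crd k (u - v) = crd k u - crd k v. Proof. exact: linearB. Qed.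
Lemma crdN k u : crd k (- u) = - crd k u. Proof. exact: linearN. Qed.
Lemma crdZ k a u : crd k (a *: u) = a * crd k u. Proof. exact: linearZ. Qed.
Lemma crd0 k : crd k 0 = 0. Proof. exact: linear0. Qed.
Lemma crd_sum k (I : Type) (r : seq I) (P : pred I) (F : I -> g) :
  crd k (\sum_(i <- r | P i) F i) = \sum_(i <- r | P i) crd k (F i).
Proof. exact: linear_sum. Qed.

Lemma nth_bas (k : 'I_78) : bas`_k = B k.
Proof. by rewrite (nth_map ord0) ?size_enum_ord // nth_ord_enum. Qed.

Lemma crd_expand v : v = \sum_(k < 78) crd k v *: B k.
Proof.
have := coord_basis hB.2 (memvf v) => {1}->; apply: eq_bigr => k _.
by rewrite /coordinate inord_val nth_bas.
Qed.

Lemma crd_basis k l : (k < 78)%N -> (l < 78)%N -> crd k (B l) = (k == l)%:R.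
Proof.
move=> hk hl; rewrite -(nth_bas (Ordinal hl)) /crd coord_free ?(basis_free hB.2) //.
by rewrite eq_sym -val_eqE /= inordK.
Qed.

Lemma crd_inj u v : (forall k, (k < 78)%N -> crd k u = crd k v) -> u = v.
Proof.
move=> uv; rewrite (crd_expand u) (crd_expand v); apply: eq_bigr => k _.
by rewrite uv.
Qed.

Lemma crd_sp_ev k s : (k < 78)%N -> all (fun l => l < 78)%N (map snd s) ->
  crd k (ev s) = (sp_coef s k)%:~R.
Proof.
move=> hk; elim: s => [|[c l] s IHs] /=; first by rewrite sp_ev_nil crd0.
move=> /andP[hl hs]; rewrite -cat1s sp_ev_cat sp_ev1 crdD crdZ IHs //.
by rewrite crd_basis // eq_sym; case: eqP => _; rewrite ?mulr1 ?mulr0 ?add0r ?intrD.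
Qed.

Lemma basis_ind (P : g -> Prop) : P 0 -> (forall a u v, P u -> P v -> P (a *: u + v)) ->
  (forall k, (k < 78)%N -> P (B k)) -> forall v, P v.
Proof.
move=> P0 Plin PB v; rewrite (crd_expand v); apply: (big_ind P) => // [x y Px Py|k _].
  by rewrite -[x]scale1r; apply: Plin.
by rewrite -[_ *: _]addr0; apply: Plin => //; apply: PB.
Qed.

Lemma crd_lie_basis c x b : (c < 78)%N -> (b < 78)%N ->
  crd c (lie x (B b)) = \sum_(a < 78) crd a x * (sp_coef (bracket a b) c)%:~R.
Proof.
move=> hc hb; rewrite {1}(crd_expand x) lie_suml crd_sum; apply: eq_bigr => a _.
by rewrite lieZl crdZ lieB // crd_sp_ev // bracket_label.
Qed.

(** Every root vector is an iterated bracket of simple ones or of their opposites,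
    and each h_i is up to sign a bracket of two of these. *)
Lemma lie_gen_ind (P : g -> Prop) : P 0 -> (forall a u v, P u -> P v -> P (a *: u + v)) ->
  (forall u v, P u -> P v -> P (lie u v)) ->
  (forall i, (i < 6)%N -> P (B i) /\ P (B (36 + i)%N)) -> forall v, P v.
Proof.
move=> P0 Plin Plie Pgen; apply: basis_ind => //.
have PZ c u : c != 0 -> P (c *: u) -> P u.
  by move=> c0 Pcu; have := Plin c^-1 _ _ Pcu P0; rewrite addr0 scalerA mulVf // scale1r.
have Ppm a : (a < 36)%N -> P (B a) /\ P (B (36 + a)%N).
  move: a; apply: pos_root_ind => // a ha hl hp [P1 P2].
  have [Pl1 Pl2] := Pgen _ hl.
  have /and3P[/eqP E1 /eqP E2 s0] := bracket_parent ha.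
  split; apply: (@PZ (lead_sign a)%:~R); rewrite ?intr_eq0 // -sp_ev1 -?E1 -?E2 -lieB.
  - exact: Plie.
  - by lia.
  - by lia.
  - exact: Plie.
  - by lia.
  - by lia.
apply: label_cases => [a /Ppm[]//|a /Ppm[]//|i hi].
apply: (@PZ (-1)%:~R); first by rewrite intr_eq0.
rewrite -sp_ev1 -(eqP (bracket_ef hi)) -lieB; [|lia|lia].
by have [] := Pgen i hi; apply: Plie.
Qed.

Definition inv_form x y : K :=
  \sum_(a < 78) \sum_(b < 78) crd a x * crd b y * (form_label a b)%:~R.
Local Notation form := inv_form.

Lemma inv_form_linl y a x1 x2 : form (a *: x1 + x2) y = a * form x1 y + form x2 y.
Proof.
rewrite /inv_form mulr_sumr -big_split; apply: eq_bigr => k _ /=.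
rewrite mulr_sumr -big_split; apply: eq_bigr => l _ /=.
by rewrite crd_lin !mulrDl !mulrA.
Qed.

Lemma inv_formC x y : form x y = form y x.
Proof.
rewrite /inv_form exchange_big; apply: eq_bigr => k _; apply: eq_bigr => l _ /=.
by rewrite (eqP (form_labelC _ _)) // [crd _ _ * _]mulrC.
Qed.

Lemma inv_form_linr x a y1 y2 : form x (a *: y1 + y2) = a * form x y1 + form x y2.
Proof. by rewrite !(inv_formC x) inv_form_linl. Qed.
Lemma inv_form0l y : form 0 y = 0.
Proof. by have := inv_form_linl y (-1) 0 0; rewrite scaler0 addr0 mulN1r => ->; rewrite addNr. Qed.
Lemma inv_form0r y : form y 0 = 0. Proof. by rewrite inv_formC inv_form0l. Qed.
Lemma inv_formDl y x1 x2 : form (x1 + x2) y = form x1 y + form x2 y.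
Proof. by have := inv_form_linl y 1 x1 x2; rewrite scale1r mul1r. Qed.
Lemma inv_formDr y x1 x2 : form y (x1 + x2) = form y x1 + form y x2.
Proof. by rewrite !(inv_formC y) inv_formDl. Qed.
Lemma inv_formZl a x y : form (a *: x) y = a * form x y.
Proof. by have := inv_form_linl y a x 0; rewrite inv_form0l !addr0. Qed.
Lemma inv_formZr a x y : form x (a *: y) = a * form x y.
Proof. by rewrite !(inv_formC x) inv_formZl. Qed.

Lemma inv_form_basis a b : (a < 78)%N -> (b < 78)%N -> form (B a) (B b) = (form_label a b)%:~R.
Proof.
move=> ha hb; rewrite /inv_form (bigD1 (Ordinal ha)) //= (bigD1 (Ordinal hb)) //=.
rewrite !crd_basis // !eqxx !mul1r !big1 ?addr0 // => [k|k] neq.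
  rewrite big1 // => l _; rewrite crd_basis //; move: neq; rewrite -val_eqE /= => /negPf ->.
  by rewrite !mul0r.
rewrite [crd k (B b)]crd_basis //; move: neq; rewrite -val_eqE /= => /negPf ->.
by rewrite mulr0 mul0r.
Qed.

Lemma inv_form_sp_ev s b : all (fun l => l < 78)%N (map snd s) -> (b < 78)%N ->
  form (ev s) (B b) = (sp_form s b)%:~R.
Proof.
move=> + hb; elim: s => [|[c l] s IHs] /=; first by rewrite sp_ev_nil inv_form0l.
move=> /andP[hl hs]; rewrite -cat1s sp_ev_cat sp_ev1 inv_form_linl IHs //.
by rewrite inv_form_basis // intrD intrM.
Qed.

Lemma inv_form_invariant y u v : form (lie y u) v + form u (lie y v) = 0.
Proof.
move: y u v; apply: lie_gen_ind => [u v|a y1 y2 H1 H2 u v|y1 y2 H1 H2 u v|i hi].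
- by rewrite !lie0l inv_form0l inv_form0r addr0.
- by rewrite !lieDl !lieZl inv_form_linl inv_form_linr addrACA -mulrDr H1 H2 mulr0 addr0.
- rewrite !lie_liel !inv_formDl !inv_formDr -!scaleN1r !inv_formZl !inv_formZr !mulN1r.
  have E1 a b : form (lie y1 a) b = - form a (lie y1 b).
    by apply/eqP; rewrite -addr_eq0 H1.
  have E2 a b : form (lie y2 a) b = - form a (lie y2 b).
    by apply/eqP; rewrite -addr_eq0 H2.
  have -> : form (lie y1 (lie y2 u)) v = form u (lie y2 (lie y1 v)).
    by rewrite E1 E2 opprK.
  have -> : form (lie y2 (lie y1 u)) v = form u (lie y1 (lie y2 v)).
    by rewrite E2 E1 opprK.
  by rewrite addrA subrK subrr.
have ext y : (forall a b, (a < 78)%N -> (b < 78)%N ->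
    form (lie y (B a)) (B b) + form (B a) (lie y (B b)) = 0) ->
    forall u v, form (lie y u) v + form u (lie y v) = 0.
  move=> H u v; move: u; apply: basis_ind => [|c u1 u2 H1 H2|a ha].
  - by rewrite lie0r !inv_form0l addr0.
  - by rewrite lieDr lieZr !inv_form_linl addrACA -mulrDr H1 H2 mulr0 addr0.
  move: v; apply: basis_ind => [|c v1 v2 H1 H2|b hb].
  - by rewrite lie0r !inv_form0r addr0.
  - by rewrite lieDr lieZr !inv_form_linr addrACA -mulrDr H1 H2 mulr0 addr0.
  exact: H.
have hi1 : (i < 78)%N by lia.
have hi2 : (36 + i < 78)%N by lia.
by split; apply: ext => a b ha hb; have /andP[/eqP E1 /eqP E2] := form_label_inv hi ha hb;
  rewrite [form (B a) _]inv_formC !lieB // !inv_form_sp_ev ?bracket_label // -intrD ?E1 ?E2.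
Qed.

(** The extremal elements turn out to be the conjugates of the multiples of the
    highest root vector.  The form is fixed, which makes the conditions quadratic in x. *)
Definition extremal x := forall z, lie x (lie x z) = form x z *: x.

Lemma extremalZ a x : extremal x -> extremal (a *: x).
Proof.
by move=> ex z; rewrite !lieZl lieZr ex inv_formZl !scalerA; congr (_ *: _); ring.
Qed.

Lemma extremal_highest : extremal (B 35).
Proof.
apply: basis_ind => [|a u v Hu Hv|b hb].
- by rewrite !lie0r inv_form0r scale0r.
- by rewrite !lieDr !lieZr Hu Hv inv_form_linr scalerDl scalerA.
rewrite lieB // (lie_sp_ev (f := bracket 35)); last first.
  by move=> k /(allP (bracket_label _ hb)) hk; rewrite lieB ?hk.
by rewrite (sp_eqP _ (extremal_label hb)) sp_ev1 inv_form_basis.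
Qed.

(** A bilinear map whose quadratic cone is the set of extremal elements. *)
Definition extremal_defect x y : g -> g := fun z => lie x (lie y z) - form x z *: y.

Definition ad_commutator u (F : g -> g) : g -> g := fun z => lie u (F z) - F (lie u z).

Fact ad_commutator_is_linear u : linear (ad_commutator u).
Proof.
move=> a F G; apply/funext => z; rewrite /ad_commutator.
rewrite !fctE lieDr lieZr scalerBr opprD addrACA. 
by [].
Qed.
HB.instance Definition _ u :=
  GRing.isLinear.Build K (g -> g) (g -> g) _ (ad_commutator u) (ad_commutator_is_linear u).

Lemma extremal_defect_equiv u x y :
  ad_commutator u (extremal_defect x y)
  = extremal_defect (lie u x) y + extremal_defect x (lie u y).
Proof.
apply/funext => z; rewrite /ad_commutator /extremal_defect /=.
have -> : form x (lie u z) = - form (lie u x) z.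
  by apply/eqP; rewrite -addr_eq0 addrC inv_form_invariant.
rewrite lieBr lieZr lie_lie [lie u (lie y z)]lie_lie lieDr scaleNr opprK opprD.
rewrite -[RHS]/(lie (lie u x) (lie y z) - form (lie u x) z *: y
  + (lie x (lie (lie u y) z) - form x z *: lie u y)).
rewrite [X in X - _ + _]addrA [X in X + _]addrAC addrA addrK [RHS]addrACA -[LHS]addrA.
by congr (_ + _); apply: addrC.
Qed.

Lemma extremal_common_eigenvector (U : {vspace g}) : lie_subalgebra U -> lie_solvable U ->
  exists x, [/\ x != 0, extremal x & forall u, u \in U -> exists mu, lie u x = mu *: x].
Proof.
move=> Usub Usol.
pose X (x : g) := x != 0 /\ extremal x.
have r_lin v : linear (fun x : g => lie x v).
  by move=> a x y; rewrite lieDl lieZl.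
have [|||x [x0 ex] xU] := @lie_common_eigenvector K g g
    (fun x => lie x : {linear g -> g}) r_lin X U Usub Usol.
- by move=> x y _ _ v /=; rewrite lie_liel.
- move=> u E uU uE [x xE [x0 ex]].
  pose Q := extremal_defect.
  have Ql y : linear (Q^~ y).
    move=> a x1 x2; apply/funext => z; rewrite /Q /extremal_defect /=.
    rewrite -[RHS]/(a *: (lie x1 (lie y z) - form x1 z *: y)
      + (lie x2 (lie y z) - form x2 z *: y)).
    by rewrite lieDl lieZl inv_form_linl scalerBr scalerDl scalerA opprD addrACA.
  have Qr y : linear (Q y).
    move=> a x1 x2; apply/funext => z; rewrite /Q /extremal_defect /=.
    rewrite -[RHS]/(a *: (lie y (lie x1 z) - form y z *: x1)
      + (lie y (lie x2 z) - form y z *: x2)).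
    rewrite lieDl lieZl lieDr lieZr scalerDr scalerBr opprD addrACA.
    by rewrite !scalerA [a * _]mulrC.
  have Qx : Q x x = 0 by apply/funext => z; rewrite /Q /extremal_defect ex subrr.
  have [v [mu [vE v0 Qv uv]]] := quadratic_cone_eigenvector
    (DW := ad_commutator u) Ql Qr (extremal_defect_equiv u) uE xE x0 Qx.
  exists v, mu; split=> //; split=> // z.
  have /(congr1 (fun F => F z)) := Qv; rewrite /Q /extremal_defect => /eqP.
  by rewrite subr_eq0 => /eqP.
- exists (B 35); split; last exact: extremal_highest.
  apply/eqP => B0; have := crd_basis (isT : (35 < 78)%N) (isT : (35 < 78)%N).
  by rewrite B0 crd0 eqxx => /esym /eqP; rewrite oner_eq0.
by exists x; split.
Qed.

End Coordinates.

(** * Automorphisms and the conjugacy of extremal elements *)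

(** The degree of a label is its coefficient on the simple root 1.  This is the
    grading by the coroot of the highest root, with degrees from -2 to 2; only the
    highest root has degree 2. *)

Definition deg_table : seq int := Eval vm_compute in [seq (rt k)`_1 | k <- iota 0 78].
Definition deg (k : nat) : int := deg_table`_k.
Arguments deg : simpl never.

Lemma cube_zero a b : (a < 72)%N -> (b < 78)%N ->
  sp_eq (sp_app (bracket a) (sp_app (bracket a) (bracket a b))) [::].
Proof. by move: a b; apply: (@check2 0 72 0 78); vm_compute. Qed.

Lemma form_label_lowest a : (a < 78)%N -> form_label a 71 == if a == 35%N then 2 else 0.
Proof. by move: a; apply: (@check1 0 78); vm_compute. Qed.

Lemma bracket_into_highest p a : (36 <= p < 72)%N -> (deg p < 0) -> (a < 78)%N ->
  sp_coef (bracket p a) 35 == 0.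
Proof.
move=> hp dp ha; move: dp; apply/implyP.
by move: p a hp ha; apply: (@check2 36 36 0 78); vm_compute.
Qed.

Lemma bracket_into_deg1 p a c : (36 <= p < 72)%N -> (a < 78)%N -> (c < 36)%N ->
  [&& deg p < 0, deg c == 1 & a != 35%N] ==> (sp_coef (bracket p a) c == 0).
Proof. by move: p a c; apply: (@check3 36 36 0 78 0 36); vm_compute. Qed.

(** The degree is the form against the highest root theta, so for k of degree 1 the
    difference k - theta is a root. *)
Lemma deg1_partner k : (k < 36)%N -> (deg k == 1) ==>
  has (fun p => (deg p == -1) && moves_to p 35 k) (iota 36 36).
Proof. by move: k; apply: (@check1 0 36); vm_compute. Qed.

Lemma lowest_into_h a : (a < 78)%N -> sp_coef (bracket 71 a) 72 == if a == 35%N then 1 else 0.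
Proof. by move: a; apply: (@check1 0 78); vm_compute. Qed.

Lemma lowest_highest_into_deg1 c : (c < 36)%N -> deg c == 1 ->
  sp_coef (bracket 71 35) c == 0.
Proof. by move=> hc; apply/implyP; move: c hc; apply: (@check1 0 36); vm_compute. Qed.

Lemma bracket_lowest a : (a < 78)%N -> (deg a != 1) && (a != 35%N) ==>
  sp_eq (bracket a 71) [:: (sp_coef (bracket a 71) 71, 71%N)].
Proof. by move: a; apply: (@check1 0 78); vm_compute. Qed.

Lemma coroot_deg a : (a < 78)%N ->
  sp_eq (sp_scale (-1) (sp_app (bracket a) (bracket 71 35))) [:: (deg a, a)].
Proof. by move: a; apply: (@check1 0 78); vm_compute. Qed.

Lemma deg_lt2 a : (a < 78)%N -> (a == 35%N) || (deg a < 2).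
Proof. by move: a; apply: (@check1 0 78); vm_compute. Qed.

Lemma deg_pos_root a : (a < 78)%N -> (deg a == 1) ==> (a < 36)%N.
Proof. by move: a; apply: (@check1 0 78); vm_compute. Qed.

Section Automorphisms.
Variables (K : numClosedFieldType) (g : lieAlgType K) (B : nat -> g).
Hypothesis hB : E6_basis B.
Let lieB : bracket_relations B := hB.1.
Local Notation form := (inv_form B).
Local Notation crd := (coordinate B).
Local Notation extremal := (extremal B).

Definition is_aut (phi : g -> g) : Prop :=
  [/\ linear phi, bijective phi, (forall x y, phi (lie x y) = lie (phi x) (phi y))
    & forall x y, form (phi x) (phi y) = form x y].

Lemma is_aut_id : is_aut id.
Proof. by split=> //; exists id. Qed.

Lemma is_aut_comp phi psi : is_aut phi -> is_aut psi -> is_aut (phi \o psi).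
Proof.
move=> [l1 b1 h1 f1] [l2 b2 h2 f2]; split=> [a x y||x y|x y] /=.
- by rewrite l2 l1.
- exact: bij_comp.
- by rewrite h2 h1.
- by rewrite f1 f2.
Qed.

Lemma aut0 phi : is_aut phi -> phi 0 = 0.
Proof.
move=> [l _ _ _]; have := l (-1) 0 0; rewrite scaler0 addr0 scaleN1r.
by rewrite addNr.
Qed.

Lemma autZ phi a x : is_aut phi -> phi (a *: x) = a *: phi x.
Proof. by move=> aut; have [l _ _ _] := aut; have := l a x 0; rewrite (aut0 aut) !addr0. Qed.

Lemma aut_extremal phi x : is_aut phi -> extremal x -> extremal (phi x).
Proof.
move=> aut ex z; have [_ [psi _ phiK] hm fm] := aut.
by rewrite -(phiK z) -!hm ex fm (autZ _ _ aut).
Qed.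

(** The exponential of ad b, when the cube of ad b vanishes. *)
Definition exp_ad (b z : g) : g := z + lie b z + 2^-1 *: lie b (lie b z).

Section ExpAd.
Variable b : g.
Hypothesis b3 : forall z, lie b (lie b (lie b z)) = 0.

Lemma exp_adK : cancel (exp_ad b) (exp_ad (- b)).
Proof.
move=> z; rewrite /exp_ad; set A := lie b z; set AA := lie b A.
have E1 : lie (- b) (z + A + 2^-1 *: AA) = - (A + AA).
  by rewrite lieNl !lieDr lieZr b3 scaler0 addr0.
rewrite E1 lieNl lieNr lieDr b3 addr0 opprK -/A -/AA.
by apply: (crd_inj hB) => k _; rewrite !(crdD, crdN, crdZ); field.
Qed.
End ExpAd.

(** The relations d3 and d4 in the proof are the vanishing of the third and fourth
    derivatives of the bracket, by the Leibniz rule. *)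
Lemma exp_ad_aut b : (forall z, lie b (lie b (lie b z)) = 0) -> is_aut (exp_ad b).
Proof.
move=> b3; split.
- move=> a x y; apply: (crd_inj hB) => k _.
  by rewrite /exp_ad !(lieDr, lieZr) !(crdD, crdZ); field.
- exists (exp_ad (- b)); first exact: exp_adK.
  have := @exp_adK (- b); rewrite opprK; apply=> z.
  by rewrite !lieNl !lieNr b3 !oppr0.
- move=> x y; rewrite /exp_ad.
  set x1 := lie b x; set x2 := lie b x1; set y1 := lie b y; set y2 := lie b y1.
  have D u v : lie b (lie u v) = lie (lie b u) v + lie u (lie b v) by exact: lie_lie.
  have mulz n (u : g) : u *+ n.+1 = 0 -> u = 0.
    by move=> /eqP; rewrite -scaler_nat scaler_eq0 pnatr_eq0 => /eqP.
  have d2 : lie b (lie b (lie x y)) = lie x2 y + (lie x1 y1 + lie x1 y1) + lie x y2.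
    by rewrite (D x) -/x1 -/y1 lieDr (D x1) (D x) -/x2 -/y2 !addrA.
  have d3 : lie x2 y1 + lie x1 y2 = 0.
    apply: (mulz 2); have := b3 (lie x y).
    rewrite d2 !lieDr (D x2) (D x1) (D x) -/x1 -/x2 -/y1 -/y2 !b3 lie0l lie0r add0r addr0.
    move=> <-; apply: (crd_inj hB) => k _; rewrite !mulrSr mulr0n add0r !crdD; ring.
  have d4 : lie x2 y2 = 0.
    have /(congr1 (lie b)) := d3.
    rewrite lieDr (D x2) (D x1) -/x2 -/y2 !b3 lie0l lie0r add0r addr0 lie0r -mulr2n.
    exact: mulz.
  rewrite d2 (D x) -/x1 -/y1 !(lieDl, lieDr, lieZl, lieZr) d4.
  apply: (crd_inj hB) => k _; have /(congr1 (crd k)) := d3.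
  rewrite !(crdD, crdZ, mulr2n, crd0) => E.
  have -> : crd k (lie x1 y2) = - crd k (lie x2 y1).
    by apply/eqP; rewrite -addr_eq0 addrC E.
  by field.
- move=> x y; rewrite /exp_ad.
have skew u v : form (lie b u) v = - form u (lie b v).
  by apply/eqP; rewrite -addr_eq0 (inv_form_invariant hB).
rewrite !(inv_formDl B, inv_formDr B, inv_formZl B, inv_formZr B) !skew !b3 lie0r !(inv_form0r B).
by field.
Qed.

Lemma exp_root_aut a t : (a < 72)%N -> is_aut (exp_ad (t *: B a)).
Proof.
move=> ha; have ha' : (a < 78)%N by lia.
apply: exp_ad_aut => z; rewrite !(lieZl, lieZr).
suff -> : lie (B a) (lie (B a) (lie (B a) z)) = 0 by rewrite !scaler0.
move: z; apply: (basis_ind hB) => [|c u v Hu Hv|k hk].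
- by rewrite !lie0r.
- by rewrite !lieDr !lieZr Hu Hv scaler0 addr0.
have lab s : all (fun l => l < 78)%N (map snd s) ->
    lie (B a) (sp_ev B s) = sp_ev B (sp_app (bracket a) s).
  by move=> /allP hs; apply: lie_sp_ev => l /hs hl; rewrite lieB.
have app_lab s : all (fun l => l < 78)%N (map snd s) ->
    all (fun l => l < 78)%N (map snd (sp_app (bracket a) s)).
  move=> /allP hs; apply/allP => l /mapP[[c m] /flattenP[u /mapP[[d n] dn ->]]].
  case/mapP=> -[e q] eq_ [_ ->] ->; apply: (allP (bracket_label ha' (hs n _))).
    exact: (map_f snd dn).
  exact: (map_f snd eq_).
have lk := bracket_label ha' hk.
rewrite lieB // lab // lab ?app_lab //.
by rewrite (sp_eqP _ (cube_zero ha hk)) sp_ev_nil.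
Qed.

Lemma crd_bracket c p x : (c < 78)%N -> (p < 78)%N ->
  crd c (lie (B p) x) = \sum_(a < 78) crd a x * (sp_coef (bracket p a) c)%:~R.
Proof.
move=> hc hp; rewrite {1}(crd_expand hB x) lie_sumr crd_sum; apply: eq_bigr => a _.
by rewrite lieZr crdZ lieB // crd_sp_ev // bracket_label.
Qed.

Lemma crd_bracket0 c p x : (c < 78)%N -> (p < 78)%N ->
  (forall a, (a < 78)%N -> sp_coef (bracket p a) c = 0) -> crd c (lie (B p) x) = 0.
Proof. by move=> hc hp H; rewrite crd_bracket // big1 // => a _; rewrite H ?mulr0. Qed.

Lemma crd_bracket1 c p b x : (c < 78)%N -> (p < 78)%N -> (b < 78)%N ->
  (forall a, (a < 78)%N -> a != b -> sp_coef (bracket p a) c = 0) ->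
  crd c (lie (B p) x) = crd b x * (sp_coef (bracket p b) c)%:~R.
Proof.
move=> hc hp hb H; rewrite crd_bracket // (bigD1 (Ordinal hb)) //= big1 ?addr0 // => a.
by rewrite -val_eqE /= => ab; rewrite H ?mulr0.
Qed.

Lemma crd_exp c p t x : crd c (exp_ad (t *: B p) x)
  = crd c x + t * crd c (lie (B p) x) + 2^-1 * t ^+ 2 * crd c (lie (B p) (lie (B p) x)).
Proof.
by rewrite /exp_ad !(lieZl, lieZr) !(crdD, crdZ) expr2 !mulrA.
Qed.

Lemma form_lowest x : form x (B 71) = 2 * crd 35 x.
Proof.
rewrite {1}(crd_expand hB x).
rewrite (big_morph (form^~ _) (fun u v => inv_formDl B _ u v) (inv_form0l B _)).
rewrite (bigD1 (Ordinal (isT : 35 < 78)%N)) //= big1 ?addr0 => [|a].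
  by rewrite inv_formZl inv_form_basis // (eqP (form_label_lowest _)) // mulrC.
rewrite -val_eqE /= => /negPf ne.
by rewrite inv_formZl inv_form_basis // (eqP (form_label_lowest _)) // ne mulr0.
Qed.

Hypothesis g_simple : lie_simple g.

(** The elements all of whose conjugates have no coordinate on the highest root form
    a subspace stable under automorphisms, hence an ideal, as the difference of
    two exponentials of ad E_a shows; it does not contain the highest root vector. *)
Lemma move_to_highest_coef x : x != 0 -> exists2 phi, is_aut phi & crd 35 (phi x) != 0.
Proof.
move=> x0; apply: contrapT => no.
pose M y := forall phi, is_aut phi -> form (phi y) (B 71) = 0.
have Mx : M x.
  move=> phi aut; apply/eqP; apply: contra_notT no; rewrite form_lowest mulf_eq0 negb_or.
  by move=> /andP[_ nz]; exists phi.
have Mlin a u v : M u -> M v -> M (a *: u + v).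
  move=> Mu Mv phi aut; have [l _ _ _] := aut.
  by rewrite l inv_form_linl Mu // Mv // mulr0 addr0.
have M0 : M 0 by move=> phi aut; rewrite aut0 // inv_form0l.
have Mexp a t y : (a < 72)%N -> M y -> M (exp_ad (t *: B a) y).
  by move=> ha My phi aut; apply: (My (phi \o exp_ad (t *: B a))); apply: is_aut_comp (exp_root_aut _ _).
have Mgen a y : (a < 72)%N -> M y -> M (lie (B a) y).
  move=> ha My.
  have := Mlin (-1) _ _ (Mexp a (-1) y ha My) (Mexp a 1 y ha My).
  rewrite scaleN1r scaleN1r scale1r /exp_ad !(lieNl, lieNr) opprK.
  set z := (X in M X) => Mz; have -> : lie (B a) y = 2^-1 *: z + 0.
    by apply: (crd_inj hB) => k _; rewrite /z !(crdD, crdZ, crdN, crd0); field.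
  exact: Mlin.
have [I IP] := vspace_of_pred M0 Mlin.
have Iid : lie_ideal fullv I.
  split; first exact: subvf.
  apply/lie_prod_subP => u v _ /IP; move: u v.
  suff H u : forall v, M v -> M (lie u v) by move=> u v /H Mv; apply/IP.
  move: u; apply: (lie_gen_ind hB) => [v _|a u1 u2 H1 H2 v Mv|u1 u2 H1 H2 v Mv|i hi].
  - by rewrite lie0l.
  - by rewrite lieDl lieZl; apply: Mlin; [apply: H1 | apply: H2].
  - rewrite lie_liel addrC -scaleN1r; apply: Mlin; first exact/H2/H1.
    exact/H1/H2.
  by split=> v; apply: Mgen; lia.
have [I0|Ifull] := g_simple.2 I Iid.
  by have /IP := Mx; rewrite I0 memv0 (negPf x0).
have /IP /(_ id is_aut_id) : B 35 \in I by rewrite Ifull memvf.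
rewrite form_lowest crd_basis // mulr1 => /eqP; by rewrite pnatr_eq0.
Qed.

(** The exponential of ad t E_p with p = k - theta, for the highest root theta, shifts
    the coordinate on k by a multiple of t, without changing the coordinates on theta
    and on the other roots of degree 1. *)
Lemma deg1_coef_zero (ks : seq nat) x : crd 35 x = 1 ->
    all (fun k => (k < 36)%N && (deg k == 1)) ks ->
  exists2 phi, is_aut phi & crd 35 (phi x) = 1 /\ {in ks, forall k, crd k (phi x) = 0}.
Proof.
move=> x1; elim: ks => [_|k ks IHks /= /andP[/andP[hk dk] hks]].
  by exists id; [apply: is_aut_id | split].
have [phi aut [y1 y0]] := IHks hks; set y := phi x in y1 y0.
have /hasP[p + /andP[/eqP dp mv]] := implyP (deg1_partner hk) dk.
rewrite mem_iota => hp; have hp' : (p < 78)%N by lia.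
have hk' : (k < 78)%N by lia.
have dneg : deg p < 0 by rewrite dp.
have E35 z : crd 35 (lie (B p) z) = 0.
  by apply: crd_bracket0 => // a ha; apply/eqP/bracket_into_highest.
have E1 z c : (c < 36)%N -> deg c == 1 ->
    crd c (lie (B p) z) = crd 35 z * (sp_coef (bracket p 35) c)%:~R.
  move=> hc dc; have hc' : (c < 78)%N by lia.
  apply: crd_bracket1 => // a ha a35; apply/eqP.
  by apply: (implyP (bracket_into_deg1 hp ha hc)); rewrite dneg dc.
move: mv; rewrite /moves_to; case pk: (bracket p 35) => [//|[s l] [|//]] /andP[s0 /eqP lk].
pose t : K := - crd k y / s%:~R.
exists (exp_ad (t *: B p) \o phi); first by apply: is_aut_comp => //; apply: exp_root_aut; lia.
rewrite /= -/y; split; first by rewrite crd_exp !E35 !mulr0 !addr0.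
have Ec c : (c < 36)%N -> deg c == 1 ->
    crd c (exp_ad (t *: B p) y) = crd c y + t * (if k == c then s else 0)%:~R.
  move=> hc dc; rewrite crd_exp !(E1 _ _ hc dc) E35 mul0r mulr0 addr0 y1 mul1r pk /= lk.
  by case: eqP; rewrite ?addr0.
move=> c; rewrite inE => /predU1P[->|cks].
  by rewrite Ec // eqxx /t divfK ?subrr ?intr_eq0 // addrN.
have /andP[hc dc] := allP hks _ cks; rewrite Ec // y0 // add0r.
have [kc|_] := eqVneq k c; last by rewrite mulr0.
by rewrite /t kc y0 // oppr0 !mul0r.
Qed.

(** The coordinate on h_0 is then removed by the lowest root vector, of degree -2:
    the coefficient of the highest root on alpha_0 is 1. *)
Lemma normalize_extremal x : crd 35 x = 1 ->
  exists2 phi, is_aut phi & [/\ crd 35 (phi x) = 1, crd 72 (phi x) = 0 &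
    forall k, (k < 78)%N -> deg k == 1 -> crd k (phi x) = 0].
Proof.
move=> x1; pose ks := [seq k <- iota 0 36 | deg k == 1].
have hks : all (fun k => (k < 36)%N && (deg k == 1)) ks.
  by apply/allP => k; rewrite mem_filter mem_iota => /andP[-> /= ->].
have [phi aut [y1 y0]] := deg1_coef_zero x1 hks; set y := phi x in y1 y0.
have d71 : (36 <= 71 < 72)%N by [].
have E35 z : crd 35 (lie (B 71) z) = 0.
  by apply: crd_bracket0 => // a ha; apply/eqP/bracket_into_highest.
have E72 z : crd 72 (lie (B 71) z) = crd 35 z.
  rewrite (crd_bracket1 (b := 35)) // => [|a ha a35]; rewrite (eqP (lowest_into_h _)) //.
    by rewrite mulr1.
  by rewrite (negPf a35).
have E1 z c : (c < 36)%N -> deg c == 1 -> crd c (lie (B 71) z) = 0.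
  move=> hc dc; have hc' : (c < 78)%N by lia.
  apply: crd_bracket0 => // a ha; have [->|a35] := eqVneq a 35%N.
    by apply/eqP/lowest_highest_into_deg1.
  by apply/eqP/(implyP (bracket_into_deg1 d71 ha hc)); rewrite dc a35.
exists (exp_ad (- crd 72 y *: B 71) \o phi).
  by apply: is_aut_comp => //; apply: exp_root_aut.
rewrite /= -/y; split.
- by rewrite crd_exp !E35 !mulr0 !addr0.
- by rewrite crd_exp !E72 E35 mulr0 addr0 y1 mulr1 subrr.
move=> k hk dk; have hk36 := implyP (deg_pos_root hk) dk.
rewrite crd_exp !(E1 _ _ hk36 dk) !mulr0 !addr0 y0 //.
by rewrite mem_filter dk mem_iota.
Qed.

(** With hv the coroot of the highest root, [x, E_71] = s E_71 - hv for some s.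
    The equation [x, [x, E_71]] = 2 x then reads
    (deg k - 2) x_k = s hv_k - s^2 delta_(k, 71) on coordinates; at k = 72 it gives
    s = 0, and then x_k = 0 for k other than the highest root. *)
Lemma normalized_extremal_highest x : extremal x -> crd 35 x = 1 -> crd 72 x = 0 ->
  (forall k, (k < 78)%N -> deg k == 1 -> crd k x = 0) -> x = B 35.
Proof.
move=> ex x1 x72 xdeg1.
pose hv := lie (B 71) (B 35).
have hvE : hv = sp_ev B (bracket 71 35) by apply: lieB.
have hv_deg a : (a < 78)%N -> lie hv (B a) = (deg a)%:~R *: B a.
  move=> ha; rewrite -sp_ev1 -(sp_eqP _ (coroot_deg ha)) sp_ev_scale scaleN1r lieC hvE.
  congr (- _); apply: lie_sp_ev => l /(allP (bracket_label _ _)) hl.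
  by apply: lieB => //; apply: hl.
have [s sE] : exists s, lie x (B 71) = s *: B 71 - hv.
  rewrite {1}(crd_expand hB x) lie_suml (bigD1 (Ordinal (isT : 35 < 78)%N)) //=.
  rewrite x1 scale1r [lie (B 35) _]lieC -/hv.
  suff [s ->] : exists s, \sum_(i < 78 | i != Ordinal (isT : 35 < 78)%N)
      lie (crd i x *: B i) (B 71) = s *: B 71 by exists s; rewrite addrC.
  apply: (big_ind (fun v => exists s, v = s *: B 71)) => [|u v [s1 ->] [s2 ->]|a].
  - by exists 0; rewrite scale0r.
  - by exists (s1 + s2); rewrite scalerDl.
  rewrite -val_eqE /= => a35; have [da|da] := boolP (deg a == 1).
    by exists 0; rewrite xdeg1 // scale0r lie0l scale0r.
  rewrite lieZl lieB //.
  have ab : (deg a != 1) && (val a != 35%N) by rewrite da.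
  rewrite (sp_eqP _ (implyP (bracket_lowest (ltn_ord a)) ab)) sp_ev1 scalerA.
  by eexists.
have hvx k : (k < 78)%N -> crd k (lie hv x) = (deg k)%:~R * crd k x.
  move=> hk; rewrite {1}(crd_expand hB x) lie_sumr crd_sum (bigD1 (Ordinal hk)) //= big1.
    by rewrite lieZr crdZ hv_deg // crdZ crd_basis // eqxx mulr1 addr0 mulrC.
  move=> a; rewrite -val_eqE /= => ak.
  by rewrite lieZr crdZ hv_deg // crdZ crd_basis // eq_sym (negPf ak) !mulr0.
have key k : (k < 78)%N -> (deg k)%:~R * crd k x + s * (s * (k == 71%N)%:R
    - (sp_coef (bracket 71 35) k)%:~R) = 2 * crd k x.
  move=> hk; have := ex (B 71); rewrite form_lowest x1 mulr1 sE lieBr lieZr sE.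
  rewrite [lie x hv]lieC opprK => /(congr1 (crd k)).
  rewrite crdD hvx // !(crdZ, crdB) crd_basis // hvE crd_sp_ev ?bracket_label //.
  by rewrite addrC.
have s0 : s = 0.
  have := key 72%N isT; rewrite x72 !mulr0 add0r (eqP (lowest_into_h _)) // sub0r.
  by move=> /eqP; rewrite mulrN1 oppr_eq0 => /eqP.
apply: (crd_inj hB) => k hk; rewrite crd_basis //.
have [->|k35] := eqVneq k 35%N; first exact: x1.
have := key k hk; rewrite s0 mul0r addr0 => /eqP; rewrite -subr_eq0 -mulrBl mulf_eq0.
case/orP=> [|/eqP //]; rewrite subr_eq0 -[2]/(2%:~R) eqr_int => /eqP dk.
by have := deg_lt2 hk; rewrite (negPf k35) dk.
Qed.

Lemma extremal_conjugate x : x != 0 -> extremal x ->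
  exists phi c, [/\ is_aut phi, c != 0 & phi x = c *: B 35].
Proof.
move=> x0 ex; have [phi aut c0] := move_to_highest_coef x0.
set c := crd 35 (phi x) in c0; pose y := c^-1 *: phi x.
have y1 : crd 35 y = 1 by rewrite /y crdZ mulVf.
have ey : extremal y by apply/extremalZ/aut_extremal.
have [psi aut' [z1 z72 zdeg]] := normalize_extremal y1.
exists (psi \o phi), c; split=> //; first exact: is_aut_comp.
have zE := normalized_extremal_highest (aut_extremal aut' ey) z1 z72 zdeg.
by rewrite /= -zE -autZ // /y scalerA divff // scale1r.
Qed.

End Automorphisms.

(** * The parabolic subalgebra and flags in dimension 6 *)

(** The labels of degree 0 span gl_6: the simple roots 0, 2, 3, 4, 5 form a diagram of
    type A5, and h_1 completes the diagonal.  With the chosen signs, a positive root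
    chain from i to j - 1 maps to the elementary matrix E_ij and its opposite to
    - E_ji; h_1 maps to diag(0, 0, 0, 1, 1, 1) since alpha_3 takes value -1 on it.
    The labels of positive degree map to 0. *)

Definition chain : seq nat := [:: 0; 2; 3; 4; 5]%N.
Definition chain_root (i j : nat) : seq int :=
  mkseq (fun l => ((l \in chain) && (i <= index l chain < j)%N)%:R) 6.
Definition gl6_entry (k i j : nat) : int :=
  if (k < 36)%N then ((i < j)%N && (rt k == chain_root i j))%:R
  else if (k < 72)%N then - ((j < i)%N && (rt (k - 36) == chain_root j i))%:R
  else if i != j then 0
  else if k == 73%N then (2 < i)%N%:R
  else (i == index (k - 72)%N chain)%:R - (i == (index (k - 72)%N chain).+1)%:R.
Definition gl6_table : seq (seq (seq int)) := Eval vm_compute in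
  mkseq (fun k => mkseq (fun i => mkseq (gl6_entry k i) 6) 6) 78.
Definition gl6 (k i j : nat) : int := (nth [::] (nth [::] gl6_table k) i)`_j.
Arguments gl6 : simpl never.
Definition sp_gl6 (s : spvec) (i j : nat) : int := foldr (fun p z => p.1 * gl6 p.2 i j + z) 0 s.
Definition int_sum (n : nat) (F : nat -> int) : int := foldr (fun l z => F l + z) 0 (iota 0 n).

Lemma gl6_bracket a b : (a < 78)%N -> (b < 78)%N ->
  if (deg a == 0) && (deg b == 0) then
    let A := nth [::] gl6_table a in let A' := nth [::] gl6_table b in
    all (fun i => all (fun j => sp_gl6 (bracket a b) i j
       == int_sum 6 (fun l => (nth [::] A i)`_l * (nth [::] A' l)`_j)
        - int_sum 6 (fun l => (nth [::] A' i)`_l * (nth [::] A l)`_j))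
     (iota 0 6)) (iota 0 6)
  else true.
Proof. by move: a b; apply: (@check2 0 78 0 78); vm_compute. Qed.

Lemma gl6_deg k i j : (k < 78)%N -> (i < 6)%N -> (j < 6)%N ->
  (deg k == 0) || (gl6 k i j == 0).
Proof. by move: k i j; apply: (@check3 0 78 0 6 0 6); vm_compute. Qed.

Lemma bracket_deg a b : (a < 78)%N -> (b < 78)%N ->
  all (fun k => deg k == deg a + deg b) (map snd (bracket a b)).
Proof. by move: a b; apply: (@check2 0 78 0 78); vm_compute. Qed.

Lemma has_iota m n (P : nat -> bool) :
  has P (iota m n) -> exists2 k, (m <= k < m + n)%N & P k.
Proof. by case/hasP=> k; rewrite mem_iota; exists k. Qed.

(** These root vectors of degree 0 yield the automorphisms that act on gl_6 as row
    operations. *)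
Lemma gl6_root i j : (i < 6)%N -> (j < 6)%N -> 
  if i != j then
    has (fun k => if (deg k == 0) && (gl6 k i j != 0) then
      all (fun i' => all (fun j' => (gl6 k i' j' == 0) || ((i' == i) && (j' == j)))
        (iota 0 6)) (iota 0 6) else false) (iota 0 72)
  else true.
Proof. by move: i j; apply: (@check2 0 6 0 6); vm_compute. Qed.

Lemma gl6_lower k : (36 <= k < 72)%N -> 
  if 0 <= deg k then
    has (fun i => has (fun j => if (j < i)%N && (gl6 k i j != 0) then
      all (fun l => (gl6 l i j == 0) || (l == k)) (iota 0 78) else false) (iota 0 6)) (iota 0 6)
  else true.
Proof. by move: k; apply: (@check1 36 36); vm_compute. Qed.

(** The coordinate c of [y, E_35] only involves the coordinate of y on k.  So an
    element normalizing the line of E_35 has no coordinate of negative degree. *)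
Lemma normalizer_label k : (k < 78)%N -> 
  if deg k < 0 then
    has (fun c => if (c != 35%N) && (sp_coef (bracket k 35) c != 0) then
      all (fun l => (sp_coef (bracket l 35) c == 0) || (l == k)) (iota 0 78) else false)
      (iota 0 78)
  else true.
Proof. by move: k; apply: (@check1 0 78); vm_compute. Qed.

(** [upper n] cuts out a filtration of the standard Borel subalgebra: positive roots
    of height at least n, with the h_i for n = 0. *)
Definition upper (n k : nat) : bool := (k < 36)%N && (n <= ht k)%N || (72 <= k < 78)%N && (n == 0)%N.

Lemma bracket_upper n a b : (n < 12)%N -> (a < 78)%N -> (b < 78)%N ->
  upper n a && upper n b ==> all (upper n.+1) (map snd (bracket a b)).
Proof. by move: n a b; apply: (@check3 0 12 0 78 0 78); vm_compute. Qed.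

Lemma upper12 k : (k < 78)%N -> ~~ upper 12 k.
Proof. by move: k; apply: (@check1 0 78); vm_compute. Qed.

Lemma upper0 k : (k < 78)%N -> upper 0 k = ~~ (36 <= k < 72)%N.
Proof. by move=> hk; apply/eqP; move: k hk; apply: (@check1 0 78); vm_compute. Qed.

Section Flags.
Variables (K : numClosedFieldType) (g : lieAlgType K) (B : nat -> g).
Hypothesis hB : E6_basis B.
Let lieB : bracket_relations B := hB.1.
Local Notation crd := (coordinate B).
Local Notation is_aut := (is_aut B).

Definition parabolic x := forall k, (k < 78)%N -> deg k < 0 -> crd k x = 0.

Lemma parabolic0 : parabolic 0. Proof. by move=> k _ _; rewrite crd0. Qed.
Lemma parabolic_lin a x y : parabolic x -> parabolic y -> parabolic (a *: x + y).
Proof. by move=> px py k hk dk; rewrite crd_lin px // py // mulr0 addr0. Qed.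

Lemma parabolic_basis k : (k < 78)%N -> 0 <= deg k -> parabolic (B k).
Proof.
move=> hk dk l hl dl; rewrite (crd_basis hB) //; case: eqP => // lk.
by move: dl; rewrite lk ltNge dk.
Qed.

Lemma parabolic_ind (P : g -> Prop) : P 0 ->
  (forall a u v, P u -> P v -> P (a *: u + v)) ->
  (forall k, (k < 78)%N -> 0 <= deg k -> P (B k)) -> forall x, parabolic x -> P x.
Proof.
move=> P0 Plin PB x px; rewrite (crd_expand hB x).
apply: (big_ind P) => // [u v Pu Pv|k _]; first by rewrite -[u]scale1r; apply: Plin.
have [dk|dk] := ltP (deg k) 0; first by rewrite px // scale0r.
by rewrite -[_ *: _]addr0; apply: Plin => //; apply: PB.
Qed.

Lemma parabolic_lie x y : parabolic x -> parabolic y -> parabolic (lie x y).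
Proof.
move=> px py; move: x px; apply: parabolic_ind => [|a u v Hu Hv|k hk dk].
- by rewrite lie0l; apply: parabolic0.
- by rewrite lieDl lieZl; apply: parabolic_lin.
move: y py; apply: parabolic_ind => [|a u v Hu Hv|l hl dl].
- by rewrite lie0r; apply: parabolic0.
- by rewrite lieDr lieZr; apply: parabolic_lin.
rewrite lieB // /sp_ev big_seq; apply: (big_ind parabolic).
- exact: parabolic0.
- by move=> u v pu pv; rewrite -[u]scale1r; apply: parabolic_lin.
move=> [c m] cm; rewrite -[_ *: _]addr0; apply: parabolic_lin parabolic0.
have ms := map_f snd cm.
apply: parabolic_basis; first exact: (allP (bracket_label hk hl)).
by rewrite (eqP (allP (bracket_deg hk hl) _ ms)) addr_ge0.
Qed.

Lemma normalizer_parabolic x mu : lie x (B 35) = mu *: B 35 -> parabolic x.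
Proof.
move=> xB k hk dk; have := normalizer_label hk; rewrite dk => /has_iota[c hc].
case: ifP => // /andP[c35 c0] /check1 sel.
have /(congr1 (crd c)) := xB; rewrite crdZ (crd_basis hB) // (negPf c35) mulr0.
rewrite (crd_lie_basis hB) // (bigD1 (Ordinal hk)) //= big1 ?addr0 => [|l].
  by move=> /eqP; rewrite mulf_eq0 intr_eq0 (negPf c0) orbF => /eqP.
rewrite -val_eqE /= => /negPf lk.
by have := sel l (ltn_ord l); rewrite lk orbF => /eqP ->; rewrite mulr0.
Qed.

Definition rho x : 'M[K]_6 := \matrix_(i, j) \sum_(k < 78) crd k x * (gl6 k i j)%:~R.

Lemma rho_lin a x y : rho (a *: x + y) = a *: rho x + rho y.
Proof.
apply/matrixP => i j; rewrite !mxE mulr_sumr -big_split; apply: eq_bigr => k _ /=.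
by rewrite crd_lin mulrDl mulrA.
Qed.
Lemma rho0 : rho 0 = 0.
Proof. by apply/matrixP => i j; rewrite !mxE big1 // => k _; rewrite crd0 mul0r. Qed.
Lemma rhoD x y : rho (x + y) = rho x + rho y.
Proof. by have := rho_lin 1 x y; rewrite !scale1r. Qed.
Lemma rhoZ a x : rho (a *: x) = a *: rho x.
Proof. by have := rho_lin a x 0; rewrite rho0 !addr0. Qed.

Lemma rho_basis k i j : (k < 78)%N -> rho (B k) i j = (gl6 k i j)%:~R.
Proof.
move=> hk; rewrite mxE (bigD1 (Ordinal hk)) //= (crd_basis hB) // eqxx mul1r.
rewrite big1 ?addr0 // => l; rewrite -val_eqE /= => /negPf lk.
by rewrite (crd_basis hB) // lk mul0r.
Qed.

Lemma rho_sp_ev s i j : all (fun k => k < 78)%N (map snd s) ->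
  rho (sp_ev B s) i j = (sp_gl6 s i j)%:~R.
Proof.
elim: s => [|[c l] s IHs] /=; first by rewrite sp_ev_nil rho0 mxE.
move=> /andP[hl hs]; rewrite -cat1s sp_ev_cat sp_ev1 rho_lin mxE IHs // mxE.
by rewrite rho_basis // intrD intrM.
Qed.

Lemma rho_basis_deg k : (k < 78)%N -> deg k != 0 -> rho (B k) = 0.
Proof.
move=> hk dk; apply/matrixP => i j; rewrite rho_basis // mxE.
by have := gl6_deg hk (ltn_ord i) (ltn_ord j); rewrite (negPf dk) => /eqP ->.
Qed.

Lemma rho_lie x y : parabolic x -> parabolic y ->
  rho (lie x y) = rho x *m rho y - rho y *m rho x.
Proof.
move=> px py; move: x px; apply: parabolic_ind => [|a u v Hu Hv|k hk dk].
- by rewrite lie0l rho0 mul0mx mulmx0 subrr.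
- rewrite lieDl lieZl !rho_lin Hu Hv mulmxDl mulmxDr -scalemxAl -scalemxAr.
  by rewrite scalerBr opprD addrACA.
move: y py; apply: parabolic_ind => [|a u v Hu Hv|l hl dl].
- by rewrite lie0r rho0 mul0mx mulmx0 subrr.
- rewrite lieDr lieZr !rho_lin Hu Hv mulmxDl mulmxDr -scalemxAl -scalemxAr.
  by rewrite scalerBr opprD addrACA.
have lab := bracket_label hk hl.
have [/eqP dk0|dk0] := boolP (deg k == 0); last first.
  rewrite (rho_basis_deg hk dk0) mul0mx mulmx0 subrr lieB //.
  rewrite /sp_ev big_seq; apply: (big_ind (fun v => rho v = 0)).
  + exact: rho0.
  + by move=> u v; rewrite rhoD => -> ->; rewrite addr0.
  move=> [c m] cm; have ms := map_f snd cm.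
  rewrite rhoZ rho_basis_deg ?scaler0 //; first exact: (allP lab).
  rewrite (eqP (allP (bracket_deg hk hl) _ ms)) gt_eqF //.
  by rewrite ltr_wpDr // lt_def dk0.
have [/eqP dl0|dl0] := boolP (deg l == 0); last first.
  rewrite (rho_basis_deg hl dl0) mul0mx mulmx0 subrr lieB //.
  rewrite /sp_ev big_seq; apply: (big_ind (fun v => rho v = 0)).
  + exact: rho0.
  + by move=> u v; rewrite rhoD => -> ->; rewrite addr0.
  move=> [c m] cm; have ms := map_f snd cm.
  rewrite rhoZ rho_basis_deg ?scaler0 //; first exact: (allP lab).
  rewrite (eqP (allP (bracket_deg hk hl) _ ms)) gt_eqF //.
  by rewrite ltr_wpDl // lt_def dl0.
have := gl6_bracket hk hl; rewrite dk0 dl0 eqxx => /check2 chk.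
apply/matrixP => i j; rewrite lieB // rho_sp_ev //.
rewrite (eqP (chk i j (ltn_ord i) (ltn_ord j))).
rewrite !mxE intrD intrN /int_sum.
have sumE (F : nat -> int) : (foldr (fun l z => F l + z) 0 (iota 0 6))%:~R
    = \sum_(l < 6) (F l)%:~R :> K.
  by rewrite !big_ord_recr big_ord0 /= add0r !intrD addr0 !addrA.
rewrite !sumE; congr (_ - _); apply: eq_bigr => m _; rewrite !rho_basis // intrM //.
Qed.

(** On gl_6 the automorphism phi is conjugation by G, with inverse G', and G fixes
    the first m basis vectors. *)
Definition induces (m : nat) (phi : g -> g) (G G' : 'M[K]_6) : Prop :=
  [/\ is_aut phi, G *m G' = 1%:M,
      forall y, parabolic y -> parabolic (phi y) /\ rho (phi y) = G *m rho y *m G' &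
      forall i j : 'I_6, (j < m)%N -> G i j = (i == j)%:R].

Lemma induces_id m : induces m id 1%:M 1%:M.
Proof.
split; [exact: is_aut_id | by rewrite mul1mx | | by move=> i j _; rewrite mxE].
by move=> y py; split=> //; rewrite mul1mx mulmx1.
Qed.

Lemma induces_comp m phi psi G G' H H' :
  induces m phi G G' -> induces m psi H H' -> induces m (phi \o psi) (G *m H) (H' *m G').
Proof.
move=> [a1 GG p1 f1] [a2 HH p2 f2]; split.
- exact: is_aut_comp.
- by rewrite mulmxA -[G *m H *m H']mulmxA HH mulmx1.
- move=> y py; have [q r] := p2 y py; have [q' r'] := p1 _ q; split=> //=.
  by rewrite r' r !mulmxA.
move=> i j jm; rewrite mxE (bigD1 j) //= f2 // eqxx mulr1 f1 // big1 ?addr0 // => l lj.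
by rewrite f2 // (negPf lj) mulr0.
Qed.

(** The exponential of a root vector whose image N in gl_6 has square zero acts as
    conjugation by 1 + N. *)
Lemma induces_elementary m (i j : 'I_6) (t : K) : i != j -> (m <= j)%N ->
  exists phi, induces m phi (1%:M + t *: delta_mx i j) (1%:M - t *: delta_mx i j).
Proof.
move=> ij mj; have := gl6_root (ltn_ord i) (ltn_ord j); rewrite val_eqE ij => /has_iota[k hk].
case: ifP => // /andP[/eqP dk c0] /check2 sel.
have hk' : (k < 78)%N by lia.
pose c := gl6 k i j; pose s := t / c%:~R.
have cK : c%:~R != 0 :> K by rewrite intr_eq0.
set N := t *: delta_mx i j.
have rhoB : rho (s *: B k) = N.
  apply/matrixP => i' j'; rewrite rhoZ mxE rho_basis // mxE mxE.
  have [/andP[/eqP -> /eqP ->]|ne] := boolP ((i' == i) && (j' == j)).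
    by rewrite /s divfK // mulr1.
  have := sel i' j' (ltn_ord i') (ltn_ord j').
  by rewrite !val_eqE (negPf ne) orbF => /eqP ->; rewrite !mulr0.
have NN : N *m N = 0.
  rewrite /N -scalemxAl -scalemxAr mul_delta_mx_0 ?scaler0 //.
  by rewrite eq_sym.
exists (exp_ad (s *: B k)); split.
- exact: exp_root_aut.
- by rewrite mulmxBr mulmx1 mulmxDl mul1mx NN addr0 addrK.
- move=> y py; have pB : parabolic (s *: B k).
    rewrite -[_ *: _]addr0; apply: parabolic_lin parabolic0.
    by apply: parabolic_basis => //; rewrite dk.
  have pL z : parabolic z -> parabolic (lie (s *: B k) z) by apply: parabolic_lie.
  split.
    rewrite /exp_ad addrC; apply: parabolic_lin; first exact/pL/pL.
    rewrite -[y]scale1r; apply: parabolic_lin => //; rewrite scale1r; exact: pL.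
  rewrite /exp_ad !rhoD rhoZ !rho_lie ?rhoB //; last exact: pL.
  set A := rho y.
  rewrite !(mulmxDl, mulmxDr, mulmxBl, mulmxBr, mulNmx, mulmxN, mul1mx, mulmx1) !mulmxA.
  rewrite NN -[A *m N *m N]mulmxA NN mul0mx mulmx0.
  apply/matrixP => i' j'; rewrite !mxE; by field.
move=> i' j' lt_j'; rewrite !mxE [j' == j](_ : _ = false) ?andbF ?mulr0 ?addr0 //.
by apply/eqP => j'j; move: lt_j'; rewrite j'j ltnNge mj.
Qed.

Lemma elementary_act (i j : 'I_6) (t : K) (v : 'cV[K]_6) l :
  ((1%:M + t *: delta_mx i j) *m v) l 0 = v l 0 + (l == i)%:R * (t * v j 0).
Proof.
rewrite mulmxDl mul1mx mxE -scalemxAl; congr (_ + _); rewrite !mxE (bigD1 j) //= big1.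
  by rewrite !mxE eqxx andbT addr0 mulrCA.
by move=> r /negPf rj; rewrite mxE rj andbF mul0r.
Qed.

(** Gaussian elimination on v, with row operations on the indices from m on. *)
Lemma move_vector (m : 'I_6) (v : 'cV[K]_6) : v != 0 ->
    (forall i : 'I_6, (i < m)%N -> v i 0 = 0) ->
  exists phi G G', [/\ induces m phi G G', (G *m v) m 0 != 0 &
    forall i : 'I_6, i != m -> (G *m v) i 0 = 0].
Proof.
move=> v0 vm.
have [phi [G [G' [ind Gm Gl]]]] : exists phi G G', [/\ induces m phi G G',
    (G *m v) m 0 != 0 & forall i : 'I_6, (i < m)%N -> (G *m v) i 0 = 0].
  have [vm0|vm0] := eqVneq (v m 0) 0; last first.
    exists id, 1%:M, 1%:M; rewrite mul1mx; split=> //; exact: induces_id.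
  have [k vk] : exists k, v k 0 != 0.
    apply: contra_neqP v0 => no; apply/colP => k; rewrite mxE.
    by apply: contra_notP no => /eqP; exists k.
  have mk : m != k by apply: contraNneq vk => <-; rewrite vm0.
  have le_mk : (m <= k)%N by rewrite leqNgt; apply: contraNN vk => /vm ->.
  have [phi ind] := induces_elementary 1 mk le_mk.
  exists phi, (1%:M + 1 *: delta_mx m k), (1%:M - 1 *: delta_mx m k); split=> //.
    by rewrite elementary_act vm0 eqxx add0r !mul1r.
  move=> i im; rewrite elementary_act vm // (_ : (i == m) = false) ?mul0r ?addr0 //.
  by apply/eqP => i_m; rewrite i_m ltnn in im.
suff HS (s : seq 'I_6) : exists phi G G', [/\ induces m phi G G', (G *m v) m 0 != 0 &
    forall i : 'I_6, ((i < m)%N \/ (i \in s)) -> i != m -> (G *m v) i 0 = 0].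
  have [phi' [H [H' [ind' Hm Hl]]]] := HS (enum 'I_6).
  exists phi', H, H'; split=> // i; apply: Hl; right; exact: mem_enum.
elim: s => [|j s [psi [H [H' [ind' Hm Hl]]]]].
  by exists phi, G, G'; split=> // i [im|//] _; apply: Gl.
have [jm|jm] := eqVneq j m.
  exists psi, H, H'; split=> // i [im|]; first by apply: Hl; left.
  rewrite inE jm => /predU1P[->|is_]; first by rewrite eqxx.
  by apply: Hl; right.
pose t := - (H *m v) j 0 / (H *m v) m 0.
have [chi indc] := induces_elementary t jm (leqnn m).
exists (chi \o psi), ((1%:M + t *: delta_mx j m) *m H), (H' *m (1%:M - t *: delta_mx j m)).
split; first exact: induces_comp.
  by rewrite -mulmxA elementary_act [m == j]eq_sym (negPf jm) mul0r addr0.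
move=> i hi im; rewrite -mulmxA elementary_act.
have [->|ij] := eqVneq i j; first by rewrite mul1r /t divfK // addrN.
rewrite mul0r addr0; apply: Hl => //; case: hi => [|]; first by left.
by rewrite inE (negPf ij); right.
Qed.

Variable U : {vspace g}.
Hypotheses (Usub : lie_subalgebra U) (Usol : lie_solvable U).

(** After applying phi, U stabilizes the first m spaces of the standard flag. *)
Definition flagged m (phi : g -> g) : Prop := is_aut phi /\
  forall y, y \in U -> parabolic (phi y) /\
    forall i j : 'I_6, (j < m)%N -> (j < i)%N -> rho (phi y) i j = 0.

(** U acts on the quotient of the space by the first m basis vectors, realized by
    the projection P onto the remaining ones.  A common eigenvector there is moved to
    the basis vector of index m. *)
Lemma flag_step (m : 'I_6) phi : flagged m phi -> exists phi', flagged m.+1 phi'.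
Proof.
move=> [aut fl]; have [lin_phi _ phi_lie _] := aut.
pose P : 'M[K]_6 := \matrix_(i, j) ((i == j) && (m <= i)%N)%:R.
have Pact (v : 'cV[K]_6) i : (P *m v) i 0 = if (m <= i)%N then v i 0 else 0.
  rewrite mxE (bigD1 i) //= big1 ?addr0 => [|l li]; last first.
    by rewrite mxE eq_sym (negPf li) mul0r.
  by rewrite mxE eqxx; case: leqP; rewrite ?mul1r ?mul0r.
have Pact0 (v : 'cV[K]_6) : P *m v = v <-> forall i : 'I_6, (i < m)%N -> v i 0 = 0.
  split=> [Pv i im|vm]; first by rewrite -Pv Pact leqNgt im.
  by apply/colP => i; rewrite Pact; case: leqP => // /vm.
have PP (v : 'cV[K]_6) : P *m (P *m v) = P *m v.
  by apply/colP => i; rewrite !Pact; case: leqP.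
pose r y : {linear 'cV[K]_6 -> 'cV[K]_6} := mulmx (P *m rho (phi y)).
have r_lin v : linear (fun y => r y v).
  by move=> a x y; rewrite /= lin_phi rho_lin mulmxDr mulmxDl -scalemxAr -scalemxAl.
have PAP y (v : 'cV[K]_6) : y \in U -> P *m (rho (phi y) *m (P *m v)) = P *m (rho (phi y) *m v).
  move=> yU; have [_ tri] := fl y yU; apply/colP => i; rewrite !Pact; case: leqP => // mi.
  rewrite !mxE; apply: eq_bigr => l _; rewrite -/((P *m v) l 0) Pact.
  case: leqP => // lm; rewrite mulr0 tri ?mul0r //; exact: leq_trans lm mi.
have r_hom x y : x \in U -> y \in U ->
    forall v, r (lie x y) v = r x (r y v) - r y (r x v).
  move=> xU yU v; have [[px _] [py _]] := (fl x xU, fl y yU).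
  rewrite /r /= phi_lie rho_lie // -!mulmxA !PAP // !mulmxBl !mulmxBr !mulmxA //.
have [||v [v0 Pv] vU] := @lie_common_eigenvector K g 'cV[K]_6 r r_lin
    (fun v => v != 0 /\ P *m v = v) U Usub Usol r_hom.
- move=> u E uU uE [v vE [v0 Pv]].
  have [E' E'P] : exists E' : {vspace 'cV[K]_6},
      forall v, v \in E' <-> (v \in E /\ P *m v = v).
    apply: vspace_of_pred => [|a w1 w2 [w1E Pw1] [w2E Pw2]].
      by rewrite mem0v mulmx0.
    by rewrite rpredD ?rpredZ // mulmxDr -scalemxAr Pw1 Pw2.
  have E'u w : w \in E' -> r u w \in E'.
    by move=> /E'P[wE _]; apply/E'P; split; [apply: uE | rewrite /r /= -!mulmxA PP].
  have vE' : v \in E' by apply/E'P.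
  (* The cone is the whole space, so this is just the existence of eigenvectors. *)
  pose Q (_ _ : 'cV[K]_6) : 'cV[K]_6 := 0.
  have Q_lin v' : linear (Q v') by move=> a x y; rewrite /Q scaler0 addr0.
  have Q_equiv x y : r u (Q x y) = Q (r u x) y + Q x (r u y).
    by rewrite /Q linear0 addr0.
  have [w [mu [/E'P[wE Pw] w0 _ uw]]] :=
    quadratic_cone_eigenvector (Q_lin) (Q_lin) Q_equiv E'u vE' v0 erefl.
  by exists w, mu.
- exists (delta_mx m 0); split.
    by apply/eqP => /matrixP /(_ m 0); rewrite !mxE !eqxx => /eqP; rewrite oner_eq0.
  by apply/Pact0 => i im; rewrite mxE (_ : (i == m) = false) //; apply/eqP => i_m; rewrite i_m ltnn in im.
have vm := (Pact0 v).1 Pv.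
have [psi [G [G' [[aut' GG ind fix_m] Gm Gv]]]] := move_vector v0 vm.
exists (psi \o phi); split; first exact: is_aut_comp.
move=> y yU; have [py tri] := fl y yU; have [py' rE] := ind _ py.
split=> // i j; rewrite /= rE ltnS leq_eqVlt; set A := rho (phi y).
have vE : G *m v = (G *m v) m 0 *: delta_mx m 0.
  apply/colP => l; rewrite [RHS]mxE [delta_mx _ _ _ _]mxE andbT.
  by have [->|lm] := eqVneq l m; rewrite ?mulr1 ?mulr0 // Gv.
have G'G : G' *m G = 1%:M by apply: mulmx1C.
have G_fix (u : 'cV[K]_6) : (forall l : 'I_6, (m <= l)%N -> u l 0 = 0) -> G *m u = u.
  move=> um; apply/colP => l; rewrite mxE (bigID (fun k : 'I_6 => (k < m)%N)) /=.
  rewrite [X in _ + X]big1 ?addr0 => [|k]; last by rewrite -leqNgt => /um ->; rewrite mulr0.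
  transitivity (\sum_(k < 6 | (k < m)%N) (l == k)%:R * u k 0).
    by apply: eq_bigr => k km; rewrite fix_m.
  have [lm|lm] := ltnP l m.
    rewrite (bigD1 l) //= eqxx mul1r big1 ?addr0 // => k /andP[_ /negPf kl].
    by rewrite eq_sym kl mul0r.
  rewrite um // big1 // => k km; rewrite (_ : (l == k) = false) ?mul0r //.
  by apply/eqP => lk; rewrite lk leqNgt km in lm.
have G_low (u : 'cV[K]_6) (l : 'I_6) : (m <= l)%N ->
    (forall k : 'I_6, (m <= k)%N -> u k 0 = v k 0) -> (G *m u) l 0 = (G *m v) l 0.
  move=> ml uv; apply/eqP; rewrite -subr_eq0.
  have -> : (G *m u) l 0 - (G *m v) l 0 = (G *m (u - v)) l 0 by rewrite mulmxBr !mxE.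
  by rewrite G_fix => [|k mk]; rewrite !mxE uv // subrr.
have GAG' (k : 'I_6) : (G *m A *m G') i k = (G *m (A *m (G' *m delta_mx k (0 : 'I_1)))) i 0.
  by rewrite !mulmxA -colE [RHS]mxE.
move=> /predU1P[jm|jm] ji; last first.
  (* G and G' fix e_j, and A e_j is a combination of the first j + 1 vectors. *)
  have Gj : G *m delta_mx j 0 = delta_mx j (0 : 'I_1).
    apply: G_fix => l ml; rewrite mxE (_ : (l == j) = false) //.
    by apply/eqP => lj; rewrite lj leqNgt jm in ml.
  have G'j : G' *m delta_mx j 0 = delta_mx j (0 : 'I_1).
    by rewrite -{1}Gj mulmxA G'G mul1mx.
  rewrite GAG' G'j G_fix => [|l ml]; rewrite -colE mxE tri //.
  exact: leq_trans jm ml.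
have {jm} jm : j = m by apply: val_inj.
have [mu /= yv] := vU y yU.
have Av (k : 'I_6) : (m <= k)%N -> (A *m v) k 0 = mu * v k 0.
  by move=> mk; have /colP /(_ k) := yv; rewrite -mulmxA Pact mk [(mu *: v) k 0]mxE.
have G'm : G' *m delta_mx m 0 = ((G *m v) m 0)^-1 *: v.
  have -> : delta_mx m (0 : 'I_1) = ((G *m v) m 0)^-1 *: (G *m v).
    by rewrite {2}vE scalerA mulVf // scale1r.
  by rewrite -scalemxAr mulmxA G'G mul1mx.
rewrite GAG' jm G'm -!scalemxAr [LHS]mxE; move: (_^-1) => d.
have -> : A *m v = mu *: v + (A *m v - mu *: v) by rewrite addrC subrK.
rewrite mulmxDr -scalemxAr [G *m (A *m v - _)]G_fix => [|l ml]; last first.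
  by rewrite mxE Av // !mxE subrr.
have mi : (m <= i)%N by rewrite -jm ltnW.
rewrite mxE [X in _ * (X + _)]mxE Gv; last by apply: contraTneq ji => ->; rewrite jm ltnn.
by rewrite mxE Av // !mxE subrr mulr0 add0r mulr0.
Qed.

Lemma flag_full phi : is_aut phi -> (forall y, y \in U -> parabolic (phi y)) ->
  exists phi', flagged 6 phi'.
Proof.
move=> aut par; suff H m : (m <= 6)%N -> exists phi', flagged m phi' by apply: H.
elim: m => [_|m IHm lt_m]; first by exists phi; split=> // y /par.
have [phi' fl] := IHm (ltnW lt_m); exact: (@flag_step (Ordinal lt_m) phi').
Qed.

Lemma flagged_lower phi y k : flagged 6 phi -> y \in U -> (36 <= k < 72)%N ->
  crd k (phi y) = 0.
Proof.
move=> [_ fl] /fl[py tri] hk; have hk' : (k < 78)%N by lia.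
have [dk|dk] := ltP (deg k) 0; first exact: py.
have := gl6_lower hk; rewrite dk => /has_iota[i hi] /has_iota[j hj].
case: ifP => // /andP[ji c0] /check1 sel.
have := tri (Ordinal (hi : (i < 6)%N)) (Ordinal (hj : (j < 6)%N)) (hj : (j < 6)%N) ji.
rewrite mxE (bigD1 (Ordinal hk')) //= big1 ?addr0 => [|l].
  by move=> /eqP; rewrite mulf_eq0 intr_eq0 (negPf c0) orbF => /eqP.
rewrite -val_eqE /= => /negPf lk.
by have := sel l (ltn_ord l); rewrite lk orbF => /eqP ->; rewrite mulr0.
Qed.

Hypothesis g_simple : lie_simple g.

Lemma conjugate_into_standard_borel : exists2 phi, is_aut phi &
  forall y k, y \in U -> (36 <= k < 72)%N -> crd k (phi y) = 0.
Proof.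
have [x [x0 ex xU]] := extremal_common_eigenvector hB Usub Usol.
have [phi [c [aut c0 phix]]] := extremal_conjugate hB g_simple x0 ex.
have par y : y \in U -> parabolic (phi y).
  move=> /xU[mu yx]; apply: (@normalizer_parabolic _ mu).
  have [_ _ phi_lie _] := aut.
  apply: (scalerI c0); rewrite -lieZr -phix -phi_lie yx (autZ _ _ aut) phix.
  by rewrite !scalerA mulrC.
have [psi fl] := flag_full aut par; exists psi; first by case: fl.
by move=> y k yU hk; apply: flagged_lower.
Qed.

End Flags.

(** * The standard Borel subalgebra *)

Section StandardBorel.
Variables (K : numClosedFieldType) (g : lieAlgType K) (B : nat -> g).
Hypothesis hB : E6_basis B.
Let lieB : bracket_relations B := hB.1.
Local Notation crd := (coordinate B).

Definition upper_part n y : Prop := forall k, (k < 78)%N -> ~~ upper n k -> crd k y = 0.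

Lemma upper_part0 n : upper_part n 0. Proof. by move=> k _ _; rewrite crd0. Qed.
Lemma upper_part_lin n a x y : upper_part n x -> upper_part n y -> upper_part n (a *: x + y).
Proof. by move=> px py k hk nk; rewrite crd_lin px // py // mulr0 addr0. Qed.

Lemma upper_part_basis n k : (k < 78)%N -> upper n k -> upper_part n (B k).
Proof.
move=> hk uk l hl ul; rewrite (crd_basis hB) //; case: eqP => // lk.
by rewrite lk uk in ul.
Qed.

Lemma upper_part_ind n (P : g -> Prop) : P 0 ->
  (forall a u v, P u -> P v -> P (a *: u + v)) ->
  (forall k, (k < 78)%N -> upper n k -> P (B k)) -> forall x, upper_part n x -> P x.
Proof.
move=> P0 Plin PB x px; rewrite (crd_expand hB x).
apply: (big_ind P) => // [u v Pu Pv|k _]; first by rewrite -[u]scale1r; apply: Plin.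
have [uk|uk] := boolP (upper n k); last by rewrite px // scale0r.
by rewrite -[_ *: _]addr0; apply: Plin => //; apply: PB.
Qed.

Lemma upper_part_lie n x y : (n < 12)%N ->
  upper_part n x -> upper_part n y -> upper_part n.+1 (lie x y).
Proof.
move=> hn px py; move: x px; apply: upper_part_ind => [|a u v Hu Hv|k hk uk].
- by rewrite lie0l; apply: upper_part0.
- by rewrite lieDl lieZl; apply: upper_part_lin.
move: y py; apply: upper_part_ind => [|a u v Hu Hv|l hl ul].
- by rewrite lie0r; apply: upper_part0.
- by rewrite lieDr lieZr; apply: upper_part_lin.
rewrite lieB // /sp_ev big_seq; apply: (big_ind (upper_part n.+1)).
- exact: upper_part0.
- by move=> u v pu pv; rewrite -[u]scale1r; apply: upper_part_lin.
move=> [c m] cm; rewrite -[_ *: _]addr0; apply: upper_part_lin; last exact: upper_part0.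
have ms := map_f snd cm.
apply: upper_part_basis; first exact: (allP (bracket_label hk hl)).
by have := bracket_upper hn hk hl; rewrite uk ul => /allP; apply.
Qed.

Lemma upper_partS n x : upper_part n.+1 x -> upper_part n x.
Proof.
move=> px k hk uk; apply: px => //; apply: contraNN uk.
by rewrite /upper andbF orbF => /andP[-> /ltnW ->].
Qed.

Lemma standard_borel_solvable (N : {vspace g}) : (forall y, y \in N <-> upper_part 0 y) ->
  lie_subalgebra N /\ lie_solvable N.
Proof.
move=> NP; split.
  apply/lie_subalgebraP => u v /NP pu /NP pv; apply/NP/upper_partS.
  exact: upper_part_lie.
exists 12; apply/eqP; rewrite -subv0; apply/subvP => x xN.
have H n : (n <= 12)%N -> forall x, x \in derived_series N n -> upper_part n x.
  elim: n => [_ y /NP //|n IHn hn y].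
  have [E EP] := vspace_of_pred (@upper_part0 n.+1) (@upper_part_lin n.+1).
  move=> yN; apply/EP; move: y yN; apply/subvP/lie_prod_subP => u v uD vD; apply/EP.
  by apply: upper_part_lie => //; apply: IHn => //; apply: ltnW.
rewrite memv0; apply/eqP/(crd_inj hB) => k hk; rewrite crd0.
by apply: (H 12) => //; apply: upper12.
Qed.

Hypothesis g_simple : lie_simple g.

(** The basis is transported by the inverse of phi. *)
Lemma E6_basis_aut phi : is_aut B phi -> exists2 B' : nat -> g,
  E6_basis B' & forall k y, (k < 78)%N -> coordinate B' k y = crd k (phi y).
Proof.
move=> aut; have [lin_phi [psi phiK psiK] phi_lie _] := aut.
have lin_psi : linear psi.
  by move=> a u v; rewrite -{1}[u]psiK -{1}[v]psiK -lin_phi phiK.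
have psiD u v : psi (u + v) = psi u + psi v.
  by have := lin_psi 1 u v; rewrite !scale1r.
have psi0 : psi 0 = 0 by apply: (addrI (psi 0)); rewrite -psiD !addr0.
have psiZ a u : psi (a *: u) = a *: psi u.
  by have := lin_psi a u 0; rewrite psi0 !addr0.
have psi_sum (I : Type) (r : seq I) (P : pred I) (F : I -> g) :
    psi (\sum_(i <- r | P i) F i) = \sum_(i <- r | P i) psi (F i).
  by apply: big_morph.
pose B' k := psi (B k).
have expand y : y = \sum_(k < 78) crd k (phi y) *: B' k.
  rewrite -{1}[y]phiK {1}(crd_expand hB (phi y)) psi_sum.
  by apply: eq_bigr => k _; rewrite psiZ.
have hB' : E6_basis B'.
  split.
    move=> a b ha hb; rewrite /B' -[lie _ _]phiK phi_lie !psiK lieB // /sp_ev psi_sum.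
    by apply: eq_bigr => p _; rewrite psiZ.
  set X := [tuple B' (val k) | k < 78].
  have nthX (k : 'I_78) : X`_k = B' k by rewrite (nth_map ord0) ?size_enum_ord // nth_ord_enum.
  apply/andP; split.
    rewrite eqEsubv subvf; apply/subvP => y _; rewrite (expand y).
    apply: memv_suml => k _; apply/memvZ/memv_span.
    by rewrite -nthX mem_nth ?size_tuple.
  apply/freeP => c cX k; pose x := \sum_(l < 78) c l *: B l.
  have x0 : x = 0.
    rewrite -[x]psiK; have -> : psi x = 0; last exact: aut0 aut.
    rewrite /x psi_sum -[RHS]cX; apply: eq_bigr => l _.
    by rewrite psiZ nthX.
  have := crd0 B k; rewrite -x0 /x crd_sum (bigD1 k) //= big1 ?addr0.
    by rewrite crdZ (crd_basis hB) // eqxx mulr1.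
  move=> l; rewrite -val_eqE /= eq_sym => /negPf lk.
  by rewrite crdZ (crd_basis hB) // lk mulr0.
exists B' => // k y hk; rewrite {1}(expand y) crd_sum (bigD1 (Ordinal hk)) //= big1.
  by rewrite crdZ (crd_basis hB') // eqxx mulr1 addr0.
move=> l; rewrite -val_eqE /= eq_sym => /negPf lk.
by rewrite crdZ (crd_basis hB') // lk mulr0.
Qed.

End StandardBorel.

(** The preimage of the standard Borel subalgebra is solvable and contains b, so it
    is b by maximality. *)
Lemma borel_standard (K : numClosedFieldType) (g : lieAlgType K) (b : {vspace g}) :
  simple_of_type_E6 g -> borel_subalgebra b ->
  exists2 B : nat -> g, E6_basis B & forall y, y \in b <-> upper_part B 0 y.
Proof.
move=> gE6 [bsub bsol bmax]; have [B hB] := E6_basis_exists gE6.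
have [phi aut phib] := conjugate_into_standard_borel hB bsub bsol gE6.1.
have [B' hB' crdB'] := E6_basis_aut hB aut; exists B' => //.
have [N NP] := vspace_of_pred (@upper_part0 _ _ B' 0) (@upper_part_lin _ _ B' 0).
have [Nsub Nsol] := standard_borel_solvable hB' NP.
have bN : (b <= N)%VS.
  apply/subvP => y yb; apply/NP => k hk; rewrite upper0 // negbK => hk'.
  by rewrite crdB' // phib.
by rewrite -(bmax N Nsub Nsol bN).
Qed.

(** * Counting the abelian ideals *)

(** The last two inequalities hold because roots are listed by increasing height. *)
Lemma bracket_pos a b : (a < 36)%N -> (b < 36)%N ->
  if bracket a b is p :: s then
    [&& p.1 != 0, s == [::], (a < p.2)%N, (b < p.2)%N & (p.2 < 36)%N] else true.
Proof. by move: a b; apply: (@check2 0 36 0 36); vm_compute. Qed.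

Definition can_add (a : nat) (S : seq nat) : bool :=
  all (fun i => all (fun p => p.2 \in S) (bracket i a)) (iota 0 6) &&
  all (fun s => nilp (bracket a s)) S.

Definition add_root (a : nat) (Ss : seq (seq nat)) : seq (seq nat) :=
  flatten [seq if can_add a T then [:: a :: T; T] else [:: T] | T <- Ss].

(** The supports of the abelian ideals, built by deciding for each root, from the
    highest one down to alpha_0, whether it belongs to the support.  Membership of
    the larger roots being known, closure and commutation are tested at once. *)
Definition ideal_supports : seq (seq nat) := foldr add_root [:: [::]] (iota 0 36).

Definition is_support (S : seq nat) : bool :=
  [&& sorted ltn S, all (fun a => a < 36)%N S,
   all (fun a => all (fun b => if upper 0 b then all (fun p => p.2 \in S) (bracket b a) else true)
     (iota 0 78)) S &
   all (fun a => all (fun b => nilp (bracket a b)) S) S].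

Lemma ideal_supports_sound : all is_support ideal_supports.
Proof. by vm_compute. Qed.

Lemma ideal_supports_uniq : uniq ideal_supports.
Proof. by vm_compute. Qed.

Lemma ideal_supports_sizes : [seq count (fun S => size S == m) ideal_supports | m <- iota 0 17]
  = [:: 1; 1; 1; 1; 2; 3; 3; 4; 6; 7; 8; 10; 7; 4; 2; 2; 2]%N.
Proof. by vm_compute. Qed.

Lemma ideal_supports_size : size ideal_supports = 64.
Proof. by vm_compute. Qed.

Lemma ideal_supports_le16 : all (fun S => size S <= 16)%N ideal_supports.
Proof. by vm_compute. Qed.

(** The partial supports of p survive all the tests. *)
Lemma ideal_supports_complete (p : pred nat) :
  (forall a i q, (a < 36)%N -> p a -> (i < 6)%N -> q \in bracket i a -> p q.2) ->
  (forall a b, (a < 36)%N -> p a -> (b < 36)%N -> p b -> bracket a b = [::]) ->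
  [seq k <- iota 0 36 | p k] \in ideal_supports.
Proof.
move=> p_up p_ab; rewrite /ideal_supports.
suff H m n : (m + n = 36)%N ->
  [seq k <- iota m n | p k] \in foldr add_root [:: [::]] (iota m n) by apply: H.
elim: n m => [|n IHn] m mn //=.
have {}IHn := IHn m.+1 (etrans (addSnnS m n) mn).
have hm : (m < 36)%N by lia.
set S := [seq k <- iota m.+1 n | p k] in IHn *.
apply/flattenP; exists (if can_add m S then [:: m :: S; S] else [:: S]).
  by apply/mapP; exists S.
case pm: (p m); last by case: ifP; rewrite !inE eqxx ?orbT.
rewrite ifT ?inE ?eqxx //; apply/andP; split.
  apply/allP => i; rewrite mem_iota => hi; apply/allP => q qi.
  rewrite mem_filter mem_iota (p_up m i q) //=.
  have hi36 : (i < 36)%N by lia.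
  have := bracket_pos hi36 hm; move: qi; case: (bracket i m) => [|q' s] //.
  rewrite inE => /predU1P qq' /and5P[_ /eqP s0 _ mq q36].
  by case: qq' mq q36 => [<-|]; rewrite ?s0 //; lia.
apply/allP => s; rewrite mem_filter mem_iota => /andP[ps hs].
by rewrite p_ab //; lia.
Qed.

Section AbelianIdeals.
Variables (K : numClosedFieldType) (g : lieAlgType K) (B : nat -> g) (b : {vspace g}).
Hypotheses (hB : E6_basis B) (bP : forall y, y \in b <-> upper_part B 0 y).
Let lieB : bracket_relations B := hB.1.
Local Notation crd := (coordinate B).

Definition root_span (S : seq nat) : {vspace g} := <<[seq B k | k <- S]>>%VS.

Lemma root_spanP S x : all (fun k => k < 78)%N S ->
  x \in root_span S <-> forall k, (k < 78)%N -> k \notin S -> crd k x = 0.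
Proof.
move=> /allP hS; split.
  pose P y := forall k, (k < 78)%N -> k \notin S -> crd k y = 0.
  have P0 : P 0 by move=> k _ _; rewrite crd0.
  have Plin a u v : P u -> P v -> P (a *: u + v).
    by move=> Pu Pv k hk kS; rewrite crd_lin Pu // Pv // mulr0 addr0.
  have [E EP] := vspace_of_pred P0 Plin; move=> xS; apply/(EP x).1.
  move: x xS; apply/subvP/span_subvP => _ /mapP[l lS ->].
  apply/EP => k hk kS; rewrite (crd_basis hB hk (hS _ lS)); have [kl|//] := eqVneq k l.
  by rewrite kl lS in kS.
move=> xS; rewrite (crd_expand hB x); apply: memv_suml => k _.
have [kS|kS] := boolP (val k \in S); last by rewrite xS // scale0r mem0v.
by apply/memvZ/memv_span/map_f.
Qed.

Lemma dim_root_span S : all (fun k => k < 78)%N S -> uniq S -> \dim (root_span S) = size S.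
Proof.
move=> /allP hS uS; pose X := map_tuple B (in_tuple S).
have -> : root_span S = <<X>>%VS by [].
suff /eqnP -> : free X by rewrite size_tuple.
apply/freeP => c cX i.
have nthX (j : 'I_(size S)) : X`_j = B (nth 0%N S j) by rewrite (nth_map 0%N).
have hj (j : 'I_(size S)) : (nth 0%N S j < 78)%N by apply/hS/mem_nth.
have := crd0 B (nth 0%N S i); rewrite -cX crd_sum (bigD1 i) //= big1 ?addr0.
  by rewrite crdZ nthX (crd_basis hB) // eqxx mulr1.
move=> j ji; rewrite crdZ nthX (crd_basis hB) // nth_uniq //.
by rewrite val_eqE eq_sym (negPf ji) mulr0.
Qed.

Lemma root_span_ideal S : is_support S -> abelian_ideals b (root_span S).
Proof.
case/and4P=> _ /allP S36 /allP up /allP ab.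
have S78 : all (fun k => k < 78)%N S by apply/allP => k /S36 h36; lia.
have up0 k : (k < 36)%N -> upper 0 k by rewrite /upper => ->.
have evS s : all (fun p => p.2 \in S) s -> sp_ev B s \in root_span S.
  move=> /allP sS; rewrite /sp_ev big_seq; apply: memv_suml => p ps.
  by apply/memvZ/memv_span/map_f/sS.
split; first split.
- apply/span_subvP => _ /mapP[k kS ->]; apply/bP.
  by apply: upper_part_basis => //; [apply: (allP S78) | apply/up0/S36].
- apply/lie_prod_subP => u v /bP pu; move: u pu v.
  apply: (upper_part_ind hB) => [v _|a u1 u2 H1 H2 v vS|k hk uk v].
  + by rewrite lie0l mem0v.
  + by rewrite lieDl lieZl rpredD ?rpredZ ?H1 ?H2.
  have [E EP] : exists E : {vspace g}, forall v, v \in E <-> lie (B k) v \in root_span S.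
    apply: vspace_of_pred; first by rewrite lie0r mem0v.
    by move=> a x y xS yS; rewrite lieDr lieZr rpredD ?rpredZ.
  move=> vS; apply/EP; move: v vS; apply/subvP/span_subvP => _ /mapP[l lS ->].
  apply/EP; rewrite lieB //; last exact: (allP S78).
  by apply: evS; have /check1 /(_ k hk) := up l lS; rewrite uk.
apply/eqP; rewrite -subv0; apply/lie_prod_subP => u v uS vS; rewrite memv0; apply/eqP.
have [E EP] : exists E : {vspace g}, forall u, u \in E <->
    forall v, v \in root_span S -> lie u v = 0.
  apply: vspace_of_pred => [w _|a x y Hx Hy w wS]; first by rewrite lie0l.
  by rewrite lieDl lieZl Hx // Hy // scaler0 addr0.
apply: (EP u).1 v vS; move: u uS; apply/subvP/span_subvP => _ /mapP[k kS ->].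
apply/EP => v vS.
have [E' E'P] : exists E' : {vspace g}, forall w, w \in E' <-> lie (B k) w = 0.
  apply: vspace_of_pred => [|a x y Hx Hy]; first exact: lie0r.
  by rewrite lieDr lieZr Hx Hy scaler0 addr0.
apply/E'P; move: v vS; apply/subvP/span_subvP => _ /mapP[l lS ->].
apply/E'P; rewrite lieB ?(allP S78) //.
by have /allP /(_ l lS) /nilP -> := ab k kS; rewrite sp_ev_nil.
Qed.

Lemma abelian_ideal_root_span I : abelian_ideals b I ->
  exists2 S, S \in ideal_supports & I = root_span S.
Proof.
move=> [[/subvP Ib /lie_prod_subP Iid] Iab].
have Iab0 u v : u \in I -> v \in I -> lie u v = 0.
  by move=> uI vI; apply/eqP; rewrite -memv0 -Iab; apply: lie_prod_mem.
have bB k : (k < 78)%N -> upper 0 k -> B k \in b.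
  by move=> hk uk; apply/bP/upper_part_basis.
have up0 k : (k < 36)%N -> upper 0 k by rewrite /upper => ->.
have bpos k : (k < 36)%N -> B k \in b by move=> hk; apply: bB (up0 _ hk); lia.
have B0 k : (k < 78)%N -> B k != 0.
  move=> hk; apply/eqP => Bk0; have := crd_basis hB hk hk.
  by rewrite Bk0 crd0 eqxx => /esym /eqP; rewrite oner_eq0.
have bh i : (i < 6)%N -> B (72 + i)%N \in b.
  by move=> hi; apply: bB; [lia | rewrite /upper; lia].
pose p k := B k \in I; exists [seq k <- iota 0 36 | p k].
  apply: ideal_supports_complete => [a i q ha pa hi qs|a c ha pa hc pc].
    have hi36 : (i < 36)%N by lia.
    have := Iid _ _ (bpos i hi36) pa; rewrite lieB; [|lia|lia].
    have := bracket_pos hi36 ha; move: qs; case: (bracket i a) => [|[d l] s] //=.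
    move=> + /and5P[d0 /eqP s0 _ _ _]; rewrite s0 inE => /eqP -> /=; rewrite sp_ev1.
    by rewrite /p rpredZeq intr_eq0 (negPf d0).
  have := Iab0 _ _ pa pc; rewrite lieB; [|lia|lia].
  have := bracket_pos ha hc; case: (bracket a c) => [|[d l] s] //=.
  move=> /and5P[d0 /eqP -> _ _ hl]; rewrite sp_ev1 => /eqP.
  rewrite scaler_eq0 intr_eq0 (negPf d0) (negPf (B0 l _)) //.
  exact: leq_trans hl _.
have S78 : all (fun k => k < 78)%N [seq k <- iota 0 36 | p k].
  by apply/allP => k; rewrite mem_filter mem_iota => /andP[_ hk]; lia.
apply/eqP; rewrite eqEsubv; apply/andP; split; last first.
  by apply/span_subvP => _ /mapP[k + ->]; rewrite mem_filter => /andP[].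
apply/subvP => x xI.
have Ilin c u v : u \in I -> v \in I -> c *: u + v \in I.
  by move=> uI vI; rewrite rpredD ?rpredZ.
have Ireg v : v \in I -> lie (regular B) v \in I.
  apply: Iid; apply: memv_suml => i _; apply/memvZ/bh; exact: ltn_ord.
have xI' : \sum_(k < 78) crd k x *: B k \in I by rewrite -(crd_expand hB).
have [Ik Ih] := weight_components (x := fun k => crd k x) lieB (mem0v I) Ilin Ireg xI'.
(* The component t in the Cartan subalgebra acts on e_j by alpha_j(t), so
   alpha_j(t) e_j is in I and commutes with t. *)
have h0 i : (i < 6)%N -> crd (72 + i) x = 0.
  apply: (cartan_injective (x := fun i => crd (72 + i)%N x)) => j hj.
  set c := (X in X = 0); set t := \sum_(i < 6) _ in Ih.
  have tj : lie t (B j) = c *: B j.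
    rewrite lie_suml scaler_suml; apply: eq_bigr => l _.
    have hl : (72 + l < 78)%N by have := ltn_ord l; lia.
    have hj72 : (j < 72)%N by lia.
    rewrite lieZl lieB ?(leq_trans hj) // (eqP (bracket_h (ltn_ord l) hj72)) sp_ev1.
    by rewrite (eqP (weight_simple _ hj)) // scalerA.
  have cI : c *: B j \in I.
    have hj36 : (j < 36)%N by lia.
    by rewrite -tj lieC rpredN; apply: Iid => //; apply: bpos.
  have := Iab0 _ _ Ih cI; rewrite lieZr tj scalerA => /eqP.
  by rewrite scaler_eq0 (negPf (B0 j _)) ?orbF; [rewrite mulf_eq0 orbb => /eqP | lia].
apply/(root_spanP _ S78) => k hk; rewrite mem_filter mem_iota negb_and.
have xb := (bP x).1 (Ib x xI) k hk.
have [lt36|ge36] /= := ltnP k 36; last first.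
  move=> _; have [lt72|ge72] := ltnP k 72; first by apply: xb; rewrite upper0 // ge36 lt72.
  by rewrite -(subnKC ge72); apply: h0; lia.
rewrite orbF => pk; apply/eqP; apply: contraNT pk => c0.
have hk72 : (k < 72)%N by lia.
by have := Ik k hk72; rewrite rpredZeq (negPf c0).
Qed.

Lemma root_span_inj : {in ideal_supports &, injective root_span}.
Proof.
move=> S T hS hT ST.
have [/and4P[sS S36 _ _] /and4P[sT T36 _ _]] :=
  (allP ideal_supports_sound _ hS, allP ideal_supports_sound _ hT).
have lt78 (U : seq nat) : all (fun a => a < 36)%N U -> all (fun a => a < 78)%N U.
  by apply: sub_all => a ha; lia.
apply: (irr_sorted_eq ltn_trans ltnn sS sT) => k.
have mem_sub (U V : seq nat) : all (fun a => a < 36)%N U -> all (fun a => a < 36)%N V ->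
    root_span U = root_span V -> k \in U -> k \in V.
  move=> U36 V36 UV kU; have hk := allP (lt78 _ U36) _ kU.
  have : B k \in root_span V by rewrite -UV; apply/memv_span/map_f.
  move=> /(root_spanP _ (lt78 _ V36)) H; apply: contraT => kV.
  by have := H k hk kV; rewrite (crd_basis hB) // eqxx => /eqP; rewrite oner_eq0.
by apply/idP/idP; apply: mem_sub.
Qed.

End AbelianIdeals.

Local Open Scope classical_set_scope.
Local Open Scope card_scope.

Lemma card_seq (T : eqType) (s : seq T) : uniq s -> [set` s] #= `I_(size s).
Proof.
case: s => [|x0 s] us; first by rewrite set_nil II0.
set t := x0 :: s in us *.
have -> : [set` t] = [set nth x0 t i | i in `I_(size t)].
  apply/seteqP; split=> [x /= xt|_ /= [i it <-]]; last exact: mem_nth.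
  by exists (index x t); [have := xt; rewrite -index_mem | rewrite nth_index].
by apply: inj_card_eq => i j; rewrite !inE => hi hj /eqP; rewrite nth_uniq // => /eqP.
Qed.

Lemma card_abelian_ideals (K : numClosedFieldType) (g : lieAlgType K) (B : nat -> g)
    (b : {vspace g}) (P : pred nat) :
  E6_basis B -> (forall y, y \in b <-> upper_part B 0 y) ->
  [set I | abelian_ideals b I /\ P (\dim I)]
  #= `I_(count (fun S => P (size S)) ideal_supports).
Proof.
move=> hB bP; pose L := [seq root_span B T | T <- ideal_supports & P (size T)].
have dimS S : S \in ideal_supports -> \dim (root_span B S) = size S.
  move=> /(allP ideal_supports_sound) /and4P[sS S36 _ _].
  apply: (dim_root_span hB); last exact: sorted_uniq ltn_trans ltnn _ sS.
  by apply: sub_all S36 => a ha; lia.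
have -> : [set I | abelian_ideals b I /\ P (\dim I)] = [set` L].
  apply/seteqP; split=> [I /= [abI PI]|_ /= /mapP[S + ->]].
    have [S hS IE] := abelian_ideal_root_span hB bP abI.
    by apply/mapP; exists S; rewrite // mem_filter hS andbT -dimS // -IE.
  rewrite mem_filter => /andP[PS hS]; split; last by rewrite dimS.
  exact/(root_span_ideal hB bP)/(allP ideal_supports_sound).
have <- : size L = count (fun S => P (size S)) ideal_supports.
  by rewrite size_map size_filter.
apply: card_seq; rewrite map_inj_in_uniq ?filter_uniq ?ideal_supports_uniq //.
move=> S T; rewrite !mem_filter => /andP[_ hS] /andP[_ hT].
exact: (root_span_inj hB).
Qed.

Theorem mainTheorem7 (R : realType) (g : lieAlgType R[i]) (b : {vspace g})
    (g_E6 : simple_of_type_E6 g) (b_borel : borel_subalgebra b) :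
  [/\ forall m : nat, (m <= 16)%N ->
        [set I | abelian_ideals b I /\ \dim I = m] #=
        `I_(nth 0%N [:: 1; 1; 1; 1; 2; 3; 3; 4; 6; 7; 8; 10; 7; 4; 2; 2; 2]%N m),
      forall m : nat, (17 <= m)%N ->
        [set I | abelian_ideals b I /\ \dim I = m] #= `I_0 &
      abelian_ideals b #= `I_64].
Proof.
have [B hB bP] := borel_standard g_E6 b_borel.
have dim_eq m : [set I | abelian_ideals b I /\ \dim I = m]
    #= `I_(count (fun S => size S == m) ideal_supports).
  have -> : [set I | abelian_ideals b I /\ \dim I = m]
      = [set I | abelian_ideals b I /\ pred1 m (\dim I)].
    by apply/seteqP; split=> I /= [abI /eqP dI]; split=> //; apply/eqP.
  exact: (card_abelian_ideals (pred1 m) hB bP).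
split=> [m le_m|m lt_m|].
- by rewrite -ideal_supports_sizes (nth_map 0%N) ?size_iota // nth_iota.
- have <- : count (fun S => size S == m) ideal_supports = 0%N; last exact: dim_eq.
  apply/eqP; rewrite eqn0Ngt -has_count; apply/hasPn => S /(allP ideal_supports_le16).
  by move=> le16; apply/negP => /eqP Sm; lia.
have -> : abelian_ideals b = [set I | abelian_ideals b I /\ predT (\dim I)].
  by apply/seteqP; split=> I //= [].
by have := card_abelian_ideals predT hB bP; rewrite count_predT ideal_supports_size.
Qed.
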